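(* Let $k\ge 0$ and let $\Gamma(\vec{x})\cup\Delta(\vec{x})\subseteq\hat{U}_k$. Then $I\hat{U}_k\vdash\Gamma(\vec{x})\Rightarrow\Delta(\vec{x})$ if and only if $\Gamma\rhd_d^{(\hat{U}_k,\mathcal{R})}\Delta$.
   Context: **Base theory.** The language is $\{0,1,+,-,\cdot,\lfloor\frac{\cdot}{\cdot}\rfloor,\le\}$. $\mathcal{R}$ is the theory of commutative discrete ordered semirings (commutative ring axioms without additive inverses, plus: $\le$ is a total discrete order with $<$ compatible with addition and with multiplication by non-zero elements) together with $(x\ge y\to (x-y)+y=x)\wedge(x<y\to x-y=0)$ and $((y+1)\cdot\lfloor\frac{x}{y}\rfloor\le x)\wedge(x-(y+1)\cdot\lfloor\frac{x}{y}\rfloor<y+1)$ (so $\lfloor\frac{x}{y}\rfloor$ really denotes $\lfloor x/(y+1)\rfloor$). **Classes.** For a class $\Phi$ containing the quantifier-free formulas and closed under boolean operations, $\Pi_0(\Phi)=\Sigma_0(\Phi)=\Phi$; $\Sigma_{k+1}(\Phi)$ consists of formulas with a block of bounded existential quantifiers in front of a $\Pi_k(\Phi)$ formula, and $\Pi_{k+1}(\Phi)$ of formulas with a block of bounded universal quantifiers in front of a $\Sigma_k(\Phi)$ formula. $\hat U_k$ is $\Pi_k(\Phi)$ with $\Phi$ the quantifier-free formulas of the language $\{0,1,+,-,\cdot,\lfloor\frac{\cdot}{\cdot}\rfloor,\le\}$. Boolean combinations such as $\bigwedge\Gamma$, $\bigvee\Delta$ are replaced by $\mathcal{R}$-equivalent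 prenex formulas in the relevant class. $I\hat U_k$ is $\mathcal{R}$ plus induction $A(0)\wedge\forall x(A(x)\to A(x+1))\to\forall x\,A(x)$ for $A\in\hat U_k$. A theory proves $\Gamma\Rightarrow\Delta$ iff it proves $\bigwedge\Gamma\to\bigvee\Delta$. **Deterministic reductions** (over a base theory $\mathcal{B}$). For $A,B$ both in $\Pi_k(\Phi)$ or both in $\Sigma_k(\Phi)$ and a sequence of terms $F=(F_i)_{i=1}^k$, define $A\le_d^{F,k}B$ by recursion on $k$. For $k=0$: $F$ is empty and $\mathcal{B}\vdash A\to B$. If $A=\forall\vec u\le\vec p(\vec x)\,C(\vec x,\vec u)$, $B=\forall\vec v\le\vec q(\vec x)\,D(\vec x,\vec v)$: $A\le_d^{F,k+1}B$ iff $\mathcal{B}\vdash\vec v\le\vec q(\vec x)\to F_{k+1}(\vec x,\vec v)\le\vec p(\vec x)$ and $\big(F_{k+1}(\vec x,\vec v)\le\vec p(\vec x)\to C(\vec x,F_{k+1}(\vec x,\vec v))\big)\le_d^{\hat F,k}\big(\vec v\le\vec q(\vec x)\to D(\vec x,\vec v)\big)$ with $\hat F=(F_i)_{i=1}^{k}$. If $A=\exists\vec u\le\vec p(\vec x)\,C$, $B=\exists\vec v\le\vec q(\vec x)\,D$: iff $\mathcal{B}\vdash\vec u\le\vec p(\vec x)\to F_{k+1}(\vec x,\vec u)\le\vec q(\vec x)$ and $\big(\vec u\le\vec p(\vec x)\wedge C(\vec x,\vec u)\big)\le_d^{\hat F,k}\big(F_{k+1}(\vec x,\vec u)\le\vec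 q(\vec x)\wedge D(\vec x,F_{k+1}(\vec x,\vec u))\big)$. $A\equiv_d^{(E_0,E_1)}B$ means $A\le_d^{E_0}B$ and $B\le_d^{E_1}A$. **Deterministic flow.** $A\rhd_d^{(\Pi_k(\Phi),\mathcal{B})}B$ (for $A,B\in\Pi_k(\Phi)$) means there are a term $t(\vec x)$, a formula $H(u,\vec x)\in\Pi_k(\Phi)$ and sequences of terms $E_0,E_1,G_0,G_1,F(u)$ such that, provably in $\mathcal{B}$: $H(0,\vec x)\equiv_d^{(E_0,E_1)}A(\vec x)$; $H(t(\vec x),\vec x)\equiv_d^{(G_0,G_1)}B(\vec x)$; and for all $u<t(\vec x)$, $H(u,\vec x)\le_d^{F(u)}H(u+1,\vec x)$. $\Gamma\rhd_d\Delta$ means $\bigwedge\Gamma\rhd_d\bigvee\Delta$. *)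

(* Defs.v *)
From Stdlib Require List.
From mathcomp Require Import all_boot.

Set Implicit Arguments.
Unset Strict Implicit.
Unset Printing Implicit Defensive.

(** * First-order syntax, with de Bruijn indices *)

(* [TDiv x y] is the function symbol written |_ x / y _|; the axioms below make
   it denote the integer part of x / (y + 1). *)
Inductive term : Type :=
| Var of nat
| TZero
| TOne
| TAdd of term & term
| TSub of term & term
| TMul of term & term
| TDiv of term & term.

Inductive form : Type :=
| FFalse
| FEq of term & term
| FLe of term & term
| FImp of form & form
| FAnd of form & form
| FOr of form & form
| FAll of form
| FEx of form.

Definition FTrue : form := FImp FFalse FFalse.
Definition FNot (A : form) : form := FImp A FFalse.
Definition FLt (s t : term) : form := FAnd (FLe s t) (FNot (FEq s t)).
Definition FBigAnd (As : seq form) : form := foldr FAnd FTrue As.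
Definition FBigOr (As : seq form) : form := foldr FOr FFalse As.

Fixpoint qfree (A : form) : bool :=
  match A with
  | FFalse | FEq _ _ | FLe _ _ => true
  | FImp B C | FAnd B C | FOr B C => qfree B && qfree C
  | FAll _ | FEx _ => false
  end.

Fixpoint tsubst (s : nat -> term) (t : term) : term :=
  match t with
  | Var i => s i
  | TZero => TZero
  | TOne => TOne
  | TAdd a b => TAdd (tsubst s a) (tsubst s b)
  | TSub a b => TSub (tsubst s a) (tsubst s b)
  | TMul a b => TMul (tsubst s a) (tsubst s b)
  | TDiv a b => TDiv (tsubst s a) (tsubst s b)
  end.

Definition shift (m : nat) : nat -> term := fun i => Var (m + i).
Definition tshift (m : nat) : term -> term := tsubst (shift m).

Definition scons (t : term) (s : nat -> term) : nat -> term :=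
  fun i => if i is j.+1 then s j else t.
Definition up (s : nat -> term) : nat -> term :=
  scons (Var 0) (fun i => tshift 1 (s i)).
Definition upn (m : nat) (s : nat -> term) : nat -> term := iter m up s.

Fixpoint fsubst (s : nat -> term) (A : form) : form :=
  match A with
  | FFalse => FFalse
  | FEq a b => FEq (tsubst s a) (tsubst s b)
  | FLe a b => FLe (tsubst s a) (tsubst s b)
  | FImp B C => FImp (fsubst s B) (fsubst s C)
  | FAnd B C => FAnd (fsubst s B) (fsubst s C)
  | FOr B C => FOr (fsubst s B) (fsubst s C)
  | FAll B => FAll (fsubst (up s) B)
  | FEx B => FEx (fsubst (up s) B)
  end.

Definition fshift (m : nat) : form -> form := fsubst (shift m).
Definition finst (t : term) : form -> form := fsubst (scons t Var).

(** * Provability: classical natural deduction with equality *)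

(* Open axioms of [T] stand for their universal closures: [FAll_intro] shifts
   the hypotheses in [G] but puts no eigenvariable condition on [T]. *)
Inductive prv (T : form -> Prop) : seq form -> form -> Prop :=
| Hyp G A : List.In A G -> prv T G A
| Axm G A : T A -> prv T G A
| FFalse_classical G A : prv T (FNot A :: G) FFalse -> prv T G A
| FImp_intro G A B : prv T (A :: G) B -> prv T G (FImp A B)
| FImp_elim G A B : prv T G (FImp A B) -> prv T G A -> prv T G B
| FAnd_intro G A B : prv T G A -> prv T G B -> prv T G (FAnd A B)
| FAnd_elim1 G A B : prv T G (FAnd A B) -> prv T G A
| FAnd_elim2 G A B : prv T G (FAnd A B) -> prv T G B
| FOr_intro1 G A B : prv T G A -> prv T G (FOr A B)
| FOr_intro2 G A B : prv T G B -> prv T G (FOr A B)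
| FOr_elim G A B C :
    prv T G (FOr A B) -> prv T (A :: G) C -> prv T (B :: G) C -> prv T G C
| FAll_intro G A : prv T (map (fshift 1) G) A -> prv T G (FAll A)
| FAll_elim G A t : prv T G (FAll A) -> prv T G (finst t A)
| FEx_intro G A t : prv T G (finst t A) -> prv T G (FEx A)
| FEx_elim G A B :
    prv T G (FEx A) -> prv T (A :: map (fshift 1) G) (fshift 1 B) -> prv T G B
| FEq_refl G t : prv T G (FEq t t)
| FEq_elim G A s t :
    prv T G (FEq s t) -> prv T G (finst s A) -> prv T G (finst t A).

Definition proves (T : form -> Prop) (A : form) : Prop := prv T [::] A.

Definition proves_seq (T : form -> Prop) (Gamma Delta : seq form) : Prop :=
  proves T (FImp (FBigAnd Gamma) (FBigOr Delta)).

(** * The base theory R *)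

Definition R_axioms : seq form :=
  let x := Var 0 in let y := Var 1 in let z := Var 2 in
  [:: (* commutative semiring *)
      FEq (TAdd (TAdd x y) z) (TAdd x (TAdd y z));
      FEq (TAdd x y) (TAdd y x);
      FEq (TAdd x TZero) x;
      FEq (TMul (TMul x y) z) (TMul x (TMul y z));
      FEq (TMul x y) (TMul y x);
      FEq (TMul x TOne) x;
      FEq (TMul x (TAdd y z)) (TAdd (TMul x y) (TMul x z));
      FEq (TMul x TZero) TZero;
      (* total order *)
      FLe x x;
      FImp (FAnd (FLe x y) (FLe y z)) (FLe x z);
      FImp (FAnd (FLe x y) (FLe y x)) (FEq x y);
      FOr (FLe x y) (FLe y x);
      (* discreteness *)
      FLt TZero TOne;
      FImp (FLt TZero x) (FLe TOne x);
      (* compatibility of < with the operations *)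
      FImp (FLt x y) (FLt (TAdd x z) (TAdd y z));
      FImp (FAnd (FNot (FEq z TZero)) (FLt x y)) (FLt (TMul x z) (TMul y z));
      (* truncated subtraction *)
      FAnd (FImp (FLe y x) (FEq (TAdd (TSub x y) y) x))
           (FImp (FLt x y) (FEq (TSub x y) TZero));
      (* integer division by y + 1 *)
      FAnd (FLe (TMul (TAdd y TOne) (TDiv x y)) x)
           (FLt (TSub x (TMul (TAdd y TOne) (TDiv x y))) (TAdd y TOne))].

Definition R : form -> Prop := fun A => List.In A R_axioms.

(** * Bounded quantifier prefixes *)

Inductive quant := Univ | Exis.
Definition dual (Q : quant) : quant := if Q is Univ then Exis else Univ.

(* [prenex k] is a matrix preceded by [k] blocks of bounded quantifiers.  A
   block is the vector of its bounds, which may not mention the variables of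
   the block itself; in the scope of a block of length m, the index i < m is
   the variable bounded by the i-th entry and m + j is the outer variable j.
   The kinds of the blocks alternate, so that the kind of the outermost one is
   all that is needed to read an element of [prenex k] as a formula: [Univ]
   for the class Pi_k and [Exis] for the class Sigma_k. *)
Fixpoint prenex (k : nat) : Type :=
  if k is k'.+1 then (seq term * prenex k')%type else form.

Fixpoint matrix (k : nat) : prenex k -> form :=
  match k return prenex k -> form with
  | 0 => fun M => M
  | k'.+1 => fun A => matrix A.2
  end.

Definition bquant (Q : quant) (p : term) (A : form) : form :=
  match Q with
  | Univ => FAll (FImp (FLe (Var 0) (tshift 1 p)) A)
  | Exis => FEx (FAnd (FLe (Var 0) (tshift 1 p)) A)
  end.

(* The 0-th variable of the block is quantified innermost. *)
Fixpoint bquants (Q : quant) (ps : seq term) (A : form) : form :=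
  if ps is p :: ps' then bquants Q ps' (bquant Q (tshift (size ps') p) A)
  else A.

Fixpoint pform (Q : quant) (k : nat) : prenex k -> form :=
  match k return prenex k -> form with
  | 0 => fun M => M
  | k'.+1 => fun A => bquants Q A.1 (pform (dual Q) A.2)
  end.

(* Membership in Pi_k(Phi), or in Sigma_k(Phi), depending on the reading. *)
Definition over (Phi : pred form) (k : nat) : pred (prenex k) :=
  fun A => Phi (matrix A).

Definition Uhat (k : nat) : pred (prenex k) := @over qfree k.

Fixpoint psubst (s : nat -> term) (k : nat) : prenex k -> prenex k :=
  match k return prenex k -> prenex k with
  | 0 => fun M => fsubst s M
  | k'.+1 => fun A =>
      (map (tsubst s) A.1, psubst (upn (size A.1) s) A.2)
  end.

(* Prenex form of [op B A], for [op] an implication or a conjunction and [B]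
   quantifier-free: [B] is moved to the matrix.  This is an equivalence over R,
   where all the domains [u <= p] of the quantifiers are nonempty. *)
Fixpoint pguard (op : form -> form -> form) (B : form) (k : nat) :
    prenex k -> prenex k :=
  match k return prenex k -> prenex k with
  | 0 => fun M => op B M
  | k'.+1 => fun A => (A.1, pguard op (fshift (size A.1) B) A.2)
  end.

(* Prenex form of [op A B], for [op] a conjunction or a disjunction: blocks of
   the same depth, which are of the same kind, are concatenated. *)
Fixpoint pmerge (op : form -> form -> form) (k : nat) :
    prenex k -> prenex k -> prenex k :=
  match k return prenex k -> prenex k -> prenex k with
  | 0 => fun M N => op M N
  | k'.+1 => fun A B =>
      (A.1 ++ B.1,
       pmerge op (psubst (upn (size A.1) (shift (size B.1))) A.2)
                 (psubst (shift (size A.1)) B.2))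
  end.

Fixpoint pconst (M : form) (k : nat) : prenex k :=
  match k return prenex k with
  | 0 => M
  | k'.+1 => ([::], pconst M k')
  end.

Definition pBigAnd (k : nat) (As : seq (prenex k)) : prenex k :=
  foldr (@pmerge FAnd k) (pconst FTrue k) As.
Definition pBigOr (k : nat) (As : seq (prenex k)) : prenex k :=
  foldr (@pmerge FOr k) (pconst FFalse k) As.

(** * The theories IU_k *)

(* The induction variable of [A] is the index 0, the others are parameters. *)
Definition induction (A : form) : form :=
  FImp (FAnd (finst TZero A)
             (FAll (FImp A (fsubst (scons (TAdd (Var 0) TOne) (shift 1)) A))))
       (FAll A).

Definition IU (k : nat) : form -> Prop := fun B =>
  R B \/ exists A : prenex k, Uhat A /\ B = induction (pform Univ A).

(** * Deterministic reductions *)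

Definition vars (m : nat) : seq term := mkseq Var m.

(* Only meaningful for vectors of the same length. *)
Definition FLes (s t : seq term) : form :=
  FBigAnd [seq FLe ab.1 ab.2 | ab <- zip s t].

(* Replaces the block of variables in scope, of length [size f], by the terms
   [f], which live in the scope of another block, of length [m]. *)
Definition reblock (f : seq term) (m : nat) : nat -> term :=
  fun i => if i < size f then nth TZero f i else Var (m + (i - size f)).

(* [dred T Q F G A B] is the reduction from A to B over the theory T, under the
   additional hypotheses G (needed because the steps of a flow are only
   required below the bound on its length).  A sequence (F_1, ..., F_k) of
   vectors of terms is the restriction to 1 .. k of a function on nat. *)
Fixpoint dred (T : form -> Prop) (Q : quant) (F : nat -> seq term)
    (G : seq form) (k : nat) : prenex k -> prenex k -> Prop :=
  match k return prenex k -> prenex k -> Prop with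
  | 0 => fun A B => prv T G (FImp A B)
  | k'.+1 => fun A B =>
      let: (p, C) := A in
      let: (q, D) := B in
      let f := F k'.+1 in
      let m := size p in
      let n := size q in
      match Q with
      | Univ =>
          let v_le_q := FLes (vars n) (map (tshift n) q) in
          let f_le_p := FLes f (map (tshift n) p) in
          let G' := map (fshift n) G in
          [/\ size f = m,
              prv T G' (FImp v_le_q f_le_p)
            & dred T Exis F G'
                (pguard FImp f_le_p (psubst (reblock f n) C))
                (pguard FImp v_le_q D)]
      | Exis =>
          let u_le_p := FLes (vars m) (map (tshift m) p) in
          let f_le_q := FLes f (map (tshift m) q) in
          let G' := map (fshift m) G in
          [/\ size f = n,
              prv T G' (FImp u_le_p f_le_q)
            & dred T Univ F G'
                (pguard FAnd u_le_p C)
                (pguard FAnd f_le_q (psubst (reblock f m) D))]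
      end
  end.

Definition dequiv (T : form -> Prop) (Q : quant) (E0 E1 : nat -> seq term)
    (G : seq form) (k : nat) (A B : prenex k) : Prop :=
  dred T Q E0 G A B /\ dred T Q E1 G B A.

(** * Deterministic flows *)

(* The index 0 of [H] and of the terms [F] is the step u of the flow, and
   i + 1 is the variable i of [A], [B] and [t]. *)
Definition dflow (Phi : pred form) (T : form -> Prop) (k : nat)
    (A B : prenex k) : Prop :=
  exists (t : term) (H : prenex k) (E0 E1 G0 G1 F : nat -> seq term),
    [/\ over Phi H,
        dequiv T Univ E0 E1 [::] (psubst (scons TZero Var) H) A,
        dequiv T Univ G0 G1 [::] (psubst (scons t Var) H) B
      & dred T Univ F [:: FLt (Var 0) (tshift 1 t)]
          H (psubst (scons (TAdd (Var 0) TOne) (shift 1)) H)].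

Definition dflow_seq (Phi : pred form) (T : form -> Prop) (k : nat)
    (Gamma Delta : seq (prenex k)) : Prop :=
  dflow Phi T (pBigAnd Gamma) (pBigOr Delta).

(* Main.v *)
(* By completeness of first-order logic, a deterministic reduction is a uniform
   strategy, made of terms, in a game played on all models of [R] at once.  Up
   to such strategies, flows preorder the prenex formulas; the additive
   conjunction [forall b <= 1, if b = 0 then A else B] is a meet, blockwise
   disjunction is a join up to contraction, and meets distribute over joins.
   Flows are closed under the induction rule: concatenate the flows from [I(y)]
   to [I(y + 1)] for [y <= t], recovering [y] from the step number by division.

   The two laws which are not evident, the contraction [A \/ A |> A] and the
   excluded middle for [Sigma_(k-1)], follow from the theorem for [k - 1]:
   there they are provable, and negating a flow turns it around and raises it
   by one block.

   If there is no flow from [A] to [B], saturate the pair [(A, B)] to a prime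
   pair, preserving the absence of flows, with witnesses for the bounded
   quantifiers and for failing instances of induction.  Its term model
   satisfies [IU k], [A] and not [B].  The converse is induction along the flow. *)

From Stdlib Require Import FunctionalExtensionality PropExtensionality.
From Stdlib Require Import ProofIrrelevance Classical ClassicalEpsilon.
Require Import Defs.
From HB Require Import structures.
From mathcomp Require Import all_boot.

Set Implicit Arguments.
Unset Strict Implicit.
Unset Printing Implicit Defensive.

(** The obstacle is that a reduction answers every block once and cannot return to it. In a
    blockwise [A /\ A] the opponent asks for two instances of the first block, and a single copy of
    [A] supplies only one, so blockwise conjunction is not a meet; the additive one lets the
    opponent choose a side first. Disjunctions admit no such remedy: choosing a disjunct is an
    existential move, while a Pi formula begins with a universal block. So disjunction stays
    blockwise, and contraction, on which joins and the cut rule rest, needs genuine flows. Once the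
    two outer blocks are identified it concerns Sigma formulas only, whose negations are Pi formulas
    one level lower; there semantic truth already yields flows.

    Saturation shows without negation that what holds is true. Excluded middle serves the converse:
    a formula that fails has a failing instance, the negation of the instance then holds, hence is
    true.

    The work is done on game trees over models of [R], where propositional rearrangements become
    equalities. Completeness returns to derivations only at the end. *)

Ltac funext i := apply: functional_extensionality => i.

Lemma propext (A B : Prop) : (A <-> B) -> A = B.
Proof. exact: propositional_extensionality. Qed.

Lemma forall_ext T (P Q : T -> Prop) :
  (forall x, P x = Q x) -> (forall x, P x) = (forall x, Q x).
Proof. by move=> e; apply: propext; split=> h x; [rewrite -e | rewrite e]. Qed.

Lemma exists_ext T (P Q : T -> Prop) :
  (forall x, P x = Q x) -> (exists x, P x) = (exists x, Q x).
Proof.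
by move=> e; apply: propext; split=> -[x h]; exists x; [rewrite -e | rewrite e].
Qed.

(** * Substitution *)

Lemma tsubst_comp s s' t :
  tsubst s (tsubst s' t) = tsubst (fun i => tsubst s (s' i)) t.
Proof. by elim: t => //= a -> b ->. Qed.

Lemma tsubst_id t : tsubst Var t = t.
Proof. by elim: t => //= a -> b ->. Qed.

Lemma tsubst_up_shift s t : tsubst (up s) (tshift 1 t) = tshift 1 (tsubst s t).
Proof. by rewrite /tshift !tsubst_comp. Qed.

Lemma up_comp s s' :
  (fun i => tsubst (up s) (up s' i)) = up (fun i => tsubst s (s' i)).
Proof. by funext i; case: i => [|i] //=; rewrite tsubst_up_shift. Qed.

Lemma up_id : up Var = Var.
Proof. by funext i; case: i. Qed.

Lemma fsubst_comp s s' A :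
  fsubst s (fsubst s' A) = fsubst (fun i => tsubst s (s' i)) A.
Proof.
elim: A s s' => [|a b|a b|B IB C IC|B IB C IC|B IB C IC|B IB|B IB] s s' //=;
  rewrite ?tsubst_comp ?IB ?IC ?up_comp //.
Qed.

Lemma fsubst_id A : fsubst Var A = A.
Proof. by elim: A => //= *; rewrite ?tsubst_id ?up_id; congruence. Qed.

Lemma finst_up t s B : finst t (fsubst (up s) B) = fsubst (scons t s) B.
Proof.
rewrite /finst fsubst_comp; congr (fsubst _ B).
by funext i; case: i => [|i] //=; rewrite /tshift tsubst_comp tsubst_id.
Qed.

Lemma fsubst_finst s t A :
  fsubst s (finst t A) = finst (tsubst s t) (fsubst (up s) A).
Proof.
rewrite finst_up /finst fsubst_comp; congr (fsubst _ A).
by funext i; case: i.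
Qed.

Lemma fsubst_fshift s A :
  fsubst (up s) (fshift 1 A) = fshift 1 (fsubst s A).
Proof. by rewrite /fshift !fsubst_comp. Qed.

Lemma map_fsubst_fshift s G :
  map (fsubst (up s)) (map (fshift 1) G) = map (fshift 1) (map (fsubst s) G).
Proof. by rewrite -!map_comp; apply: eq_map => A /=; rewrite fsubst_fshift. Qed.

Lemma tinst_shift t a : tsubst (scons t Var) (tshift 1 a) = a.
Proof. by rewrite /tshift tsubst_comp tsubst_id. Qed.

(** A strict upper bound on the free indices, so that [Var b] is fresh for whatever is bounded by
    [b]. *)
Fixpoint tb (t : term) : nat :=
  match t with
  | Var i => i.+1
  | TZero | TOne => 0
  | TAdd a b | TSub a b | TMul a b | TDiv a b => maxn (tb a) (tb b)
  end.

Fixpoint fb (A : form) : nat :=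
  match A with
  | FFalse => 0
  | FEq a b | FLe a b => maxn (tb a) (tb b)
  | FImp B C | FAnd B C | FOr B C => maxn (fb B) (fb C)
  | FAll B | FEx B => (fb B).-1
  end.

Lemma tsubst_ext s s' t :
  (forall i, i < tb t -> s i = s' i) -> tsubst s t = tsubst s' t.
Proof.
elim: t => [i|||a IA b IB|a IA b IB|a IA b IB|a IA b IB] //= h; first exact: h.
all: by rewrite IA ?IB // => i hi; apply: h; rewrite leq_max hi ?orbT.
Qed.

Lemma fsubst_ext s s' A :
  (forall i, i < fb A -> s i = s' i) -> fsubst s A = fsubst s' A.
Proof.
elim: A s s' => [|a b|a b|B IB C IC|B IB C IC|B IB C IC|B IB|B IB] s s' //= h.
1,2: by rewrite !(tsubst_ext (s' := s')) // => i hi; apply: h;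
        rewrite leq_max hi ?orbT.
1-3: by rewrite (IB s s') ?(IC s s') // => i hi; apply: h;
        rewrite leq_max hi ?orbT.
all: rewrite (IB (up s) (up s')) // => -[|i] //= hi; rewrite h //;
     by case: (fb B) hi.
Qed.

(** * Structures and soundness *)

Record struct := Struct {
  dom :> Type;
  s0 : dom; s1 : dom;
  sadd : dom -> dom -> dom; ssub : dom -> dom -> dom;
  smul : dom -> dom -> dom; sdiv : dom -> dom -> dom;
  sle : dom -> dom -> Prop }.
Arguments s0 {s}.
Arguments s1 {s}.

Implicit Type M : struct.

Section Semantics.
Variable M : struct.
Implicit Types (r : nat -> M).

Fixpoint ev r (t : term) : M :=
  match t with
  | Var i => r i
  | TZero => s0
  | TOne => s1
  | TAdd a b => sadd (ev r a) (ev r b)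
  | TSub a b => ssub (ev r a) (ev r b)
  | TMul a b => smul (ev r a) (ev r b)
  | TDiv a b => sdiv (ev r a) (ev r b)
  end.

Definition econs (x : M) r : nat -> M := fun i => if i is j.+1 then r j else x.

Fixpoint sat r (A : form) : Prop :=
  match A with
  | FFalse => False
  | FEq a b => ev r a = ev r b
  | FLe a b => sle (ev r a) (ev r b)
  | FImp B C => sat r B -> sat r C
  | FAnd B C => sat r B /\ sat r C
  | FOr B C => sat r B \/ sat r C
  | FAll B => forall x, sat (econs x r) B
  | FEx B => exists x, sat (econs x r) B
  end.

Definition sb (s : nat -> term) r : nat -> M := fun i => ev r (s i).

Lemma ev_subst s t r : ev r (tsubst s t) = ev (sb s r) t.
Proof. by elim: t => //= a -> b ->. Qed.

Lemma sb_comp s s' r : sb s' (sb s r) = sb (fun i => tsubst s (s' i)) r.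
Proof. by funext i; rewrite /sb ev_subst. Qed.

Lemma sb_id r : sb Var r = r. Proof. by funext i. Qed.

Lemma sb_scons t s r : sb (scons t s) r = econs (ev r t) (sb s r).
Proof. by funext i; case: i. Qed.

Lemma sb_up s x r : sb (up s) (econs x r) = econs x (sb s r).
Proof. by funext i; case: i => [|i] //=; rewrite /sb /= ev_subst. Qed.

Lemma sat_subst s A r : sat r (fsubst s A) = sat (sb s r) A.
Proof.
elim: A s r => [|a b|a b|B IB C IC|B IB C IC|B IB C IC|B IB|B IB] s r //=;
  rewrite ?ev_subst ?IB ?IC //.
- by apply: forall_ext => x; rewrite IB sb_up.
- by apply: exists_ext => x; rewrite IB sb_up.
Qed.

Lemma sat_finst t A r : sat r (finst t A) = sat (econs (ev r t) r) A.
Proof. by rewrite sat_subst sb_scons sb_id. Qed.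

Lemma sat_fshift1 x A r : sat (econs x r) (fshift 1 A) = sat r A.
Proof. by rewrite sat_subst. Qed.

Definition sats r (G : seq form) := forall B, List.In B G -> sat r B.

Lemma sats_fshift1 x r G : sats r G -> sats (econs x r) (map (fshift 1) G).
Proof.
by move=> hG B /List.in_map_iff [C [<- hC]]; rewrite sat_fshift1; apply: hG.
Qed.

Lemma sats_cons r B G : sat r B -> sats r G -> sats r (B :: G).
Proof. by move=> hB hG C [<- | /hG]. Qed.

Definition model (T : form -> Prop) := forall A, T A -> forall r, sat r A.

Lemma soundness T G A r : model T -> prv T G A -> sats r G -> sat r A.
Proof.
move=> hM hp; elim: hp r => {G A}.
- by move=> G A hA r; apply.
- by move=> G A hA r _; apply: hM.
- move=> G A _ IH r hG; apply: NNPP => hA.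
  by apply: (IH r); apply: sats_cons.
- by move=> G A B _ IH r hG /= hA; apply: IH; apply: sats_cons.
- by move=> G A B _ IH1 _ IH2 r hG; apply: (IH1 r hG); apply: IH2.
- by move=> G A B _ IH1 _ IH2 r hG; split; [apply: IH1 | apply: IH2].
- by move=> G A B _ IH r hG; case: (IH r hG).
- by move=> G A B _ IH r hG; case: (IH r hG).
- by move=> G A B _ IH r hG; left; apply: IH.
- by move=> G A B _ IH r hG; right; apply: IH.
- move=> G A B C _ IH _ IH1 _ IH2 r hG.
  by case: (IH r hG) => h; [apply: IH1 | apply: IH2]; apply: sats_cons.
- by move=> G A _ IH r hG x; apply: IH; apply: sats_fshift1.
- by move=> G A t _ IH r hG; rewrite sat_finst; apply: (IH r hG).
- by move=> G A t _ IH r hG; exists (ev r t); rewrite -sat_finst; apply: IH.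
- move=> G A B _ IH _ IH2 r hG; case: (IH r hG) => x hx.
  rewrite -(sat_fshift1 x); apply: IH2; apply: sats_cons => //.
  exact: sats_fshift1.
- by [].
- move=> G A s t _ IH _ IH2 r hG; rewrite sat_finst -(IH r hG) -sat_finst.
  exact: IH2.
Qed.

Lemma ev_ext r r' t : (forall i, i < tb t -> r i = r' i) -> ev r t = ev r' t.
Proof.
elim: t => [i|||a IA b IB|a IA b IB|a IA b IB|a IA b IB] //= h; first exact: h.
all: by rewrite IA ?IB // => i hi; apply: h; rewrite leq_max hi ?orbT.
Qed.

Lemma sat_ext r r' A : (forall i, i < fb A -> r i = r' i) -> sat r A = sat r' A.
Proof.
elim: A r r' => [|a b|a b|B IB C IC|B IB C IC|B IB C IC|B IB|B IB] r r' //= h.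
1,2: by rewrite !(ev_ext (r' := r')) // => i hi; apply: h;
        rewrite leq_max hi ?orbT.
1-3: by rewrite (IB r r') ?(IC r r') // => i hi; apply: h;
        rewrite leq_max hi ?orbT.
1: apply: forall_ext => x.
2: apply: exists_ext => x.
all: apply: IB => -[|i] //= hi; rewrite h //; by case: (fb B) hi.
Qed.

End Semantics.

(** * Completeness *)

Section Derivations.
Variable T : form -> Prop.
Implicit Types (G : seq form) (A B : form).

Lemma prv_weak G G' A :
  prv T G A -> (forall B, List.In B G -> List.In B G') -> prv T G' A.
Proof.
have inc (B : form) (H H' : seq form) : (forall B, List.In B H -> List.In B H') ->
    forall C, List.In C (B :: H) -> List.In C (B :: H').
  by move=> h C /= [-> | /h hC]; [left | right].
have incm (H H' : seq form) : (forall B, List.In B H -> List.In B H') ->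
    forall C, List.In C (map (fshift 1) H) -> List.In C (map (fshift 1) H').
  by move=> h C /List.in_map_iff [B [<- /h hB]]; apply: List.in_map.
move=> hp; elim: hp G' => {G A}.
- by move=> G A hA G' h; apply: Hyp; apply: h.
- by move=> G A hA G' h; apply: Axm.
- by move=> G A _ IH G' h; apply: FFalse_classical; apply: IH; apply: inc.
- by move=> G A B _ IH G' h; apply: FImp_intro; apply: IH; apply: inc.
- by move=> G A B _ IH1 _ IH2 G' h; apply: FImp_elim (IH1 _ h) (IH2 _ h).
- by move=> G A B _ IH1 _ IH2 G' h; apply: FAnd_intro; auto.
- by move=> G A B _ IH G' h; apply: FAnd_elim1 (IH _ h).
- by move=> G A B _ IH G' h; apply: FAnd_elim2 (IH _ h).
- by move=> G A B _ IH G' h; apply: FOr_intro1; auto.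
- by move=> G A B _ IH G' h; apply: FOr_intro2; auto.
- move=> G A B C _ IH _ IH1 _ IH2 G' h.
  by apply: FOr_elim (IH _ h) (IH1 _ _) (IH2 _ _); apply: inc.
- by move=> G A _ IH G' h; apply: FAll_intro; apply: IH; apply: incm.
- by move=> G A t _ IH G' h; apply: FAll_elim (IH _ h).
- by move=> G A t _ IH G' h; apply: FEx_intro (IH _ h).
- move=> G A B _ IH _ IH2 G' h; apply: FEx_elim (IH _ h) (IH2 _ _).
  by apply/inc/incm.
- by move=> G t G' _; apply: FEq_refl.
- by move=> G A s t _ IH _ IH2 G' h; apply: FEq_elim (IH _ h) (IH2 _ h).
Qed.

Lemma prv_cons G A B : prv T G A -> prv T (B :: G) A.
Proof. by move=> h; apply: prv_weak h _ => C hC; right. Qed.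

Lemma prv_cut G A B : prv T G A -> prv T (A :: G) B -> prv T G B.
Proof. by move=> hA hB; apply: FImp_elim hA; apply: FImp_intro. Qed.

Lemma prv_hd G A : prv T (A :: G) A. Proof. by apply: Hyp; left. Qed.

Lemma prv_exfalso G A : prv T G FFalse -> prv T G A.
Proof. by move=> h; apply: FFalse_classical; apply: prv_cons. Qed.

Lemma all_elim n G A s : prv T G (iter n FAll A) ->
  prv T G (fsubst (fun i => if i < n then s i else Var (i - n)) A).
Proof.
elim: n A s => [|n IH] A s.
  rewrite (_ : (fun i => _) = Var) ?fsubst_id //.
  by funext i; rewrite subn0.
(* The innermost quantifier is instantiated last, by [s 0]; the outer ones receive the shifted
   sequence. *)
rewrite iterSr => /IH h; have := FAll_elim (s 0) (h (s \o succn)).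
rewrite finst_up; congr (prv T G (fsubst _ A)).
by funext i; case: i.
Qed.

(** [T] need not be closed under substitution, but [FAll_intro] may generalize all the variables of
    an axiom, after which the quantifiers are instantiated by [s]. *)
Lemma prv_axiom_inst G A s : T A -> prv T G (fsubst s A).
Proof.
move=> hA.
have all_intro n : forall G, prv T G (iter n FAll A).
  elim: n => [|n IH] G'; first exact: Axm.
  by rewrite iterS; apply: FAll_intro.
have := all_elim s (all_intro (fb A) G); congr (prv T G _).
by apply: fsubst_ext => i ->.
Qed.

Lemma prv_subst G A s : prv T G A -> prv T (map (fsubst s) G) (fsubst s A).
Proof.
move=> hp; elim: hp s => {G A} /=.
- by move=> G A hA s; apply: Hyp; apply: List.in_map.
- by move=> G A hA s; apply: prv_axiom_inst.
- by move=> G A _ IH s; apply: FFalse_classical; apply: (IH s).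
- by move=> G A B _ IH s; apply: FImp_intro; apply: IH.
- by move=> G A B _ IH1 _ IH2 s; apply: FImp_elim (IH1 s) (IH2 s).
- by move=> G A B _ IH1 _ IH2 s; apply: FAnd_intro; auto.
- by move=> G A B _ IH s; apply: FAnd_elim1 (IH s).
- by move=> G A B _ IH s; apply: FAnd_elim2 (IH s).
- by move=> G A B _ IH s; apply: FOr_intro1; auto.
- by move=> G A B _ IH s; apply: FOr_intro2; auto.
- by move=> G A B C _ IH _ IH1 _ IH2 s; apply: FOr_elim (IH s) (IH1 s) (IH2 s).
- by move=> G A _ IH s; apply: FAll_intro; rewrite -map_fsubst_fshift.
- by move=> G A t _ IH s; rewrite fsubst_finst; apply: FAll_elim (IH s).
- move=> G A t _ IH s; apply: (FEx_intro (t := tsubst s t)).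
  by rewrite -fsubst_finst.
- move=> G A B _ IH _ IH2 s; apply: FEx_elim (IH s) _.
  by have := IH2 (up s); rewrite map_fsubst_fshift fsubst_fshift.
- by move=> G t s; apply: FEq_refl.
- move=> G A a b _ IH _ IH2 s; rewrite fsubst_finst; apply: FEq_elim (IH s) _.
  by rewrite -fsubst_finst.
Qed.

Definition fresh (b : nat) G := forall A, List.In A G -> fb A <= b.

Lemma fresh_ex G : exists b, fresh b G.
Proof.
elim: G => [|A G [b hb]]; first by exists 0.
exists (maxn (fb A) b) => C /= [<- | /hb h]; first exact: leq_maxl.
exact: leq_trans h (leq_maxr _ _).
Qed.

(** Renames the fresh variable [b] to the index 0 and shifts all others, which turns a derivation
    about [Var b] into a premise of [FAll_intro] or [FEx_elim]. *)
Definition unfresh (b : nat) : nat -> term :=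
  fun i => if i == b then Var 0 else Var i.+1.

Lemma unfresh_fshift b A : fb A <= b -> fsubst (unfresh b) A = fshift 1 A.
Proof.
move=> h; apply: fsubst_ext => i hi.
by rewrite /unfresh ltn_eqF //; apply: leq_trans h.
Qed.

Lemma unfresh_map b G :
  fresh b G -> map (fsubst (unfresh b)) G = map (fshift 1) G.
Proof.
elim: G => //= A G IH h; rewrite unfresh_fshift ?IH //; last by apply: h; left.
by move=> B hB; apply: h; right.
Qed.

Lemma unfresh_finst b B :
  (fb B).-1 <= b -> fsubst (unfresh b) (finst (Var b) B) = B.
Proof.
move=> h; rewrite /finst fsubst_comp -[RHS]fsubst_id.
apply: fsubst_ext => -[|i] hi /=; first by rewrite /unfresh eqxx.
by rewrite /unfresh ltn_eqF //; apply: leq_trans h; case: (fb B) hi.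
Qed.

Lemma prv_gen b G B : fresh b G -> (fb B).-1 <= b ->
  prv T G (finst (Var b) B) -> prv T G (FAll B).
Proof.
move=> hG hB /(prv_subst (unfresh b)) h; apply: FAll_intro.
by rewrite -(unfresh_map hG) -[X in prv T _ X](unfresh_finst hB).
Qed.

Lemma prv_gen_ex b G B : fresh b G -> (fb B).-1 <= b ->
  prv T (finst (Var b) B :: G) FFalse -> prv T G (FEx B) -> prv T G FFalse.
Proof.
move=> hG hB /(prv_subst (unfresh b)) /= h1 h2.
apply: FEx_elim h2 _.
by rewrite -(unfresh_map hG) -[X in prv T (X :: _)](unfresh_finst hB).
Qed.

End Derivations.

(** The relation depends on the stage because stage [n] treats the [n]-th task. Both the Henkin
    construction and the saturation of pairs are obtained this way. *)
Lemma dependent_choice (S : Type) (P : S -> Prop) (Rl : nat -> S -> S -> Prop) x0 :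
  (forall n x, P x -> exists y, P y /\ Rl n x y) -> P x0 ->
  exists f : nat -> S, f 0 = x0 /\ forall n, P (f n) /\ Rl n (f n) (f n.+1).
Proof.
move=> h h0.
have step n (x : {x | P x}) : {y : {y | P y} | Rl n (sval x) (sval y)}.
  apply: constructive_indefinite_description.
  by case: (h n _ (proj2_sig x)) => y [hy hr]; exists (exist _ y hy).
pose g := fix g n := if n is m.+1 then sval (step m (g m)) else exist _ x0 h0.
exists (fun n => sval (g n)); split=> // n; split; first exact: proj2_sig (g n).
exact: proj2_sig (step n (g n)).
Qed.

(** * Enumeration of terms and formulas *)

Fixpoint term_code (t : term) : GenTree.tree nat :=
  match t with
  | Var i => GenTree.Leaf i
  | TZero => GenTree.Node 0 [::]
  | TOne => GenTree.Node 1 [::]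
  | TAdd a b => GenTree.Node 2 [:: term_code a; term_code b]
  | TSub a b => GenTree.Node 3 [:: term_code a; term_code b]
  | TMul a b => GenTree.Node 4 [:: term_code a; term_code b]
  | TDiv a b => GenTree.Node 5 [:: term_code a; term_code b]
  end.

Fixpoint term_decode (c : GenTree.tree nat) : term :=
  match c with
  | GenTree.Leaf i => Var i
  | GenTree.Node 1 _ => TOne
  | GenTree.Node 2 [:: a; b] => TAdd (term_decode a) (term_decode b)
  | GenTree.Node 3 [:: a; b] => TSub (term_decode a) (term_decode b)
  | GenTree.Node 4 [:: a; b] => TMul (term_decode a) (term_decode b)
  | GenTree.Node 5 [:: a; b] => TDiv (term_decode a) (term_decode b)
  | _ => TZero
  end.

Lemma term_codeK : cancel term_code term_decode.
Proof. by elim=> //= a -> b ->. Qed.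

HB.instance Definition _ := Countable.copy term (can_type term_codeK).

Fixpoint form_code (A : form) : GenTree.tree (nat * term) :=
  match A with
  | FFalse => GenTree.Node 0 [::]
  | FEq a b => GenTree.Node 1 [:: GenTree.Leaf (0, a); GenTree.Leaf (0, b)]
  | FLe a b => GenTree.Node 2 [:: GenTree.Leaf (0, a); GenTree.Leaf (0, b)]
  | FImp B C => GenTree.Node 3 [:: form_code B; form_code C]
  | FAnd B C => GenTree.Node 4 [:: form_code B; form_code C]
  | FOr B C => GenTree.Node 5 [:: form_code B; form_code C]
  | FAll B => GenTree.Node 6 [:: form_code B]
  | FEx B => GenTree.Node 7 [:: form_code B]
  end.

Fixpoint form_decode (c : GenTree.tree (nat * term)) : form :=
  match c with
  | GenTree.Node 1 [:: GenTree.Leaf (_, a); GenTree.Leaf (_, b)] => FEq a b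
  | GenTree.Node 2 [:: GenTree.Leaf (_, a); GenTree.Leaf (_, b)] => FLe a b
  | GenTree.Node 3 [:: B; C] => FImp (form_decode B) (form_decode C)
  | GenTree.Node 4 [:: B; C] => FAnd (form_decode B) (form_decode C)
  | GenTree.Node 5 [:: B; C] => FOr (form_decode B) (form_decode C)
  | GenTree.Node 6 [:: B] => FAll (form_decode B)
  | GenTree.Node 7 [:: B] => FEx (form_decode B)
  | _ => FFalse
  end.

Lemma form_codeK : cancel form_code form_decode.
Proof. by elim=> //= B -> // C ->. Qed.

HB.instance Definition _ := Countable.copy form (can_type form_codeK).

(** * Term models of congruences *)

Section TermModel.
Variables (E L : term -> term -> Prop).

Record term_congruence : Prop := {
  tc_refl : forall a, E a a;
  tc_sym : forall a b, E a b -> E b a;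
  tc_trans : forall a b c, E a b -> E b c -> E a c;
  tc_add : forall a b c d, E a b -> E c d -> E (TAdd a c) (TAdd b d);
  tc_sub : forall a b c d, E a b -> E c d -> E (TSub a c) (TSub b d);
  tc_mul : forall a b c d, E a b -> E c d -> E (TMul a c) (TMul b d);
  tc_div : forall a b c d, E a b -> E c d -> E (TDiv a c) (TDiv b d);
  tc_le : forall a b c d, E a b -> E c d -> L a c -> L b d }.

Hypothesis hE : term_congruence.

(** Each class is represented by a chosen member, so the domain is a sigma type on which [E] becomes
    equality. *)
Definition trep (t : term) : term := epsilon (inhabits TZero) (E t).

Lemma trepP t : E t (trep t).
Proof. by apply: epsilon_spec; exists t; apply: tc_refl. Qed.

(** Equivalent terms have extensionally equal classes, so [epsilon] is applied to the same
    predicate. *)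
Lemma trep_eq a b : E a b -> trep a = trep b.
Proof.
move=> h; rewrite /trep (_ : E a = E b) //.
funext c; apply: propext; split; first exact: tc_trans (tc_sym hE h).
exact: tc_trans h.
Qed.

Definition tclass (t : term) : {t | trep t = t} :=
  exist _ (trep t) (esym (trep_eq (trepP t))).

Lemma tclass_eq a b : tclass a = tclass b <-> E a b.
Proof.
split=> [[h] | h].
  by apply: (tc_trans hE (trepP a)); rewrite h; apply: tc_sym => //; apply: trepP.
by apply: subset_eq_compat; apply: trep_eq.
Qed.

Lemma tclass_val x : tclass (sval x) = x.
Proof. by case: x => t ht; apply: subset_eq_compat. Qed.

Lemma tclass_rep t : E t (sval (tclass t)).
Proof. exact: trepP. Qed.

Definition term_model : struct :=
  let op f x y := tclass (f (sval x) (sval y)) in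
  @Struct {t | trep t = t} (tclass TZero) (tclass TOne)
    (op TAdd) (op TSub) (op TMul) (op TDiv) (fun x y => L (sval x) (sval y)).

Definition tenv (s : nat -> term) : nat -> term_model := fun i => tclass (s i).

Lemma ev_tenv s t : ev (tenv s) t = tclass (tsubst s t).
Proof.
have rp t' : E (sval (tclass t')) t' by apply: tc_sym => //; apply: tclass_rep.
elim: t => //= a -> b ->; apply/tclass_eq.
- exact: tc_add.
- exact: tc_sub.
- exact: tc_mul.
- exact: tc_div.
Qed.

Lemma sle_tclass a b : sle (tclass a : term_model) (tclass b) <-> L a b.
Proof.
by split; apply: tc_le => //; try exact: tclass_rep; apply: tc_sym => //;
  apply: tclass_rep.
Qed.

Lemma tenv_val (r : nat -> term_model) : r = tenv (fun i => sval (r i)).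
Proof. by funext i; rewrite /tenv tclass_val. Qed.

Lemma econs_tenv t s : econs (tclass t : term_model) (tenv s) = tenv (scons t s).
Proof. by funext i; case: i. Qed.

End TermModel.

(** * Henkin theories *)

Section Completeness.
Variable T : form -> Prop.

Definition consistent (S : seq form) := ~ prv T S FFalse.

(** Stage [n] decides the formula with code [n]. An accepted existential comes with a witness, and a
    rejected universal with a counterexample, [FAll] being primitive rather than a negated [FEx]. *)
Definition henkin_step (n : nat) (S S' : seq form) :=
  (forall B, List.In B S -> List.In B S') /\
  let A := odflt FFalse (unpickle n) in
  (List.In A S' /\ (forall B, A = FEx B -> exists t, List.In (finst t B) S')) \/
  (List.In (FNot A) S' /\
     (forall B, A = FAll B -> exists t, List.In (FNot (finst t B)) S')).

Lemma henkin_step_ex n S :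
  consistent S -> exists S', consistent S' /\ henkin_step n S S'.
Proof.
move=> hS; rewrite /henkin_step; set A := odflt _ _.
case: (fresh_ex (A :: S)) => b hb.
have hbA : fb A <= b by apply: hb; left.
have hbS : fresh b S by move=> B hB; apply: hb; right.
have hbNS : fresh b (FNot A :: S).
  by move=> B /= [<- | /hbS //]; rewrite /= maxn0.
have [hA | hA] := classic (consistent (A :: S)).
  case: A hA hb hbA {hbNS} => [|a c|a c|B C|B C|B C|B|B] hA hb hbA;
    try by eexists; split; [exact: hA |]; split;
      [by right | left; split; first by left].
  exists (finst (Var b) B :: FEx B :: S); split.
    move=> h; apply: hA; apply: prv_gen_ex hb _ h _ => //; exact: prv_hd.
  split; first by move=> C hC; right; right.
  left; split; first by right; left.
  by move=> _ [<-]; exists (Var b); left.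
have hNA : consistent (FNot A :: S).
  move=> h; apply: hA => h'; apply: hS.
  by apply: prv_cut h'; apply: FFalse_classical.
case: A hA hb hbA hbNS hNA => [|a c|a c|B C|B C|B C|B|B] hA hb hbA hbNS hNA;
    try by eexists; split; [exact: hNA |]; split;
      [by right | right; split; first by left].
exists (FNot (finst (Var b) B) :: FNot (FAll B) :: S); split.
  move=> h; apply: hNA.
  (* A contradiction from the fresh counterexample would generalize to a proof of [FAll B]. *)
  apply: (FImp_elim (prv_hd _ _ _)).
  by apply: prv_gen hbNS _ _ => //; apply: FFalse_classical.
split; first by move=> C hC; right; right.
right; split; first by right; left.
by move=> _ [<-]; exists (Var b); left.
Qed.

Variables (f : nat -> seq form).
Hypothesis hf : forall n, consistent (f n) /\ henkin_step n (f n) (f n.+1).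

Definition Th (A : form) := exists n, List.In A (f n).

Lemma f_mono m n B : m <= n -> List.In B (f m) -> List.In B (f n).
Proof.
elim: n => [|n IH]; first by rewrite leqn0 => /eqP ->.
rewrite leq_eqVlt => /orP [/eqP -> // | hm hB].
by case: (hf n) => _ [h _]; apply: h; apply: IH.
Qed.

Lemma Th_list G : (forall B, List.In B G -> Th B) ->
  exists n, forall B, List.In B G -> List.In B (f n).
Proof.
elim: G => [|A G IH] h; first by exists 0.
case: IH => [B hB | n hn]; first by apply: h; right.
case: (h A); first by left.
move=> m hm; exists (maxn m n) => B /= [<- | /hn].
  exact: f_mono (leq_maxl _ _) hm.
exact: f_mono (leq_maxr _ _).
Qed.

Lemma Th_cons : ~ Th FFalse.
Proof. by case=> n hn; case: (hf n) => h _; apply: h; apply: Hyp. Qed.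

Lemma Th_step A :
  (Th A /\ (forall B, A = FEx B -> exists t, Th (finst t B))) \/
  (Th (FNot A) /\ (forall B, A = FAll B -> exists t, Th (FNot (finst t B)))).
Proof.
case: (hf (pickle A)) => _ [_]; rewrite pickleK /=.
case=> -[h1 h2]; [left | right]; split; try by exists (pickle A).+1.
  by move=> B /h2 [t ht]; exists t; exists (pickle A).+1.
by move=> B /h2 [t ht]; exists t; exists (pickle A).+1.
Qed.

Lemma Th_prv G A : (forall B, List.In B G -> Th B) -> prv T G A -> Th A.
Proof.
move=> hG hp; case: (Th_step A) => -[//] hN _.
have [n hn] := Th_list hG; case: hN => m hm.
case: (hf (maxn n m)) => hc _; case: hc.
apply: (FImp_elim (A := A)).
  by apply: Hyp; apply: f_mono (leq_maxr _ _) hm.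
by apply: prv_weak hp _ => B /hn; apply: f_mono (leq_maxl _ _).
Qed.

Lemma Th_prv0 A : prv T [::] A -> Th A. Proof. exact: Th_prv. Qed.

Lemma Th_not A : Th (FNot A) <-> ~ Th A.
Proof.
split=> [hN hA | hA]; last by case: (Th_step A) => -[].
apply: Th_cons; apply: (@Th_prv [:: FNot A; A]).
  by move=> B /= [<- | [<- | []]].
apply: (FImp_elim (A := A)); first exact: prv_hd.
by apply: Hyp; right; left.
Qed.

Lemma Th_imp A B : Th (FImp A B) <-> (Th A -> Th B).
Proof.
split=> [hI hA | h].
  apply: (@Th_prv [:: FImp A B; A]); first by move=> C /= [<- | [<- | []]].
  apply: (FImp_elim (A := A)); first exact: prv_hd.
  by apply: Hyp; right; left.
have [hB | hB] := classic (Th B).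
  apply: (@Th_prv [:: B]); first by move=> C /= [<- | []].
  by apply: FImp_intro; apply: prv_cons; apply: prv_hd.
have hA : Th (FNot A) by apply/Th_not => /h.
apply: (@Th_prv [:: FNot A]); first by move=> C /= [<- | []].
apply: FImp_intro; apply: prv_exfalso.
by apply: FImp_elim (prv_hd _ _ _); apply: prv_cons; apply: prv_hd.
Qed.

Lemma Th_and A B : Th (FAnd A B) <-> Th A /\ Th B.
Proof.
split=> [h | [hA hB]].
  split; apply: (@Th_prv [:: FAnd A B]); try by move=> C /= [<- | []].
    exact: FAnd_elim1 (prv_hd _ _ _).
  exact: FAnd_elim2 (prv_hd _ _ _).
apply: (@Th_prv [:: A; B]); first by move=> C /= [<- | [<- | []]].
by apply: FAnd_intro; apply: Hyp; [left | right; left].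
Qed.

Lemma Th_or A B : Th (FOr A B) <-> Th A \/ Th B.
Proof.
split=> [h | [hA | hB]].
- apply: NNPP => /not_or_and [/Th_not hA /Th_not hB]; apply: Th_cons.
  apply: (@Th_prv [:: FOr A B; FNot A; FNot B]).
    by move=> C /= [<- | [<- | [<- | []]]].
  apply: (FOr_elim (prv_hd _ _ _)).
    by apply: FImp_elim (prv_hd _ _ _); apply: Hyp; right; right; left.
  by apply: FImp_elim (prv_hd _ _ _); apply: Hyp; right; right; right; left.
- apply: (@Th_prv [:: A]); first by move=> C /= [<- | []].
  exact: FOr_intro1 (prv_hd _ _ _).
- apply: (@Th_prv [:: B]); first by move=> C /= [<- | []].
  exact: FOr_intro2 (prv_hd _ _ _).
Qed.

Lemma Th_all B : Th (FAll B) <-> forall t, Th (finst t B).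
Proof.
split=> [h t | h].
  apply: (@Th_prv [:: FAll B]); first by move=> C /= [<- | []].
  exact: FAll_elim (prv_hd _ _ _).
case: (Th_step (FAll B)) => -[// _ h']; case: (h' B erefl) => t /Th_not.
by case.
Qed.

Lemma Th_ex B : Th (FEx B) <-> exists t, Th (finst t B).
Proof.
split=> [h | [t h]].
  case: (Th_step (FEx B)) => -[h1 h2]; first exact: h2.
  by move/Th_not: h1.
apply: (@Th_prv [:: finst t B]); first by move=> C /= [<- | []].
exact: FEx_intro (prv_hd _ _ _).
Qed.

Lemma Th_rewrite a b A : Th (FEq a b) -> Th (finst a A) -> Th (finst b A).
Proof.
move=> h1 h2; apply: (@Th_prv [:: FEq a b; finst a A]).
  by move=> C /= [<- | [<- | []]].
by apply: FEq_elim (prv_hd _ _ _) _; apply: Hyp; right; left.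
Qed.

Lemma Th_congruence :
  term_congruence (fun a b => Th (FEq a b)) (fun a b => Th (FLe a b)).
Proof.
have rf a : Th (FEq a a) by apply: Th_prv0; apply: FEq_refl.
have sy a b : Th (FEq a b) -> Th (FEq b a).
  move=> h; have := @Th_rewrite a b (FEq (Var 0) (tshift 1 a)) h.
  by rewrite /finst /= !tinst_shift; apply.
have tr a b c : Th (FEq a b) -> Th (FEq b c) -> Th (FEq a c).
  move=> h1 h2; have := @Th_rewrite b c (FEq (tshift 1 a) (Var 0)) h2.
  by rewrite /finst /= !tinst_shift; apply.
have op (g : term -> term -> term) a b c d :
    (forall s x y, tsubst s (g x y) = g (tsubst s x) (tsubst s y)) ->
    Th (FEq a b) -> Th (FEq c d) -> Th (FEq (g a c) (g b d)).
  move=> hg h1 h2; apply: (tr _ (g b c)).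
    have := @Th_rewrite a b (FEq (g (tshift 1 a) (tshift 1 c))
                                 (g (Var 0) (tshift 1 c))) h1.
    by rewrite /finst /= !hg !tinst_shift /=; apply.
  have := @Th_rewrite c d (FEq (g (tshift 1 b) (tshift 1 c))
                               (g (tshift 1 b) (Var 0))) h2.
  by rewrite /finst /= !hg !tinst_shift /=; apply.
split=> //; try by move=> a b c d; apply: op.
move=> a b c d h1 h2 h.
have := @Th_rewrite a b (FLe (Var 0) (tshift 1 c)) h1.
rewrite /finst /= !tinst_shift => /(_ h) h'.
have := @Th_rewrite c d (FLe (tshift 1 b) (Var 0)) h2.
by rewrite /finst /= !tinst_shift => /(_ h').
Qed.

Lemma Th_sat A s : sat (tenv Th_congruence s) A <-> Th (fsubst s A).
Proof.
elim: A s => [|a b|a b|B IB C IC|B IB C IC|B IB C IC|B IB|B IB] s /=.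
- by split=> // /Th_cons.
- by rewrite !ev_tenv; apply: tclass_eq.
- by rewrite !ev_tenv; apply: (sle_tclass Th_congruence).
- by rewrite Th_imp IB IC.
- by rewrite Th_and IB IC.
- by rewrite Th_or IB IC.
- rewrite Th_all; split=> h t.
    by rewrite finst_up -IB -econs_tenv.
  by rewrite -(tclass_val Th_congruence t) econs_tenv IB -finst_up.
- rewrite Th_ex; split=> -[t h].
    exists (sval t); rewrite finst_up -IB -econs_tenv.
    by rewrite (tclass_val Th_congruence).
  by exists (tclass Th_congruence t); rewrite econs_tenv IB -finst_up.
Qed.

Lemma Th_model : model (term_model Th_congruence) T.
Proof.
move=> A hA r; rewrite (tenv_val r) Th_sat; apply: Th_prv0.
exact: prv_axiom_inst.
Qed.

End Completeness.

(** Allows all reductions to be built semantically, as strategies over the models of [R]; the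
    derivations required by [dred] are recovered from it. *)
Lemma completeness T G A :
  (forall M : struct, model M T -> forall r : nat -> M, sats r G -> sat r A) ->
  prv T G A.
Proof.
move=> h; apply: FFalse_classical; apply: NNPP => hc.
have [f [f0 hf]] := dependent_choice (@henkin_step_ex T) hc.
have hs B : sat (tenv (Th_congruence hf) Var) B <-> Th f B.
  by rewrite Th_sat fsubst_id.
have hin B : List.In B (FNot A :: G) -> Th f B by move=> hB; exists 0; rewrite f0.
have: sat (tenv (Th_congruence hf) Var) A.
  by apply: h; [exact: Th_model | move=> B hB; apply/hs/hin; right].
rewrite hs => hA; have /Th_not := hin (FNot A) (or_introl erefl).
by move=> /(_ _ hf).
Qed.

(** * Arithmetic in models of R *)

Section Arith.
Variable M : struct.
Hypothesis hM : model M R.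
Implicit Types x y z a b c d q r u v : M.

Local Notation "x +' y" := (sadd x y) (at level 50, left associativity).
Local Notation "x -' y" := (ssub x y) (at level 50, left associativity).
Local Notation "x *' y" := (smul x y) (at level 40, left associativity).
Local Notation "x <=' y" := (sle x y) (at level 70).
Definition slt x y := sle x y /\ x <> y.
Local Notation "x <' y" := (slt x y) (at level 70).

Lemma R_sat x y z i A :
  List.nth_error R_axioms i = Some A ->
  sat (econs x (econs y (econs z (fun _ => s0)))) A.
Proof. by move=> h; apply: hM; apply: List.nth_error_In h. Qed.

Lemma saddA x y z : x +' y +' z = x +' (y +' z).
Proof. exact: (@R_sat x y z 0 _ erefl). Qed.
Lemma saddC x y : x +' y = y +' x.
Proof. exact: (@R_sat x y s0 1 _ erefl). Qed.
Lemma sadd0 x : x +' s0 = x.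
Proof. exact: (@R_sat x s0 s0 2 _ erefl). Qed.
Lemma smulC x y : x *' y = y *' x.
Proof. exact: (@R_sat x y s0 4 _ erefl). Qed.
Lemma smul1 x : x *' s1 = x.
Proof. exact: (@R_sat x s0 s0 5 _ erefl). Qed.
Lemma smulDr x y z : x *' (y +' z) = x *' y +' x *' z.
Proof. exact: (@R_sat x y z 6 _ erefl). Qed.
Lemma smul0 x : x *' s0 = s0.
Proof. exact: (@R_sat x s0 s0 7 _ erefl). Qed.
Lemma slexx x : x <=' x.
Proof. exact: (@R_sat x s0 s0 8 _ erefl). Qed.
Lemma sle_trans y x z : x <=' y -> y <=' z -> x <=' z.
Proof. by move=> h1 h2; exact: (@R_sat x y z 9 _ erefl (conj h1 h2)). Qed.
Lemma sle_anti x y : x <=' y -> y <=' x -> x = y.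
Proof. by move=> h1 h2; exact: (@R_sat x y s0 10 _ erefl (conj h1 h2)). Qed.
Lemma sle_total x y : x <=' y \/ y <=' x.
Proof. exact: (@R_sat x y s0 11 _ erefl). Qed.
Lemma slt01 : (s0 : M) <' s1.
Proof. exact: (@R_sat s0 s0 s0 12 _ erefl). Qed.
Lemma slt0_le1 x : s0 <' x -> s1 <=' x.
Proof. exact: (@R_sat x s0 s0 13 _ erefl). Qed.
Lemma slt_add2r z x y : x <' y -> x +' z <' y +' z.
Proof. exact: (@R_sat x y z 14 _ erefl). Qed.
Lemma slt_mul2r z x y : z <> s0 -> x <' y -> x *' z <' y *' z.
Proof. by move=> h1 h2; exact: (@R_sat x y z 15 _ erefl (conj h1 h2)). Qed.
Lemma ssubK x y : y <=' x -> (x -' y) +' y = x.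
Proof. exact: (proj1 (@R_sat x y s0 16 _ erefl)). Qed.
Lemma ssub_lt x y : x <' y -> x -' y = s0.
Proof. exact: (proj2 (@R_sat x y s0 16 _ erefl)). Qed.
Lemma sdiv_le x y : (y +' s1) *' sdiv x y <=' x.
Proof. exact: (proj1 (@R_sat x y s0 17 _ erefl)). Qed.
Lemma sdiv_lt x y : x -' (y +' s1) *' sdiv x y <' y +' s1.
Proof. exact: (proj2 (@R_sat x y s0 17 _ erefl)). Qed.

Lemma sltNge x y : x <' y <-> ~ y <=' x.
Proof.
split=> [[h1 h2] h3 | h]; first by apply: h2; apply: sle_anti.
by case: (sle_total x y) => // hxy; split=> // e; apply: h; rewrite e; apply: slexx.
Qed.

Lemma sleNgt x y : x <=' y <-> ~ y <' x.
Proof. by rewrite sltNge; split=> [h []| /NNPP]. Qed.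

Lemma slt_le_trans x y z : x <' y -> y <=' z -> x <' z.
Proof. by rewrite !sltNge => h1 h2 h3; apply: h1; apply: sle_trans h3. Qed.

Lemma sle_lt_trans x y z : x <=' y -> y <' z -> x <' z.
Proof. by rewrite !sltNge => h1 h2 h3; apply: h2; apply: sle_trans h1. Qed.

Lemma sle_eq_or_lt x y : x <=' y -> x = y \/ x <' y.
Proof. by move=> h; case: (classic (x = y)) => [|e]; [left | right]. Qed.

(* If [x < 0] then [x] is non-zero and multiplying [0 < 1] by it gives [0 < x]. *)
Lemma sle0 x : s0 <=' x.
Proof.
apply/sleNgt => h; have hx : x <> s0 by case: h.
have := slt_mul2r hx slt01; rewrite (smulC s0) smul0 (smulC s1) smul1 => h'.
by apply: (proj1 (sltNge _ _) h); case: h'.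
Qed.

Lemma sle_add2r z x y : x +' z <=' y +' z <-> x <=' y.
Proof.
split=> [h | /sle_eq_or_lt [-> | /slt_add2r h]].
- by apply/sleNgt => /(@slt_add2r z) /sltNge.
- exact: slexx.
- by case: (h z).
Qed.

Lemma sadd_inj z x y : x +' z = y +' z -> x = y.
Proof.
move=> e; apply: sle_anti; apply/(@sle_add2r z); rewrite e; exact: slexx.
Qed.

Lemma sle_add a b c d : a <=' b -> c <=' d -> a +' c <=' b +' d.
Proof.
move=> h1 h2; apply: (@sle_trans (b +' c)); first exact/sle_add2r.
by rewrite !(saddC b); apply/sle_add2r.
Qed.

Lemma sle_addr x y : x <=' x +' y.
Proof. by rewrite -{1}(sadd0 x); apply: sle_add (slexx _) (sle0 _). Qed.

Lemma sle_addl x y : x <=' y +' x.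
Proof. by rewrite saddC; apply: sle_addr. Qed.

Lemma sle_mul2r z x y : x <=' y -> x *' z <=' y *' z.
Proof.
case: (classic (z = s0)) => [-> _ | hz]; first by rewrite !smul0; apply: slexx.
case/sle_eq_or_lt => [-> | /(slt_mul2r hz) []//]; exact: slexx.
Qed.

Lemma sle_mul a b c d : a <=' b -> c <=' d -> a *' c <=' b *' d.
Proof.
move=> h1 h2; apply: (@sle_trans (b *' c)); first exact: sle_mul2r.
by rewrite !(smulC b); apply: sle_mul2r.
Qed.

Lemma saddK x y : (x +' y) -' y = x.
Proof. by apply: (@sadd_inj y); apply: ssubK; apply: sle_addl. Qed.

Lemma ssub0 x : x -' s0 = x.
Proof. by rewrite -{1}(sadd0 x) saddK. Qed.

Lemma ssub_le0 x y : x <=' y -> x -' y = s0.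
Proof.
case/sle_eq_or_lt => [<- | /ssub_lt //].
by have := saddK s0 x; rewrite saddC sadd0.
Qed.

Lemma ssubxx x : x -' x = s0.
Proof. exact: ssub_le0 (slexx _). Qed.

Lemma ssub_le x y : x -' y <=' x.
Proof.
case: (sle_total x y) => h; first by rewrite ssub_le0 //; apply: sle0.
by rewrite -{2}(ssubK h); apply: sle_addr.
Qed.

Lemma slt_succ x : x <' x +' s1.
Proof. by have := @slt_add2r x _ _ slt01; rewrite !(saddC _ x) sadd0. Qed.

Lemma slt_succP x y : x <' y <-> x +' s1 <=' y.
Proof.
split=> [[h1 h2] | ]; last exact: slt_le_trans (slt_succ x).
rewrite -(ssubK h1) saddC; apply/sle_add2r/slt0_le1.
split; first exact: sle0.
by move=> e; apply: h2; rewrite -(ssubK h1) -e saddC sadd0.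
Qed.

Lemma sltS_le x y : x <' y +' s1 <-> x <=' y.
Proof. by rewrite slt_succP; apply: sle_add2r. Qed.

Lemma ssub_gt0 x y : y <' x -> s1 <=' x -' y.
Proof.
move=> h; have [hyx hne] := h; apply: slt0_le1; split; first exact: sle0.
by move=> e; apply: hne; rewrite -(ssubK hyx) -e saddC sadd0.
Qed.

Lemma s1_sub_ge1 x : s1 <=' x -> s1 -' x = s0. Proof. exact: ssub_le0. Qed.

Lemma sle0_eq x : x <=' s0 -> x = s0.
Proof. by move=> h; apply: sle_anti h _; apply: sle0. Qed.

Lemma s1_neq0 : (s1 : M) <> s0.
Proof. by case: slt01 => _ h e; apply: h. Qed.

Lemma sdiv_lex x y : sdiv x y <=' x.
Proof.
apply: sle_trans (sdiv_le x y); rewrite -{1}(smul1 (sdiv x y)) smulC.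
by apply: sle_mul2r; apply: sle_addl.
Qed.

Lemma sdiv_mod x y : x = (y +' s1) *' sdiv x y +' (x -' (y +' s1) *' sdiv x y).
Proof. by rewrite saddC ssubK //; apply: sdiv_le. Qed.

(** If [a < b], then [(d + 1) a + u] with [u <= d] stays below [(d + 1) b], so two decompositions of
    the same element have equal quotients. This decodes the step number in [flow_ind]. *)
Lemma sdiv_uniq d q r : r <=' d -> sdiv ((d +' s1) *' q +' r) d = q.
Proof.
set x := _ +' r => hr.
have key a b u v : u <' d +' s1 -> (d +' s1) *' a +' u = (d +' s1) *' b +' v ->
    b <=' a.
  move=> hu e; apply/sleNgt => /slt_succP hab.
  have h : (d +' s1) *' a +' u <' (d +' s1) *' b.
    apply: (@slt_le_trans _ ((d +' s1) *' (a +' s1))).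
      rewrite smulDr smul1 !(saddC ((d +' s1) *' a)); exact: slt_add2r.
    by rewrite !(smulC (d +' s1)); apply: sle_mul2r.
  by move: h; rewrite e; move/sltNge; apply; apply: sle_addr.
apply: sle_anti.
- apply: (key _ _ r (x -' (d +' s1) *' sdiv x d)); first exact/sltS_le.
  exact: sdiv_mod.
- apply: (key _ _ (x -' (d +' s1) *' sdiv x d) r); first exact: sdiv_lt.
  by rewrite -sdiv_mod.
Qed.

End Arith.

(** * Majorants, characteristic terms and definition by cases *)

(** Truncated subtraction and division are not monotone in their second arguments. Dropping these
    arguments leaves a monotone term that is at least as large. *)
Fixpoint maj (t : term) : term :=
  match t with
  | TAdd a b => TAdd (maj a) (maj b)
  | TSub a _ => maj a
  | TMul a b => TMul (maj a) (maj b)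
  | TDiv a _ => maj a
  | _ => t
  end.

(** The value is 1 or 0 according to truth for quantifier-free formulas; for others it is a dummy 0.
    In the atoms, [1 - (a - b)] tests [a <= b], since a nonzero difference is at least 1. *)
Fixpoint tchar (A : form) : term :=
  match A with
  | FEq a b => TMul (TSub TOne (TSub a b)) (TSub TOne (TSub b a))
  | FLe a b => TSub TOne (TSub a b)
  | FImp B C => TSub TOne (TMul (tchar B) (TSub TOne (tchar C)))
  | FAnd B C => TMul (tchar B) (tchar C)
  | FOr B C => TSub TOne (TMul (TSub TOne (tchar B)) (TSub TOne (tchar C)))
  | _ => TZero
  end.

Definition tif (c : form) (a b : term) : term :=
  TAdd (TMul (tchar c) a) (TMul (TSub TOne (tchar c)) b).

Section MajChar.
Variable M : struct.
Hypothesis hM : model M R.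
Implicit Types r : nat -> M.

(** Domination and monotonicity in one statement: the environment may be enlarged along with the
    term. *)
Lemma ev_maj r r' t : (forall i, sle (r i) (r' i)) -> sle (ev r t) (ev r' (maj t)).
Proof.
move=> h; elim: t => //=; try by move=> *; apply: slexx.
- by move=> a IA b IB; apply: sle_add.
- by move=> a IA b IB; apply: sle_trans (ssub_le _ _ _) IA.
- by move=> a IA b IB; apply: sle_mul.
- by move=> a IA b IB; apply: sle_trans (sdiv_lex _ _ _) IA.
Qed.

Lemma ev_tchar r A : qfree A ->
  (sat r A -> ev r (tchar A) = s1) /\ (~ sat r A -> ev r (tchar A) = s0).
Proof.
have mul11 : smul s1 s1 = s1 :> M by rewrite smul1.
have sub10 : ssub s1 s0 = s1 :> M by rewrite ssub0.
have sub11 : ssub s1 s1 = s0 :> M by rewrite ssubxx.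
have m0 (x : M) : smul s0 x = s0 by rewrite smulC // smul0.
have sub1 x y : slt y x -> ssub s1 (ssub x y) = s0 :> M.
  by move=> h; apply: s1_sub_ge1 => //; apply: ssub_gt0.
elim: A => //= [a b _|a b _|B IB C IC|B IB C IC|B IB C IC].
- split=> [-> | h]; first by rewrite !ssubxx // sub10 mul11.
  case: (sle_total hM (ev r a) (ev r b)) => /sle_eq_or_lt [e | /sub1 ->].
  - by case: h.
  - by rewrite smul0.
  - by case: h.
  - by rewrite m0.
- split=> [/(ssub_le0 hM) -> | h]; first by rewrite sub10.
  rewrite sub1 //.
  exact/sltNge.
- case/andP=> /IB [B1 B0] /IC [C1 C0]; split=> h.
    case: (classic (sat r B)) => hB; last by rewrite B0 // m0.
    by rewrite C1 ?sub11 ?smul0 //; apply: h.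
  have [hB hC] := imply_to_and _ _ h; by rewrite B1 // C0 // sub10 mul11.
- case/andP=> /IB [B1 B0] /IC [C1 C0]; split=> [[/B1 -> /C1 -> //] | h].
  by case/not_and_or: h => [/B0 | /C0] ->; rewrite ?m0 ?smul0.
- case/andP=> /IB [B1 B0] /IC [C1 C0]; split=> [[/B1 | /C1] -> | h].
  + by rewrite sub11 m0 sub10.
  + by rewrite sub11 smul0 // sub10.
  + by case/not_or_and: h => /B0 -> /C0 ->; rewrite sub10 mul11.
Qed.

Lemma ev_tif_true r c a b : qfree c -> sat r c -> ev r (tif c a b) = ev r a.
Proof.
move=> /(ev_tchar r) [h _] /h /= ->.
by rewrite ssubxx // !(smulC hM _ (ev r _)) smul1 // smul0 // sadd0.
Qed.

Lemma ev_tif_false r c a b : qfree c -> ~ sat r c -> ev r (tif c a b) = ev r b.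
Proof.
move=> /(ev_tchar r) [_ h] /h /= ->.
rewrite ssub0 // !(smulC hM _ (ev r _)) smul1 // smul0 //.
by rewrite saddC // sadd0.
Qed.

End MajChar.

(** * Games *)

(** A game tree: the legal first moves, the game after each move, and a proposition at the end. Who
    moves is not recorded, so the same tree serves the Pi and the Sigma reading. *)
Fixpoint sg (M : Type) (k : nat) : Type :=
  if k is k'.+1 then ((seq M -> Prop) * (seq M -> sg M k'))%type else Prop.

Section Envs.
Variable M : struct.
Implicit Types (r : nat -> M) (v w : seq M).

Definition tl (n : nat) r : nat -> M := fun i => r (n + i).
Definition hd (n : nat) r : seq M := mkseq r n.
Definition ext (n : nat) v r : nat -> M :=
  fun i => if i < n then nth s0 v i else r (i - n).
(** Only the first [size w] entries of [v] count and missing ones read as 0, so a move may have any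
    length. *)
Definition vle v w := forall i, i < size w -> sle (nth s0 v i) (nth s0 w i).
Definition evs r (f : seq term) : seq M := map (ev r) f.

Lemma ext_hd n r : ext n (hd n r) (tl n r) = r.
Proof.
funext i; rewrite /ext /hd /tl; case: ltnP => h; first by rewrite nth_mkseq.
by rewrite subnKC.
Qed.

Lemma tl_ext n v r : tl n (ext n v r) = r.
Proof. by funext i; rewrite /tl /ext ltnNge leq_addr /= addKn. Qed.

Lemma hd_ext n v r : size v = n -> hd n (ext n v r) = v.
Proof.
move=> h; apply: (@eq_from_nth _ s0); rewrite size_mkseq // => i hi.
by rewrite nth_mkseq // /ext hi.
Qed.

Lemma size_hd n r : size (hd n r) = n. Proof. exact: size_mkseq. Qed.

Lemma upnE n s i : upn n s i = if i < n then Var i else tshift n (s (i - n)).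
Proof.
elim: n i => [|n IH] i; first by rewrite subn0 /tshift tsubst_id.
rewrite /upn iterS; case: i => [|i] //=.
rewrite -/(upn n s) IH ltnS subSS; case: ltnP => // h.
by rewrite /tshift tsubst_comp.
Qed.

Lemma sb_upn n s v r : sb (upn n s) (ext n v r) = ext n v (sb s r).
Proof.
funext i; rewrite /sb upnE {2}/ext; case: ltnP => h; first by rewrite /= /ext h.
rewrite /tshift ev_subst /sb; congr (ev _ _).
by funext j; rewrite /= /ext ltnNge leq_addr /= addKn.
Qed.

Lemma tl_upn n s r : tl n (sb (upn n s) r) = sb s (tl n r).
Proof. by rewrite -{1}(ext_hd n r) sb_upn tl_ext. Qed.

Lemma hd_upn n s r : hd n (sb (upn n s) r) = hd n r.
Proof.
by rewrite -{1}(ext_hd n r) sb_upn hd_ext // size_hd.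
Qed.

Lemma evs_subst r s f : evs r (map (tsubst s) f) = evs (sb s r) f.
Proof. by rewrite /evs -map_comp; apply: eq_map => t /=; rewrite ev_subst. Qed.

Lemma nth_evs r f i : i < size f -> nth s0 (evs r f) i = ev r (nth TZero f i).
Proof. by move=> h; rewrite (nth_map TZero). Qed.

Lemma sb_shift_tl n r : sb (shift n) r = tl n r. Proof. by []. Qed.

Lemma evs_vars n r : evs r (vars n) = hd n r.
Proof. by rewrite /evs /vars /mkseq -map_comp. Qed.

Lemma sb_reblock f n r :
  sb (reblock f n) r = ext (size f) (evs r f) (tl n r).
Proof.
funext i; rewrite /sb /reblock /ext; case: ltnP => h //.
by rewrite nth_evs.
Qed.

Lemma hd_add m n r : hd (m + n) r = hd m r ++ hd n (tl m r).
Proof.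
rewrite /hd /mkseq iotaD map_cat add0n; congr (_ ++ _).
by rewrite -{1}(addn0 m) iotaDl -map_comp.
Qed.

Lemma tl_add m n r : tl n (tl m r) = tl (m + n) r.
Proof. by funext i; rewrite /tl addnA. Qed.

Lemma tl1_econs x r : tl 1 (econs x r) = r. Proof. by []. Qed.
Lemma econs_tl1 r : econs (r 0) (tl 1 r) = r. Proof. by funext i; case: i. Qed.

Lemma sat_FLes r s t : size s = size t ->
  sat r (FLes s t) <-> vle (evs r s) (evs r t).
Proof.
rewrite /FLes; elim: s t => [|a s IH] [|b t] //= [e].
have {}IH := IH t e; split=> [[h1 /IH h2] [|i] //= hi | h].
  exact: (h2 i).
by split; [apply: (h 0) | apply/IH => i hi; apply: (h i.+1)].
Qed.

Lemma vle_cat v (ps qs : seq M) :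
  vle v (ps ++ qs) = (vle (take (size ps) v) ps /\ vle (drop (size ps) v) qs).
Proof.
apply: propext; split=> [h | [h1 h2] i].
  split=> i hi.
    have := h i; rewrite size_cat nth_cat hi nth_take // ; apply.
    by apply: leq_trans hi (leq_addr _ _).
  have := h (size ps + i); rewrite size_cat ltn_add2l nth_drop nth_cat.
  by rewrite [size ps + i < _]ltnNge leq_addr /= addKn; apply.
rewrite size_cat nth_cat; case: (ltnP i (size ps)) => hi h.
  by have := h1 _ hi; rewrite nth_take.
have := h2 (i - size ps); rewrite nth_drop subnKC //; apply.
by rewrite -(ltn_add2l (size ps)) subnKC.
Qed.

Lemma vle_take n v ps : size ps = n -> vle (take n v) ps = vle v ps.
Proof.
by move=> h; apply: propext; split=> hv i hi; have := hv i hi;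
  rewrite nth_take // -h.
Qed.

Lemma ext_take n v r : ext n (take n v) r = ext n v r.
Proof. by funext i; rewrite /ext; case: ltnP => h //; rewrite nth_take. Qed.

Lemma sb_upn_shift m n v r :
  sb (upn m (shift n)) (ext (m + n) v r) = ext m (take m v) r.
Proof.
funext i; rewrite /sb upnE /ext; case: ltnP => h /=.
  by rewrite nth_take // (leq_trans h) // leq_addr.
by rewrite ltn_add2l ltnNge leq_addr /= subnDA addKn addKn.
Qed.

Lemma tl_ext_add m n v r : tl m (ext (m + n) v r) = ext n (drop m v) r.
Proof.
funext i; rewrite /tl /ext ltn_add2l nth_drop; case: ltnP => //.
by rewrite subnDA addKn.
Qed.

Fixpoint gm k : prenex k -> (nat -> M) -> sg M k :=
  match k return prenex k -> (nat -> M) -> sg M k with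
  | 0 => fun A r => sat r A
  | k'.+1 => fun A r =>
      (fun v => vle v (evs r A.1), fun v => gm A.2 (ext (size A.1) v r))
  end.

(* [n j] is the length of the first component of a move with [j] blocks left. *)
Fixpoint mg (op : Prop -> Prop -> Prop) (n : nat -> nat) k :
    sg M k -> sg M k -> sg M k :=
  match k return sg M k -> sg M k -> sg M k with
  | 0 => op
  | k'.+1 => fun X Y =>
      (fun v => X.1 (take (n k') v) /\ Y.1 (drop (n k') v),
       fun v => mg op n (X.2 (take (n k') v)) (Y.2 (drop (n k') v)))
  end.

Fixpoint lmap (f : Prop -> Prop) k : sg M k -> sg M k :=
  match k return sg M k -> sg M k with
  | 0 => f
  | k'.+1 => fun X => (X.1, fun v => lmap f (X.2 v))
  end.

Lemma sg_ext k (X Y : sg M k.+1) :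
  (forall v, X.1 v = Y.1 v) -> (forall v, X.2 v = Y.2 v) -> X = Y.
Proof.
case: X Y => [p b] [p' b'] /= h1 h2.
by congr (_, _); apply: functional_extensionality.
Qed.

Lemma lmap_id f k (X : sg M k) : (forall P, f P = P) -> lmap f X = X.
Proof. by move=> h; elim: k X => [|k IH] X; [apply: h | apply: sg_ext => v /=]. Qed.

Lemma lmap_comp f g k (X : sg M k) : lmap f (lmap g X) = lmap (f \o g) X.
Proof. by elim: k X => [|k IH] X //; apply: sg_ext => v /=. Qed.

Lemma lmap_ext f g k (X : sg M k) : (forall P, f P = g P) -> lmap f X = lmap g X.
Proof. by move=> h; elim: k X => [|k IH] X; [apply: h | apply: sg_ext => v /=]. Qed.

Lemma mg_lmapl op op' f n k (X Y : sg M k) :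
  (forall P Q, op (f P) Q = op' P Q) -> mg op n (lmap f X) Y = mg op' n X Y.
Proof. 
move=> h; elim: k X Y => [|k IH] X Y; first exact: h.
by apply: sg_ext => v /=.
Qed.

Lemma mg_lmapr op op' f n k (X Y : sg M k) :
  (forall P Q, op P (f Q) = op' P Q) -> mg op n X (lmap f Y) = mg op' n X Y.
Proof. 
move=> h; elim: k X Y => [|k IH] X Y; first exact: h.
by apply: sg_ext => v /=.
Qed.

Lemma lmap_mg op op' f n k (X Y : sg M k) :
  (forall P Q, f (op P Q) = op' P Q) -> lmap f (mg op n X Y) = mg op' n X Y.
Proof. 
move=> h; elim: k X Y => [|k IH] X Y; first exact: h.
by apply: sg_ext => v /=.
Qed.

End Envs.
Arguments tl {M} n r _ /.

(** Block lengths are indexed by the number of blocks inside, an index that is stable when passing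
    to a subformula. *)
Fixpoint shp k : prenex k -> nat -> nat :=
  match k return prenex k -> nat -> nat with
  | 0 => fun _ _ => 0
  | k'.+1 => fun A i => if i == k' then size A.1 else shp A.2 i
  end.

Lemma shp_psubst s k (A : prenex k) : shp (psubst s A) = shp A.
Proof.
elim: k s A => [|k IH] s A //=; funext i; rewrite size_map.
by rewrite IH.
Qed.

Lemma shp_pguard op B k (A : prenex k) : shp (pguard op B A) = shp A.
Proof. by elim: k B A => [|k IH] B A //=; rewrite IH. Qed.

Lemma shp_pmerge op k (A B : prenex k) i :
  shp (pmerge op A B) i = shp A i + shp B i.
Proof.
elim: k A B => [|k IH] A B //=; rewrite size_cat.
by case: eqP => // _; rewrite IH !shp_psubst.
Qed.

Lemma shp_pmergeE op k (A B : prenex k) :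
  shp (pmerge op A B) = fun i => shp A i + shp B i.
Proof. by funext i; rewrite shp_pmerge. Qed.

Lemma shp_pconst N k : shp (pconst N k) = fun _ => 0.
Proof.
elim: k => //= k IH; funext i; rewrite IH; by case: eqP.
Qed.

Section Gm.
Variable M : struct.
Implicit Types r : nat -> M.

Lemma gm_psubst s k (A : prenex k) r : gm (psubst s A) r = gm A (sb s r).
Proof.
elim: k s A r => [|k IH] s A r /=; first by rewrite sat_subst.
apply: sg_ext => v /=; first by rewrite evs_subst.
by rewrite IH size_map sb_upn.
Qed.

Lemma mg_shp op k m (X Y : sg M k) n :
  (forall i, i < k -> n i = m i) -> mg op n X Y = mg op m X Y.
Proof.
elim: k X Y => [|k IH] X Y h //=; apply: sg_ext => v /=; rewrite h //.
by apply: IH => i hi; apply: h; apply: ltnW.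
Qed.

Lemma gm_pmerge op opP k (A B : prenex k) r :
  (forall M (r : nat -> M) C D,
     sat r (op C D) = opP (sat r C) (sat r D)) ->
  gm (pmerge op A B) r = mg opP (shp A) (gm A r) (gm B r).
Proof.
move=> hop; elim: k A B r => [|k IH] A B r /=; first by rewrite hop.
rewrite eqxx; apply: sg_ext => v /=.
  by rewrite /evs map_cat vle_cat size_map.
rewrite IH shp_psubst !gm_psubst size_cat sb_upn_shift.
rewrite sb_shift_tl tl_ext_add; apply: mg_shp => i hi.
by rewrite ltn_eqF.
Qed.

Lemma gm_pmerge_or k (A B : prenex k) r :
  gm (pmerge FOr A B) r = mg or (shp A) (gm A r) (gm B r).
Proof. exact: gm_pmerge. Qed.

Lemma gm_pmerge_and k (A B : prenex k) r :
  gm (pmerge FAnd A B) r = mg and (shp A) (gm A r) (gm B r).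
Proof. exact: gm_pmerge. Qed.

Lemma gm_guard_imp N k (A : prenex k) r :
  gm (pguard FImp N A) r = lmap (fun P => sat r N -> P) (gm A r).
Proof.
elim: k N A r => [|k IH] N A r //=; apply: sg_ext => v //=.
by rewrite IH /fshift; apply: lmap_ext => P; rewrite sat_subst sb_shift_tl tl_ext.
Qed.

Lemma gm_guard_and N k (A : prenex k) r :
  gm (pguard FAnd N A) r = lmap (fun P => sat r N /\ P) (gm A r).
Proof.
elim: k N A r => [|k IH] N A r //=; apply: sg_ext => v //=.
by rewrite IH /fshift; apply: lmap_ext => P; rewrite sat_subst sb_shift_tl tl_ext.
Qed.

(** The zero move is always legal, as 0 is below every bound. A player therefore always has some
    legal move, even once the outcome is settled. *)
Fixpoint szok k : sg M k -> Prop :=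
  match k return sg M k -> Prop with
  | 0 => fun _ => True
  | k'.+1 => fun X => (forall n, X.1 (nseq n s0)) /\ (forall v, szok (X.2 v))
  end.

Lemma gm_szok k (A : prenex k) r : model M R -> szok (gm A r).
Proof.
move=> hM; elim: k A r => [|k IH] A r //=; split=> // n i _.
by rewrite nth_nseq if_same; apply: sle0.
Qed.

Lemma szok_lmap f k (X : sg M k) : szok X -> szok (lmap f X).
Proof. by elim: k X => [|k IH] X //= [h1 h2]; split=> // v; apply: IH. Qed.

(** The game is settled with outcome [b], however it is played. *)
Fixpoint leaves (b : Prop) k : sg M k -> Prop :=
  match k return sg M k -> Prop with
  | 0 => fun P => P <-> b
  | k'.+1 => fun X => forall v, leaves b (X.2 v)
  end.

Lemma leaves_lmap b f k (X : sg M k) : (forall P, f P <-> b) -> leaves b (lmap f X).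
Proof. by move=> h; elim: k X => [|k IH] X //= v; apply: IH. Qed.

Lemma psubst_pconst s N k : psubst s (pconst N k) = pconst (fsubst s N) k.
Proof. by elim: k s => //= k IH s; rewrite IH. Qed.

Lemma leaves_pconst N k r : leaves (sat r N) (gm (pconst N k) r).
Proof.
elim: k r => //= k IH r v.
by rewrite (_ : ext 0 v r = r) //; funext i; rewrite /ext subn0.
Qed.

Lemma leaves_pconst_true N k r : sat r N -> leaves True (gm (pconst N k) r).
Proof.
move=> h; have := leaves_pconst N k r; rewrite (_ : sat r N = True) //.
by apply: propext; split.
Qed.

Lemma leaves_pconst_false N k r : ~ sat r N -> leaves False (gm (pconst N k) r).
Proof.
move=> h; have := leaves_pconst N k r; rewrite (_ : sat r N = False) //.
by apply: propext; split.
Qed.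

Lemma ext0 v r : ext 0 v r = r.
Proof. by funext i; rewrite /ext subn0. Qed.

Lemma mg_pconstr op N k (A : prenex k) n r :
  (forall i, i < k -> n i = shp A i) ->
  mg op n (gm A r) (gm (pconst N k) r) = lmap (fun P => op P (sat r N)) (gm A r).
Proof.
(* The moves extend the environment on the side of [A] only, because the blocks of [pconst] are
   empty; so the two environments must be generalized separately. *)
have key (r' : nat -> M) : sat r' N = sat r N ->
  (forall i, i < k -> n i = shp A i) ->
  forall r0, mg op n (gm A r0) (gm (pconst N k) r') =
    lmap (fun P => op P (sat r N)) (gm A r0); last by move=> h; apply: key.
move=> e; elim: k A n => [|k IH] A n h r0 /=; first by rewrite e.
have hn := h _ (ltnSn k); rewrite /= eqxx in hn.
apply: sg_ext => v /=; rewrite hn.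
  rewrite vle_take ?size_map //; apply: propext; split=> [[] | h1] //.
rewrite ext_take ext0; apply: IH => i hi.
by have := h i (ltnW hi); rewrite /= ltn_eqF.
Qed.

End Gm.

(** * Reductions between families of games *)

(** Families need not come from formulas: after moves given by terms and after maps on the leaves,
    only the games matter. *)
Definition fam k := forall M : struct, (nat -> M) -> sg M k.
Definition ctx := forall M : struct, (nat -> M) -> Prop.

Definition nctx (G : ctx) k (n : nat) (Y : fam k.+1) : ctx :=
  fun M r => G M (tl n r) /\ (Y M (tl n r)).1 (hd n r).
Definition nopp k (n : nat) (Y : fam k.+1) : fam k :=
  fun M r => (Y M (tl n r)).2 (hd n r).
Definition nown k (n : nat) (f : seq term) (X : fam k.+1) : fam k :=
  fun M r => (X M (tl n r)).2 (evs r f).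

(* We own the moves of [X], the opponent those of [Y]; each turn, the opponent
   moves first, and then the roles are exchanged.  The opponent's moves are
   pushed on the environment, our moves are terms in it. *)
Fixpoint D (s : bool) k (nX nY : nat -> nat) (G : ctx) : fam k -> fam k -> Prop :=
  match k return fam k -> fam k -> Prop with
  | 0 => fun X Y => forall M, model M R -> forall r, G M r ->
           if s then X M r -> Y M r else Y M r -> X M r
  | k'.+1 => fun X Y => exists f : seq term,
      [/\ size f = nX k',
          forall M, model M R -> forall r,
            nctx G (nY k') Y r -> (X M (tl (nY k') r)).1 (evs r f)
        & D (~~ s) nY nX (nctx G (nY k') Y) (nopp (nY k') Y) (nown (nY k') f X)]
  end.

(** Strategies consist of terms, so a substitution [t] acts on them; [upn] protects the opponent's
    moves, which stand in front. *)
Lemma D_reindex s k nX nY G (X Y : fam k) t G2 (X2 Y2 : fam k) :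
  D s nX nY G X Y ->
  (forall M, model M R -> forall r, G2 M r ->
    [/\ G M (sb t r), X2 M r = X M (sb t r) & Y2 M r = Y M (sb t r)]) ->
  D s nX nY G2 X2 Y2.
Proof.
elim: k s nX nY G X Y t G2 X2 Y2 => [|k IH] s nX nY G X Y t G2 X2 Y2 /=.
  by move=> h h2 M hM r hr; have [hG -> ->] := h2 M hM r hr; apply: h.
move=> [f [hf hmv hD]] h2; exists (map (tsubst (upn (nY k) t)) f).
have hn M (hM : model M R) (r : nat -> M) : nctx G2 (nY k) Y2 r ->
    nctx G (nY k) Y (sb (upn (nY k) t) r).
  case=> hr hY; have [hG _ eY] := h2 M hM _ hr.
  by split; rewrite tl_upn ?hd_upn -?eY.
split; first by rewrite size_map.
  move=> M hM r hr; rewrite evs_subst; case: (hr) => hr' _.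
  have [_ -> _] := h2 M hM _ hr'.
  by rewrite -tl_upn; apply: hmv => //; apply: hn.
apply: (IH) hD _ => M hM r hr; split; first exact: hn.
  by rewrite /nopp tl_upn hd_upn; case: hr => hr _; have [_ _ ->] := h2 M hM _ hr.
rewrite /nown tl_upn evs_subst; case: hr => hr _.
by have [_ -> _] := h2 M hM _ hr.
Qed.

Lemma D_ext s k nX nY G (X Y : fam k) G2 (X2 Y2 : fam k) :
  D s nX nY G X Y ->
  (forall M, model M R -> forall r, G2 M r ->
    [/\ G M r, X2 M r = X M r & Y2 M r = Y M r]) ->
  D s nX nY G2 X2 Y2.
Proof. by move=> h h2; apply: (D_reindex (t := Var)) h _. Qed.

Lemma D_shp s k nX nY mX mY G (X Y : fam k) :
  (forall i, i < k -> nX i = mX i) -> (forall i, i < k -> nY i = mY i) ->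
  D s nX nY G X Y -> D s mX mY G X Y.
Proof.
elim: k s nX nY mX mY G X Y => [|k IH] s nX nY mX mY G X Y //= hX hY [f].
rewrite hX // hY // => -[hf hmv hD]; exists f; split=> //.
by apply: IH hD => i hi; [apply: hY | apply: hX]; apply: ltnW.
Qed.

(** The copycat strategy. *)
Lemma D_eq s k n G (X Y : fam k) :
  (forall M, model M R -> forall r, G M r -> X M r = Y M r) -> D s n n G X Y.
Proof.
elim: k s n G X Y => [|k IH] s n G X Y h /=.
  by move=> M hM r hG; rewrite h //; case: s.
exists (vars (n k)); rewrite size_mkseq; split=> //.
  by move=> M hM r [hG]; rewrite evs_vars h.
by apply: IH => M hM r [hG _]; rewrite /nopp /nown evs_vars h.
Qed.

(** Composition of strategies: the answer [g] in the middle game is fed to the first strategy as its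
    opponent's move. Since the roles have been exchanged, the two remaining strategies are composed
    in the opposite order. *)
Lemma D_trans s k nX nY nZ G (X Y Z : fam k) :
  D s nX nY G X Y -> D s nY nZ G Y Z -> D s nX nZ G X Z.
Proof.
elim: k s nX nY nZ G X Y Z => [|k IH] s nX nY nZ G X Y Z /=.
  by move=> h1 h2 M hM r hG; case: s h1 h2 => h1 h2 h; [apply: h2 | apply: h1];
     try apply: h1; try apply: h2.
case=> f [hf hf1 hf2] [g [hg hg1 hg2]].
exists (map (tsubst (reblock g (nZ k))) f).
have e M (r : nat -> M) :
    sb (reblock g (nZ k)) r = ext (nY k) (evs r g) (tl (nZ k) r).
  by rewrite sb_reblock hg.
have e1 M (r : nat -> M) : tl (nY k) (sb (reblock g (nZ k)) r) = tl (nZ k) r.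
  by rewrite e tl_ext.
have e2 M (r : nat -> M) : hd (nY k) (sb (reblock g (nZ k)) r) = evs r g.
  by rewrite e hd_ext // size_map.
have hn M (hM : model M R) (r : nat -> M) : nctx G (nZ k) Z r ->
    nctx G (nY k) Y (sb (reblock g (nZ k)) r).
  by move=> h; split; rewrite e1 ?e2; [case: h | apply: hg1].
split; first by rewrite size_map.
  by move=> M hM r hr; rewrite evs_subst -e1; apply: hf1 => //; apply: hn.
apply: (IH) hg2 _.
apply: (D_reindex (t := reblock g (nZ k))) hf2 _ => M hM r hr.
by split; [apply: hn | rewrite /nown /nopp e1 e2 | rewrite /nown e1 evs_subst].
Qed.

Lemma qfree_subst s A : qfree (fsubst s A) = qfree A.
Proof. by elim: A s => //= B IB C IC s; rewrite IB IC. Qed.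

(** Two strategies are glued move by move with [tif]. The condition must be quantifier-free so that
    its truth is computed by a term. *)
Lemma D_case s k nX nY G (X Y : fam k) c : qfree c ->
  D s nX nY (fun M r => G M r /\ sat r c) X Y ->
  D s nX nY (fun M r => G M r /\ ~ sat r c) X Y ->
  D s nX nY G X Y.
Proof.
elim: k s nX nY G X Y c => [|k IH] s nX nY G X Y c hc /=.
  move=> h1 h2 M hM r hG; case: (classic (sat r c)) => h.
    by apply: h1.
  exact: h2.
case=> f [hf hf1 hf2] [g [hg hg1 hg2]].
set c' := fshift (nY k) c.
have hc' : qfree c' by rewrite qfree_subst.
have ec M (r : nat -> M) : sat r c' = sat (tl (nY k) r) c by rewrite sat_subst.
exists [seq tif c' ab.1 ab.2 | ab <- zip f g].
have sz : size (zip f g) = nX k by rewrite size_zip hf hg minnn.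
have et M (hM : model M R) (r : nat -> M) : sat r c' ->
    evs r [seq tif c' ab.1 ab.2 | ab <- zip f g] = evs r f.
  move=> h; apply: (@eq_from_nth _ s0) => [|i].
    by rewrite !size_map sz.
  rewrite !size_map sz => hi; rewrite !nth_evs ?size_map ?sz ?hf //.
  by rewrite (nth_map (TZero, TZero)) ?sz // ev_tif_true // nth_zip ?hf ?hg.
have ef M (hM : model M R) (r : nat -> M) : ~ sat r c' ->
    evs r [seq tif c' ab.1 ab.2 | ab <- zip f g] = evs r g.
  move=> h; apply: (@eq_from_nth _ s0) => [|i].
    by rewrite !size_map sz.
  rewrite !size_map sz => hi; rewrite !nth_evs ?size_map ?sz ?hg //.
  by rewrite (nth_map (TZero, TZero)) ?sz // ev_tif_false // nth_zip ?hf ?hg.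
split; first by rewrite size_map.
  move=> M hM r [hG hY]; case: (classic (sat r c')) => h.
    by rewrite et //; apply: hf1 => //; split=> //; rewrite -ec.
  by rewrite ef //; apply: hg1 => //; split=> //; rewrite -ec.
apply: (IH _ _ _ _ _ _ c' hc').
  apply: (D_ext) hf2 _ => M hM r [[hG hY] h]; split=> //.
    by split=> //; rewrite -ec.
  by rewrite /nown et.
apply: (D_ext) hg2 _ => M hM r [[hG hY] h]; split=> //.
  by split=> //; rewrite -ec.
by rewrite /nown ef.
Qed.

(** Both games are played in parallel. Monotonicity of [op] is needed only at the leaves. *)
Lemma D_merge op s k nX1 nX2 nY1 nY2 G (X1 X2 Y1 Y2 : fam k) :
  (forall P P' Q Q' : Prop, (P -> P') -> (Q -> Q') -> op P Q -> op P' Q') ->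
  D s nX1 nY1 G X1 Y1 -> D s nX2 nY2 G X2 Y2 ->
  D s (fun i => nX1 i + nX2 i) (fun i => nY1 i + nY2 i) G
    (fun M r => mg op nX1 (X1 M r) (X2 M r))
    (fun M r => mg op nY1 (Y1 M r) (Y2 M r)).
Proof.
move=> hop; elim: k s nX1 nX2 nY1 nY2 G X1 X2 Y1 Y2
  => [|k IH] s nX1 nX2 nY1 nY2 G X1 X2 Y1 Y2 /=.
  by move=> h1 h2 M hM r hG; move: (h1 M hM r hG) (h2 M hM r hG);
    case: s {h1 h2} => h1 h2; apply: hop.
case=> f [hf hf1 hf2] [g [hg hg1 hg2]].
(* The opponent's moves in the two games arrive concatenated: [t1] hides the second one from the
   first strategy, and [t2] the first one from the second. *)
set m := nY1 k; set n := nY2 k; set t1 := upn m (shift n); set t2 := shift m.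
have r1 M (r : nat -> M) :
    tl m (sb t1 r) = tl (m + n) r /\ hd m (sb t1 r) = hd m r.
  by rewrite hd_upn /t1 tl_upn sb_shift_tl tl_add.
have r2 M (r : nat -> M) :
    tl n (sb t2 r) = tl (m + n) r /\ hd n (sb t2 r) = hd n (tl m r).
  by rewrite /t2 sb_shift_tl tl_add.
have th M (r : nat -> M) : take m (hd (m + n) r) = hd m r.
  by rewrite hd_add take_size_cat // size_hd.
have dh M (r : nat -> M) : drop m (hd (m + n) r) = hd n (tl m r).
  by rewrite hd_add drop_size_cat // size_hd.
have n1 M (hM : model M R) (r : nat -> M) :
    nctx G (m + n) (fun M r => mg op nY1 (Y1 M r) (Y2 M r)) r ->
    nctx G m Y1 (sb t1 r) /\ nctx G n Y2 (sb t2 r).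
  case=> hG /= []; rewrite th dh => h1 h2.
  by rewrite /nctx; case: (r1 M r) => -> ->; case: (r2 M r) => -> ->.
exists (map (tsubst t1) f ++ map (tsubst t2) g).
have ek M (r : nat -> M) : evs r (map (tsubst t1) f ++ map (tsubst t2) g)
    = evs (sb t1 r) f ++ evs (sb t2 r) g.
  by rewrite /evs map_cat -!/(evs _ _) !evs_subst.
have tk M (r : nat -> M) : take (nX1 k) (evs (sb t1 r) f ++ evs (sb t2 r) g)
    = evs (sb t1 r) f by rewrite take_size_cat // size_map.
have dk M (r : nat -> M) : drop (nX1 k) (evs (sb t1 r) f ++ evs (sb t2 r) g)
    = evs (sb t2 r) g by rewrite drop_size_cat // size_map.
split; first by rewrite size_cat !size_map hf hg.
  move=> M hM r /(n1 M hM) [h1 h2] /=; rewrite ek tk dk; split.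
    by have := hf1 _ hM _ h1; case: (r1 M r) => ->.
  by have := hg1 _ hM _ h2; case: (r2 M r) => ->.
set G' := nctx _ _ _.
have hD1 : D (~~ s) nY1 nX1 G' (fun M r => nopp m Y1 (sb t1 r))
    (fun M r => nown m f X1 (sb t1 r)).
  by apply: (D_reindex (t := t1)) hf2 _ => M hM r /(n1 M hM) [].
have hD2 : D (~~ s) nY2 nX2 G' (fun M r => nopp n Y2 (sb t2 r))
    (fun M r => nown n g X2 (sb t2 r)).
  by apply: (D_reindex (t := t2)) hg2 _ => M hM r /(n1 M hM) [].
have hD := IH _ _ _ _ _ _ _ _ _ _ hD1 hD2.
apply: D_ext hD _ => M hM r hr; split=> //.
  rewrite /nopp /=; case: (r1 M r) => -> ->; case: (r2 M r) => -> ->.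
  by rewrite -/m -/n th dh.
rewrite /nown /= ek tk dk; case: (r1 M r) => ->; case: (r2 M r) => ->.
by [].
Qed.

(** The implication aimed at is from [X] to [Y] for [s = true] and from [Y] to [X] otherwise; one
    settled side suffices for it. *)
Definition won (s : bool) k (M : struct) (X Y : sg M k) :=
  if s then leaves False X \/ leaves True Y else leaves True X \/ leaves False Y.

Lemma D_win s k nX nY G (X Y : fam k) :
  (forall M, model M R -> forall r, G M r ->
    [/\ szok (X M r), szok (Y M r) & won s (X M r) (Y M r)]) ->
  D s nX nY G X Y.
Proof.
elim: k s nX nY G X Y => [|k IH] s nX nY G X Y h /=.
  move=> M hM r hG; case: (h M hM r hG) => _ _; rewrite /won /=.
  by case: s {h}; tauto.
exists (nseq (nX k) TZero); rewrite size_nseq; split=> //.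
  move=> M hM r [hG _]; case: (h M hM _ hG) => -[h1 _] _ _.
  by rewrite /evs map_nseq.
apply: IH => M hM r [hG _]; case: (h M hM _ hG) => -[_ h1] [_ h2] h3.
split; [exact: h2 | exact: h1 |].
by move: h3; rewrite /won; case: (s) => /= -[h3|h3]; [right|left|right|left];
  apply: h3.
Qed.

(** The same moves still work: negation merely reverses the implication between the leaves. *)
Lemma D_neg s k nX nY G (X Y : fam k) : D s nX nY G X Y ->
  D (~~ s) nX nY G (fun M r => lmap not (X M r)) (fun M r => lmap not (Y M r)).
Proof.
elim: k s nX nY G X Y => [|k IH] s nX nY G X Y /=.
  by move=> h M hM r hG; move: (h M hM r hG); case: s {h} => /=; tauto.
by case=> f [hf hf1 hf2]; exists f; split=> //; apply: IH.
Qed.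

(** Copycat with the two halves of every move exchanged. *)
Lemma D_swap op op' s k n1 n2 G (A B : fam k) :
  (forall P Q, op P Q = op' Q P) ->
  D s (fun i => n1 i + n2 i) (fun i => n2 i + n1 i) G
    (fun M r => mg op n1 (A M r) (B M r)) (fun M r => mg op' n2 (B M r) (A M r)).
Proof.
elim: k op op' s n1 n2 G A B => [|k IH] op op' s n1 n2 G A B h.
  by move=> M hM r hG /=; rewrite h; case: s.
set m := n1 k; set n := n2 k.
exists (map (tshift n) (vars m) ++ vars n).
have ek M (r : nat -> M) :
    evs r (map (tshift n) (vars m) ++ vars n) = hd m (tl n r) ++ hd n r.
  by rewrite /evs map_cat -!/(evs _ _) /tshift evs_subst !evs_vars.
split; first by rewrite size_cat size_map !size_mkseq.
  move=> M hM r [hG] /=; rewrite ek -/m -/n hd_add.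
  by rewrite !take_size_cat ?drop_size_cat ?size_hd //; case.
have hop P Q : op' P Q = op Q P by rewrite h.
have := IH op' op (~~ s) n2 n1 (nctx G (n + m) (fun M r => mg op' n2 (B M r) (A M r)))
  (fun M r => (B M (tl (n + m) r)).2 (hd n r))
  (fun M r => (A M (tl (n + m) r)).2 (hd m (tl n r))) hop.
move=> hD; apply: D_ext hD _ => M hM r hr; split=> //.
  by rewrite /nopp /= -/m -/n hd_add take_size_cat ?drop_size_cat ?size_hd.
by rewrite /nown /= ek -/m -/n take_size_cat ?drop_size_cat ?size_hd.
Qed.

Lemma is_true_true : is_true true = True.
Proof. exact: propext. Qed.

Lemma is_true_false : is_true false = False.
Proof. exact: propext. Qed.

Lemma D_guard (s : bool) k nX nY G (X Y : fam k.+1) c f :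
  qfree c -> size f = nX k ->
  (forall M, model M R -> forall r : nat -> M, G M r -> szok (X M r) /\ szok (Y M r)) ->
  (forall M, model M R -> forall r : nat -> M, nctx G (nY k) Y r -> sat r c ->
     (X M (tl (nY k) r)).1 (evs r f)) ->
  (forall M, model M R -> forall r : nat -> M, nctx G (nY k) Y r -> ~ sat r c ->
     leaves s (nopp (nY k) Y r)) ->
  D (~~ s) nY nX (fun M r => nctx G (nY k) Y r /\ sat r c)
    (nopp (nY k) Y) (nown (nY k) f X) ->
  D s nX nY G X Y.
Proof.
move=> hc hf hz hmv hw hD.
pose g := map (fun t => tif c t TZero) f.
have e1 M (hM : model M R) (r : nat -> M) : sat r c -> evs r g = evs r f.
  move=> h; rewrite /evs -map_comp; apply: eq_map => t.
  by rewrite /comp ev_tif_true.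
have e0 M (hM : model M R) (r : nat -> M) : ~ sat r c ->
    evs r g = nseq (size f) s0.
  move=> h; rewrite /evs /g -map_comp (@eq_map _ _ _ (fun _ => s0)).
    by elim: (f) => //= t f' ->.
  by move=> t; rewrite /comp ev_tif_false.
exists g; rewrite size_map; split=> //.
  move=> M hM r hr; case: (classic (sat r c)) => h; first by rewrite e1 //; auto.
  by rewrite e0 //; case: hr => hG _; case: (hz M hM _ hG) => -[].
apply: (D_case hc).
  apply: D_ext hD _ => M hM r [h1 h2]; split=> //.
  by rewrite /nown e1.
apply: D_win => M hM r [h1 h2]; have h3 := hw M hM r h1 h2.
case: h1 => hG hY; case: (hz M hM _ hG) => -[_ hX1] [_ hY1].
split; [exact: hY1 | exact: hX1 |].
rewrite /won; case: (s) h3 => h3 /=; left; first by rewrite -is_true_true.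
by rewrite -is_true_false.
Qed.

(** * Reductions between prenex formulas *)

(** The semantic form of deterministic reduction between Pi formulas; [le_dred] extracts the terms
    and the derivations. *)
Definition le (G : ctx) k (A B : prenex k) : Prop :=
  D true (shp A) (shp B) G (fun M r => gm A r) (fun M r => gm B r).

Definition top : ctx := fun _ _ => True.

Section Le.
Variable k : nat.
Implicit Types (A B C : prenex k) (G : ctx).

Lemma le_trans G B A C : le G A B -> le G B C -> le G A C.
Proof. exact: D_trans. Qed.

Lemma le_eq G A B : shp A = shp B ->
  (forall M, model M R -> forall r : nat -> M, G M r -> gm A r = gm B r) ->
  le G A B.
Proof. by move=> e h; rewrite /le -e; apply: D_eq. Qed.

Lemma le_refl G A : le G A A. Proof. exact: le_eq. Qed.

Lemma le_re G G2 t A B A2 B2 : le G A B ->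
  shp A2 = shp A -> shp B2 = shp B ->
  (forall M, model M R -> forall r : nat -> M, G2 M r ->
     [/\ G M (sb t r), gm A2 r = gm A (sb t r) & gm B2 r = gm B (sb t r)]) ->
  le G2 A2 B2.
Proof. by move=> h e1 e2 h2; rewrite /le e1 e2; apply: D_reindex h h2. Qed.

Lemma le_psubst G G2 t A B : le G A B ->
  (forall M, model M R -> forall r : nat -> M, G2 M r -> G M (sb t r)) ->
  le G2 (psubst t A) (psubst t B).
Proof.
move=> h hG; apply: (le_re (t := t)) h _ _ _; rewrite ?shp_psubst // => M hM r h2.
by rewrite !gm_psubst; split=> //; apply: hG.
Qed.

Lemma le_weak G G2 A B : le G A B ->
  (forall M, model M R -> forall r : nat -> M, G2 M r -> G M r) -> le G2 A B.
Proof. by move=> h hG; apply: (D_ext h) => M hM r h2; split=> //; apply: hG. Qed.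

Lemma le_top G A B : le top A B -> le G A B.
Proof. by move=> h; apply: le_weak h _. Qed.

Lemma le_case G c A B : qfree c ->
  le (fun M r => G M r /\ sat r c) A B -> le (fun M r => G M r /\ ~ sat r c) A B ->
  le G A B.
Proof. exact: D_case. Qed.

Lemma le_win G A B :
  (forall M, model M R -> forall r : nat -> M, G M r ->
     leaves False (gm A r) \/ leaves True (gm B r)) -> le G A B.
Proof.
by move=> h; apply: D_win => M hM r hG; split; [exact: gm_szok | exact: gm_szok |
  apply: h].
Qed.

Lemma le_or G A A' B B' : le G A A' -> le G B B' ->
  le G (pmerge FOr A B) (pmerge FOr A' B').
Proof.
move=> h1 h2; rewrite /le !shp_pmergeE.
have h : forall P P' Q Q' : Prop, (P -> P') -> (Q -> Q') -> P \/ Q -> P' \/ Q'.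
  by tauto.
apply: D_ext (D_merge h h1 h2) _ => M hM r hG.
by rewrite !gm_pmerge_or.
Qed.

Lemma le_and G A A' B B' : le G A A' -> le G B B' ->
  le G (pmerge FAnd A B) (pmerge FAnd A' B').
Proof.
move=> h1 h2; rewrite /le !shp_pmergeE.
have h : forall P P' Q Q' : Prop, (P -> P') -> (Q -> Q') -> P /\ Q -> P' /\ Q'.
  by tauto.
apply: D_ext (D_merge h h1 h2) _ => M hM r hG.
by rewrite !gm_pmerge_and.
Qed.

Lemma le_orC G A B : le G (pmerge FOr A B) (pmerge FOr B A).
Proof.
rewrite /le !shp_pmergeE.
have h P Q : (P \/ Q) = (Q \/ P) by apply: propext; tauto.
apply: D_ext (D_swap true (shp A) (shp B) G (fun M r => gm A r)
   (fun M r => gm B r) h) _ => M hM r hG.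
by rewrite !gm_pmerge_or.
Qed.

Lemma le_andC G A B : le G (pmerge FAnd A B) (pmerge FAnd B A).
Proof.
rewrite /le !shp_pmergeE.
have h P Q : (P /\ Q) = (Q /\ P) by apply: propext; tauto.
apply: D_ext (D_swap true (shp A) (shp B) G (fun M r => gm A r)
   (fun M r => gm B r) h) _ => M hM r hG.
by rewrite !gm_pmerge_and.
Qed.

Lemma le_or_false G A : le G A (pmerge FOr A (pconst FFalse k)).
Proof.
apply: le_eq => [|M hM r _].
  by rewrite shp_pmergeE shp_pconst; funext i; rewrite addn0.
rewrite gm_pmerge_or mg_pconstr // lmap_id // => P /=.
by apply: propext; tauto.
Qed.

Lemma le_and_true G A :
  le G A (pmerge FAnd A (pconst FTrue k)) /\
  le G (pmerge FAnd A (pconst FTrue k)) A.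
Proof.
have e : shp A = shp (pmerge FAnd A (pconst FTrue k)).
  by rewrite shp_pmergeE shp_pconst; funext i; rewrite addn0.
have e' M (r : nat -> M) : gm (pmerge FAnd A (pconst FTrue k)) r = gm A r.
  rewrite gm_pmerge_and mg_pconstr // lmap_id // => P /=.
  by apply: propext; tauto.
by split; apply: le_eq.
Qed.

Lemma le_orl G A B : le G A (pmerge FOr A B).
Proof.
apply: le_trans (le_or_false _ _) _; apply: le_or (le_refl _ _) _.
by apply: le_win => M hM r _; left; apply: leaves_pconst_false.
Qed.

Lemma le_orr G A B : le G A (pmerge FOr B A).
Proof. exact: le_trans (le_orl _ _ B) (le_orC _ _ _). Qed.

Lemma le_andl G A B : le G (pmerge FAnd A B) A.
Proof.
apply: le_trans _ (proj2 (le_and_true _ _)); apply: le_and (le_refl _ _) _.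
by apply: le_win => M hM r _; right; apply: leaves_pconst_true => -[].
Qed.

Lemma le_andr G A B : le G (pmerge FAnd A B) B.
Proof. exact: le_trans (le_andC _ _ _) (le_andl _ _ _). Qed.

Lemma le_and_won G A B :
  (forall M, model M R -> forall r : nat -> M, G M r -> leaves True (gm B r)) ->
  le G A (pmerge FAnd A B).
Proof.
move=> h; apply: le_trans (proj1 (le_and_true _ _)) _.
by apply: le_and (le_refl _ _) _; apply: le_win => M hM r hG; right; apply: h.
Qed.

Lemma pguard_true G N A :
  (forall M, model M R -> forall r : nat -> M, G M r -> sat r N) ->
  le G (pguard FImp N A) A /\ le G A (pguard FImp N A).
Proof.
move=> h.
have e M (hM : model M R) (r : nat -> M) : G M r -> gm (pguard FImp N A) r = gm A r.
  move=> hG; rewrite gm_guard_imp lmap_id // => P.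
  by apply: propext; have := h M hM r hG; tauto.
by split; apply: le_eq; rewrite ?shp_pguard // => M hM r hG; rewrite e.
Qed.

Lemma pguard_false M (r : nat -> M) N A : ~ sat r N ->
  leaves True (gm (pguard FImp N A) r).
Proof. by move=> h; rewrite gm_guard_imp; apply: leaves_lmap => P; tauto. Qed.

(** Definition by cases within the class. Where [c] is decided, the guard of the other conjunct
    makes all its leaves true, so that conjunct can be ignored. *)
Definition pif (c : form) A B : prenex k :=
  pmerge FAnd (pguard FImp c A) (pguard FImp (FNot c) B).

Lemma pif_true G c A B :
  (forall M, model M R -> forall r : nat -> M, G M r -> sat r c) ->
  le G (pif c A B) A /\ le G A (pif c A B).
Proof.
move=> h; case: (pguard_true A h) => h1 h2; split.
  exact: le_trans (le_andl _ _ _) h1.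
apply: le_trans h2 _; apply: le_and_won => M hM r hG.
by apply: pguard_false => /= h3; apply: h3; apply: h hG.
Qed.

Lemma pif_false G c A B :
  (forall M, model M R -> forall r : nat -> M, G M r -> ~ sat r c) ->
  le G (pif c A B) B /\ le G B (pif c A B).
Proof.
move=> h; have [h1 h2] : le G (pguard FImp (FNot c) B) B /\
    le G B (pguard FImp (FNot c) B) by apply: pguard_true.
split; first exact: le_trans (le_andr _ _ _) h1.
apply: le_trans h2 (le_trans _ (le_andC _ _ _)).
by apply: le_and_won => M hM r hG; apply: pguard_false; apply: h hG.
Qed.

Lemma psubst_pif_true G s c A B :
  (forall M, model M R -> forall r : nat -> M, G M r -> sat (sb s r) c) ->
  le G (psubst s (pif c A B)) (psubst s A) /\
  le G (psubst s A) (psubst s (pif c A B)).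
Proof.
by move=> h; split; apply: (le_psubst (G := fun M r => sat r c)) => //;
  [apply: (proj1 (pif_true _ _ _)) | apply: (proj2 (pif_true _ _ _))].
Qed.

Lemma psubst_pif_false G s c A B :
  (forall M, model M R -> forall r : nat -> M, G M r -> ~ sat (sb s r) c) ->
  le G (psubst s (pif c A B)) (psubst s B) /\
  le G (psubst s B) (psubst s (pif c A B)).
Proof.
by move=> h; split; apply: (le_psubst (G := fun M r => ~ sat r c)) => //;
  [apply: (proj1 (pif_false _ _ _)) | apply: (proj2 (pif_false _ _ _))].
Qed.

End Le.

(** * Bounded universal quantification of a prenex formula *)

Definition insts (ts : seq term) (s : nat -> term) : nat -> term :=
  fun i => if i < size ts then nth TZero ts i else s (i - size ts).

Lemma sb_insts (M : struct) ts s (r : nat -> M) :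
  sb (insts ts s) r = ext (size ts) (evs r ts) (sb s r).
Proof.
by funext i; rewrite /sb /insts /ext; case: ltnP => h //; rewrite nth_evs.
Qed.

(* [forall ys <= ps, H(ys)], where [ys] are the first variables of [H].  The
   bounds of the first block of [H] may depend on [ys], so they are replaced by
   majorants and moved to the matrix. *)
Definition pall (ps : seq term) k (H : prenex k.+1) : prenex k.+1 :=
  ([seq tsubst (insts ps Var) (maj q) | q <- H.1] ++ ps,
   pguard FImp (FLes (vars (size H.1)) (map (tshift (size H.1)) H.1)) H.2).

Section Pall.
Variable k : nat.
Implicit Types (A B H : prenex k.+1) (G : ctx).

Definition pall_guard H : form :=
  FLes (vars (size H.1)) (map (tshift (size H.1)) H.1).

Lemma sat_pall_guard M (r : nat -> M) H :
  sat r (pall_guard H) <->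
  (gm H (tl (size H.1) r)).1 (hd (size H.1) r).
Proof.
rewrite sat_FLes ?size_map ?size_iota // /tshift evs_subst evs_vars.
by [].
Qed.

Lemma qfree_FLes s t : qfree (FLes s t).
Proof. by rewrite /FLes; elim: s t => [|a s IH] [|b t] //=. Qed.

Lemma pall_bound M (r : nat -> M) ps w qs v : model M R -> size w = size ps ->
  vle w (evs r ps) -> vle v (evs (ext (size ps) w r) qs) ->
  vle v (evs r [seq tsubst (insts ps Var) (maj q) | q <- qs]).
Proof.
move=> hM hs hw hv i; rewrite !size_map => hi.
have := hv i; rewrite size_map => /(_ hi); rewrite !nth_evs ?size_map // => h.
apply: sle_trans h _ => //; rewrite (nth_map TZero) // ev_subst.
apply: ev_maj => // j; rewrite sb_insts sb_id /ext; case: ltnP => hj.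
  by apply: hw; rewrite size_map.
exact: slexx.
Qed.

Lemma gm_pall1 M (r : nat -> M) ps H v :
  (gm (pall ps H) r).1 v <->
  vle (take (size H.1) v) (evs r [seq tsubst (insts ps Var) (maj q) | q <- H.1])
  /\ vle (drop (size H.1) v) (evs r ps).
Proof. by rewrite /= /evs map_cat vle_cat !size_map. Qed.

Lemma ext_ext M (r : nat -> M) m n v :
  ext (m + n) v r = ext m (take m v) (ext n (drop m v) r).
Proof.
funext i; rewrite /ext nth_drop; case: (ltnP i m) => h.
  by rewrite nth_take // ltn_addr.
by rewrite subnKC // -[i - m < n](ltn_add2l m) subnKC // subnDA.
Qed.

Lemma gm_pall2 M (r : nat -> M) ps H v :
  let r' := ext (size ps) (drop (size H.1) v) r in
  let w := take (size H.1) v in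
  size w = size H.1 ->
  (gm (pall ps H) r).2 v = lmap (fun P => (gm H r').1 w -> P) ((gm H r').2 w).
Proof.
move=> r' w hw /=; rewrite gm_guard_imp size_cat size_map ext_ext -/r' -/w.
apply: lmap_ext => P; congr (_ -> P); apply: propext.
by rewrite -/(pall_guard H) sat_pall_guard tl_ext hd_ext.
Qed.

Lemma shp_pall ps H i :
  shp (pall ps H) i = if i == k then size H.1 + size ps else shp H.2 i.
Proof. by rewrite /= size_cat size_map shp_pguard. Qed.

(** The opponent chooses [ys] and the first block of [H] in a single move, and the given strategy
    reads [ys] from the environment. A move below the majorants but not below the actual bounds
    falsifies the guard in the matrix, which is the case handled by [D_guard]. *)
Lemma le_pall_intro G X s ps H :
  le (fun M r => G M (tl (size ps) r) /\
        vle (hd (size ps) r) (evs (sb s (tl (size ps) r)) ps))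
     (psubst (shift (size ps)) X) (psubst (upn (size ps) s) H) ->
  le G X (psubst s (pall ps H)).
Proof.
set n := size ps; set m := size H.1 => hle.
rewrite /le /= !eqxx !size_map in hle.
case: hle => f; rewrite -/m => -[hf hf1 hf2].
set H' := psubst (upn n s) H.
have hm : size H'.1 = m by rewrite size_map.
have gp M (r : nat -> M) : gm (psubst s (pall ps H)) r = gm (pall ps H) (sb s r).
  exact: gm_psubst.
set Y : fam k.+1 := fun M r => gm (psubst s (pall ps H)) r.
set G' : ctx := fun M r => G M (tl n r) /\ vle (hd n r) (evs (sb s (tl n r)) ps).
have gg M (r : nat -> M) : sat r (pall_guard H') <->
    (gm H' (tl m r)).1 (hd m r).
  by rewrite sat_pall_guard hm.
have hY M (r : nat -> M) : nctx G (m + n) Y r -> G' M (tl m r).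
  case=> hG; rewrite /Y gp => /gm_pall1 [_]; rewrite -/m hd_add.
  by rewrite drop_size_cat ?size_hd // => h; split; rewrite tl_add.
have gH M (r : nat -> M) : gm H' (tl m r) =
    gm H (ext n (hd n (tl m r)) (sb s (tl (m + n) r))).
  by rewrite /H' gm_psubst -{1}(ext_hd n (tl m r)) sb_upn tl_add.
have n2 M (r : nat -> M) : nopp (m + n) Y r =
    lmap (fun P => sat r (pall_guard H') -> P) ((gm H' (tl m r)).2 (hd m r)).
  rewrite /nopp /Y gp gm_pall2 -/m -/n hd_add take_size_cat ?drop_size_cat
    ?size_hd // -gH.
  by apply: lmap_ext => P; congr (_ -> P); apply: propext; rewrite gg.
change (D true (shp X) (shp (psubst s (pall ps H))) G (fun M r => gm X r) Y).
have eY : shp (psubst s (pall ps H)) k = m + n.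
  by rewrite shp_psubst shp_pall eqxx.
apply: (D_guard (c := pall_guard H') (f := f)).
- exact: qfree_FLes.
- by rewrite hf /= eqxx.
- by move=> M hM r _; split; apply: gm_szok.
- rewrite eY => M hM r hr hc.
  have := hf1 M hM r; rewrite -/m => h; have {}h : vle (evs r f)
     (evs (tl m r) [seq tsubst (shift n) i | i <- X.1]).
    by apply: h; split; [apply: hY | apply/gg].
  by move: h; rewrite evs_subst sb_shift_tl tl_add.
- rewrite eY => M hM r hr hc; rewrite n2; apply: leaves_lmap => P.
  by split=> // _ /hc.
- rewrite eY; apply: D_shp (D_ext hf2 _).
  + by move=> i hi; rewrite /= ?shp_psubst ?shp_pguard !ltn_eqF.
  + by move=> i hi; rewrite /= ?shp_psubst ?shp_pguard !ltn_eqF.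
  + move=> M hM r [hr hc]; split.
    * by split; [apply: hY | apply/gg].
    * rewrite n2 lmap_id; first by rewrite /nopp /H' /= size_map.
      by move=> P; apply: propext; split=> [|p _ //]; apply.
    * by rewrite /nown /= gm_psubst sb_upn sb_shift_tl tl_add.
Qed.

(** The answer is [ts] together with a copy of the opponent's move in [H]; by [pall_bound] the copy
    respects the majorants. *)
Lemma le_pall_elim G s ps ts H : size ts = size ps ->
  (forall M, model M R -> forall r : nat -> M, G M r ->
     vle (evs r ts) (evs (sb s r) ps)) ->
  le G (psubst s (pall ps H)) (psubst (insts ts s) H).
Proof.
move=> hs hts; set n := size ps; set m := size H.1.
pose f := vars m ++ map (tshift m) ts.
set X : fam k.+1 := fun M r => gm (psubst s (pall ps H)) r.
set Y : fam k.+1 := fun M r => gm (psubst (insts ts s) H) r.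
have ef M (r : nat -> M) : evs r f = hd m r ++ evs (tl m r) ts.
  by rewrite /evs map_cat -!/(evs _ _) evs_vars /tshift evs_subst.
have eX : shp (psubst s (pall ps H)) k = m + n.
  by rewrite shp_psubst shp_pall eqxx.
have eY : shp (psubst (insts ts s) H) k = m by rewrite shp_psubst /= eqxx.
have gp M (r : nat -> M) : gm (psubst s (pall ps H)) r = gm (pall ps H) (sb s r).
  exact: gm_psubst.
have gY M (r : nat -> M) : Y M r = gm H (ext n (evs r ts) (sb s r)).
  by rewrite /Y gm_psubst sb_insts hs.
change (D true (shp (psubst s (pall ps H))) (shp (psubst (insts ts s) H)) G X Y).
exists f; rewrite eX eY; split.
- by rewrite size_cat size_mkseq size_map hs.
- move=> M hM r [hG]; rewrite gY /X gp gm_pall1 ef -/m.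
  rewrite take_size_cat ?drop_size_cat ?size_hd // => h.
  have ht := hts M hM _ hG; split=> //.
  by apply: (pall_bound hM) ht h; rewrite size_map.
- set nY := shp (psubst (insts ts s) H); set nX := shp (psubst s (pall ps H)).
  apply: (@D_shp _ _ nY nY nY nX) => //; last first.
    apply: D_eq => M hM r [hG hY].
    rewrite /nopp /nown gY /X gp gm_pall2 ef -/m ?take_size_cat ?drop_size_cat
      ?size_hd // -/n -gY lmap_id // => P.
    by apply: propext; split=> [|p _ //]; apply.
  move=> i hi; rewrite /nX /nY !shp_psubst shp_pall ltn_eqF //= ltn_eqF //.
Qed.

(** The opponent fixes [ys] and the first blocks of [H] and [Z] simultaneously, so there is nothing
    to wait for: the answer is a permutation of the move. *)
Lemma le_pall_or G ps H Z :
  le G (pall ps (pmerge FOr H (psubst (shift (size ps)) Z)))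
       (pmerge FOr (pall ps H) Z).
Proof.
set n := size ps; set m := size H.1; set d := size Z.1.
set HZ := pmerge FOr H (psubst (shift n) Z).
have sHZ : size HZ.1 = m + d by rewrite size_cat size_map.
pose f := vars m ++ map (tshift (m + n)) (vars d) ++ map (tshift m) (vars n).
set X : fam k.+1 := fun M r => gm (pall ps HZ) r.
set Y : fam k.+1 := fun M r => gm (pmerge FOr (pall ps H) Z) r.
have ef M (r : nat -> M) :
    evs r f = hd m r ++ hd d (tl (m + n) r) ++ hd n (tl m r).
  by rewrite /evs !map_cat -!/(evs _ _) /tshift !evs_subst !evs_vars.
have ef' M (r : nat -> M) :
    take (m + d) (evs r f) = hd m r ++ hd d (tl (m + n) r) /\
    drop (m + d) (evs r f) = hd n (tl m r).
  by rewrite ef catA take_size_cat ?drop_size_cat // size_cat !size_hd.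
have eX : shp (pall ps HZ) k = m + d + n by rewrite shp_pall eqxx sHZ.
have eY : shp (pmerge FOr (pall ps H) Z) k = m + n + d.
  by rewrite shp_pmerge shp_pall eqxx /= eqxx.
have hh M (r : nat -> M) : take (m + n) (hd (m + n + d) r) = hd (m + n) r /\
    drop (m + n) (hd (m + n + d) r) = hd d (tl (m + n) r).
  by rewrite hd_add take_size_cat ?drop_size_cat // size_hd.
have gX M (r : nat -> M) : X M r = gm (pall ps HZ) r by [].
have gY M (r : nat -> M) v : (Y M r).1 v <->
    (gm (pall ps H) r).1 (take (m + n) v) /\ (gm Z r).1 (drop (m + n) v).
  by rewrite /Y gm_pmerge_or /= eqxx size_cat size_map.
have gY2 M (r : nat -> M) v : (Y M r).2 v =
    mg or (shp (pall ps H)) ((gm (pall ps H) r).2 (take (m + n) v))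
       ((gm Z r).2 (drop (m + n) v)).
  by rewrite /Y gm_pmerge_or /= eqxx size_cat size_map.
change (D true (shp (pall ps HZ)) (shp (pmerge FOr (pall ps H) Z)) G X Y).
exists f; rewrite eX eY; split.
- by rewrite !size_cat !size_map !size_iota addnA.
- move=> M hM r [hG]; rewrite gY gX gm_pall1; case: (hh M r) => -> ->.
  rewrite gm_pall1 -/m hd_add take_size_cat ?drop_size_cat ?size_hd //.
  move=> [[h1 h2] h3]; rewrite sHZ; case: (ef' M r) => -> ->.
  split=> //; rewrite /evs map_cat map_cat vle_cat !size_map -/m.
  rewrite take_size_cat ?drop_size_cat ?size_hd //; split=> //.
  apply: (@pall_bound _ _ _ (hd n (tl m r))) => //; first by rewrite size_hd.
  by rewrite evs_subst sb_shift_tl tl_ext.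
- set nY := shp (pmerge FOr (pall ps H) Z); set nX := shp (pall ps HZ).
  apply: (@D_shp _ _ nY nY nY nX) => //; last first.
    apply: D_eq => M hM r [hG hY].
    rewrite /nopp /nown gY2 gX (@gm_pall2 _ _ ps HZ); last first.
      by rewrite sHZ; case: (ef' M r) => -> _; rewrite size_cat !size_hd.
    rewrite sHZ; case: (ef' M r) => -> ->.
    case: (hh M r) => -> ->; rewrite gm_pall2 -/m hd_add;
      rewrite take_size_cat ?drop_size_cat ?size_hd //.
    rewrite /HZ gm_pmerge_or /= eqxx -/m take_size_cat ?drop_size_cat ?size_hd //.
    rewrite size_map gm_psubst sb_upn sb_shift_tl tl_ext evs_subst sb_shift_tl tl_ext.
    move/gY: hY; case: (hh M r) => -> -> [_ h3].
    (* [P1] and [P2] say that the moves in [H] and in [Z] obey their own bounds. Legality of the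
       opponent's move gives [P2], so the common guard reduces to a guard on the left disjunct. *)
    set P1 := vle _ _; set P2 := vle _ _.
    rewrite (mg_lmapl (op' := fun P Q => (P1 -> P) \/ Q)) //.
    rewrite (lmap_mg (op' := fun P Q => (P1 -> P) \/ Q)).
      apply: mg_shp => i hi; by rewrite ltn_eqF // shp_pguard.
    move=> P Q; apply: propext; split=> [h | h [hP1 _]]; last by tauto.
    by case: (classic P1) => hP1; [| left]; tauto.
  move=> i hi; rewrite /nX /nY shp_pall ltn_eqF // shp_pmerge shp_pall ltn_eqF //.
  by rewrite /HZ /= shp_pmerge !shp_psubst ltn_eqF.
Qed.

End Pall.

Lemma le_psubst_comp k (A : prenex k) G s t u :
  (forall M, model M R -> forall r : nat -> M, G M r ->
     sb t (sb s r) = sb u r) ->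
  le G (psubst s (psubst t A)) (psubst u A) /\
  le G (psubst u A) (psubst s (psubst t A)).
Proof.
by move=> h; split; apply: le_eq => [|M hM r hG];
  rewrite ?shp_psubst // !gm_psubst h.
Qed.

Lemma le_psubst_comp2 k (A : prenex k) G s t s' t' :
  (forall M, model M R -> forall r : nat -> M, G M r ->
     sb t (sb s r) = sb t' (sb s' r)) ->
  le G (psubst s (psubst t A)) (psubst s' (psubst t' A)).
Proof.
by move=> h; apply: le_eq => [|M hM r hG];
  rewrite ?shp_psubst // !gm_psubst h.
Qed.

Lemma le_psubst_id k (A : prenex k) G s :
  (forall M, model M R -> forall r : nat -> M, G M r -> sb s r = r) ->
  le G (psubst s A) A /\ le G A (psubst s A).
Proof.
by move=> h; split; apply: le_eq => [|M hM r hG];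
  rewrite ?shp_psubst // !gm_psubst h.
Qed.

Lemma le_unshift k (A : prenex k) G s :
  (forall M (r : nat -> M), tl 1 (sb s r) = r) ->
  le G (psubst s (psubst (shift 1) A)) A /\
  le G A (psubst s (psubst (shift 1) A)).
Proof.
by move=> h; split; apply: le_eq => [|M hM r _];
  rewrite ?shp_psubst // !gm_psubst sb_shift_tl h.
Qed.

Lemma le_psubst_or k (A B : prenex k) G s :
  le G (psubst s (pmerge FOr A B)) (pmerge FOr (psubst s A) (psubst s B)) /\
  le G (pmerge FOr (psubst s A) (psubst s B)) (psubst s (pmerge FOr A B)).
Proof.
have e : shp (psubst s (pmerge FOr A B)) =
    shp (pmerge FOr (psubst s A) (psubst s B)).
  by rewrite shp_psubst !shp_pmergeE !shp_psubst.
have e2 M (r : nat -> M) : gm (psubst s (pmerge FOr A B)) r =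
    gm (pmerge FOr (psubst s A) (psubst s B)) r.
  by rewrite gm_psubst !gm_pmerge_or !shp_psubst !gm_psubst.
by split; apply: le_eq.
Qed.

Lemma le_pall_intro0 k G (X : prenex k.+1) ps H :
  le (fun M r => G M (tl (size ps) r) /\
        vle (hd (size ps) r) (evs (tl (size ps) r) ps))
     (psubst (shift (size ps)) X) H ->
  le G X (pall ps H).
Proof.
move=> h; apply: (@le_trans _ _ (psubst Var (pall ps H))); last first.
  by case: (@le_psubst_id _ (pall ps H) G Var).
apply: le_pall_intro; apply: le_trans (le_weak h _) _ => //.
case: (@le_psubst_id _ H (fun M r => G M (tl (size ps) r) /\
  vle (hd (size ps) r) (evs (sb Var (tl (size ps) r)) ps)) (upn (size ps) Var)) => //.
move=> M hM r _; funext i; rewrite /sb upnE; case: ltnP => h' //=.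
by rewrite subnKC.
Qed.

(** * Additive conjunction *)

(** Without blocks there is no move with which to choose a side, but there plain conjunction is
    already a meet. *)
Definition pwith k : prenex k -> prenex k -> prenex k :=
  match k return prenex k -> prenex k -> prenex k with
  | 0 => FAnd
  | k'.+1 => fun A B => pall [:: TOne]
      (pif (FEq (Var 0) TZero) (psubst (shift 1) A) (psubst (shift 1) B))
  end.

Section With.
Variable k : nat.
Implicit Types (A B C X : prenex k) (G : ctx).

Lemma le_with G s X A B : le G X (psubst s A) -> le G X (psubst s B) ->
  le G X (psubst s (pwith A B)).
Proof.
case: k X A B => [|k'] X A B hA hB.
  move=> M hM r hG hX; split; [exact: hA hX | exact: hB hX].
apply: le_pall_intro; set G' : ctx := fun M r => _.
have hs (C : prenex k'.+1) : le G X (psubst s C) ->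
    le G' (psubst (shift 1) X) (psubst (upn 1 s) (psubst (shift 1) C)).
  move=> h; apply: (le_re (t := shift 1)) h _ _ _; rewrite ?shp_psubst // => M hM r [hG _].
  by rewrite !gm_psubst !sb_shift_tl tl_upn.
apply: (le_case (c := FEq (Var 0) TZero)) => //.
- apply: le_trans (le_weak (hs _ hA) _) _; first by move=> M hM r [].
  by apply: (proj2 (psubst_pif_true _ _ _)) => M hM r [].
- apply: le_trans (le_weak (hs _ hB) _) _; first by move=> M hM r [].
  by apply: (proj2 (psubst_pif_false _ _ _)) => M hM r [].
Qed.

Lemma le_withl G s A B : le G (psubst s (pwith A B)) (psubst s A).
Proof.
case: k A B => [|k'] A B; first by move=> M hM r hG [].
have h : forall M, model M R -> forall r : nat -> M, G M r ->
    vle (evs r [:: TZero]) (evs (sb s r) [:: TOne]).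
  by move=> M hM r _ [|i] // _; apply: sle0.
apply: le_trans (le_pall_elim _ _ h) _ => //.
apply: le_trans (proj1 (psubst_pif_true _ _ _)) _ => //.
by apply: (proj1 (le_psubst_comp _ _)) => M hM r _; rewrite sb_insts; apply: tl_ext.
Qed.

Lemma le_withr G s A B : le G (psubst s (pwith A B)) (psubst s B).
Proof.
case: k A B => [|k'] A B; first by move=> M hM r hG [].
have h : forall M, model M R -> forall r : nat -> M, G M r ->
    vle (evs r [:: TOne]) (evs (sb s r) [:: TOne]).
  by move=> M hM r _ [|i] // _; apply: slexx.
apply: le_trans (le_pall_elim _ _ h) _ => //.
apply: le_trans (proj1 (psubst_pif_false _ _ _)) _ => //.
  by move=> M hM r _ /=; apply: s1_neq0.
by apply: (proj1 (le_psubst_comp _ _)) => M hM r _; rewrite sb_insts; apply: tl_ext.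
Qed.

Lemma le_with0 G X A B : le G X A -> le G X B -> le G X (pwith A B).
Proof.
move=> hA hB; have h C : le G C (psubst Var C) /\ le G (psubst Var C) C.
  by split; [apply: (proj2 (le_psubst_id _ _)) | apply: (proj1 (le_psubst_id _ _))].
apply: le_trans _ (proj2 (h _)); apply: le_with.
  exact: le_trans hA (proj1 (h _)).
exact: le_trans hB (proj1 (h _)).
Qed.

Lemma le_withl0 G A B : le G (pwith A B) A.
Proof.
apply: le_trans (proj2 (le_psubst_id (s := Var) _ _)) _ => //.
apply: le_trans (le_withl _ _ _ _) _.
exact: (proj1 (le_psubst_id _ _)).
Qed.

Lemma le_withr0 G A B : le G (pwith A B) B.
Proof.
apply: le_trans (proj2 (le_psubst_id (s := Var) _ _)) _ => //.
apply: le_trans (le_withr _ _ _ _) _.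
exact: (proj1 (le_psubst_id _ _)).
Qed.

End With.

(* [C & (A | Z)] reduces to [(C & A) | Z] in one step: the choice of a side is
   the opponent's first move, hence precedes ours. *)
Lemma le_with_or k G (A C Z : prenex k) :
  le G (pwith C (pmerge FOr A Z)) (pmerge FOr (pwith C A) Z).
Proof.
case: k A C Z => [|k'] A C Z.
  by move=> M hM r hG [h1 [h2|h2]]; [left | right].
pose H := pif (FEq (Var 0) TZero) (psubst (shift 1) C) (psubst (shift 1) A).
apply: (le_trans (B := pall [:: TOne] (pmerge FOr H (psubst (shift 1) Z))));
  last exact: le_pall_or.
apply: le_pall_intro0; set G' : ctx := fun M r => _.
apply: (le_case (c := FEq (Var 0) TZero)) => //.
- apply: le_trans (le_withl _ (shift 1) C (pmerge FOr A Z)) _.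
  apply: le_trans (le_orl _ _ (psubst (shift 1) Z)).
  by apply: (proj2 (pif_true _ _ _)) => M hM r [].
- apply: le_trans (le_withr _ (shift 1) C (pmerge FOr A Z)) _.
  apply: le_trans (proj1 (le_psubst_or _ _ _ _)) _.
  apply: le_or (le_refl _ _).
  by apply: (proj2 (pif_false _ _ _)) => M hM r [].
Qed.

Lemma UhatE k (A : prenex k) : Uhat A = qfree (matrix A). Proof. by []. Qed.

Lemma matrix_psubst k (A : prenex k) s : qfree (matrix (psubst s A)) = qfree (matrix A).
Proof. by elim: k A s => [|k IH] A s /=; rewrite ?qfree_subst ?IH. Qed.

Lemma matrix_guard op k (A : prenex k) N :
  (forall C E, qfree (op C E) = qfree C && qfree E) ->
  qfree (matrix (pguard op N A)) = qfree N && qfree (matrix A).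
Proof.
move=> hop; elim: k A N => [|k IH] A N /=; first exact: hop.
by rewrite IH qfree_subst.
Qed.

Lemma matrix_merge op k (A B : prenex k) :
  (forall C E, qfree (op C E) = qfree C && qfree E) ->
  qfree (matrix (pmerge op A B)) = qfree (matrix A) && qfree (matrix B).
Proof.
move=> hop; elim: k A B => [|k IH] A B /=; first exact: hop.
by rewrite IH !matrix_psubst.
Qed.

Lemma Uhat_or k (A B : prenex k) : Uhat A -> Uhat B -> Uhat (pmerge FOr A B).
Proof. by rewrite !UhatE matrix_merge // => -> ->. Qed.

Lemma Uhat_and k (A B : prenex k) : Uhat A -> Uhat B -> Uhat (pmerge FAnd A B).
Proof. by rewrite !UhatE matrix_merge // => -> ->. Qed.

Lemma Uhat_psubst k (A : prenex k) s : Uhat A -> Uhat (psubst s A).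
Proof. by rewrite !UhatE matrix_psubst. Qed.

Lemma Uhat_imp k (A : prenex k) N : qfree N -> Uhat A -> Uhat (pguard FImp N A).
Proof. by rewrite !UhatE matrix_guard // => -> ->. Qed.

Lemma Uhat_pif c k (A B : prenex k) : qfree c -> Uhat A -> Uhat B -> Uhat (pif c A B).
Proof. by move=> hc hA hB; apply: Uhat_and; apply: Uhat_imp; rewrite //= hc. Qed.

Lemma Uhat_pall ps k (H : prenex k.+1) : Uhat H -> Uhat (pall ps H).
Proof. by move=> h; rewrite UhatE /= matrix_guard // qfree_FLes. Qed.

Lemma Uhat_with k (A B : prenex k) : Uhat A -> Uhat B -> Uhat (pwith A B).
Proof.
case: k A B => [|k] A B hA hB; first by rewrite UhatE /=; apply/andP.
by apply: Uhat_pall; apply: Uhat_pif => //; apply: Uhat_psubst.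
Qed.

Lemma Uhat_const k N : qfree N -> Uhat (pconst N k).
Proof. by rewrite !UhatE; elim: k. Qed.

(** * Flows *)

Definition stepv : nat -> term := scons (TAdd (Var 0) TOne) (shift 1).

(* Unlike in [dflow], the steps are unconditional, and any sufficiently long
   iteration reaches the end. *)
Definition flow k (A B : prenex k) : Prop := exists (t : term) (H : prenex k),
  [/\ Uhat H,
      le top A (psubst (scons TZero Var) H),
      le top H (psubst stepv H)
    & le (fun M r => sle (ev (tl 1 r) t) (r 0)) H (psubst (shift 1) B)].

Lemma sb_stepv M (r : nat -> M) : sb stepv r = econs (sadd (r 0) s1) (tl 1 r).
Proof. by funext i; case: i. Qed.

Lemma sb_scons0 (M : struct) t (r : nat -> M) : sb (scons t Var) r = econs (ev r t) r.
Proof. by rewrite sb_scons sb_id. Qed.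

Lemma sb_scons_shift (M : struct) t n (r : nat -> M) :
  sb (scons t (shift n)) r = econs (ev r t) (tl n r).
Proof. by rewrite sb_scons. Qed.

Lemma ev_tshift (M : struct) n t (r : nat -> M) : ev r (tshift n t) = ev (tl n r) t.
Proof. by rewrite /tshift ev_subst. Qed.

Section Flow.
Variable k : nat.
Implicit Types (A B C X : prenex k).

Lemma flow_le A B : Uhat A -> le top A B -> flow A B.
Proof.
move=> uA h; exists TZero, (psubst (shift 1) A); split.
- exact: Uhat_psubst.
- apply: le_trans (proj2 (le_psubst_id (s := Var) _ _)) _ => //.
  by apply: (proj2 (le_psubst_comp _ _)) => M hM r _; rewrite sb_scons0.
- by apply: (proj2 (le_psubst_comp _ _)) => M hM r _; rewrite sb_stepv.
- exact: le_psubst h _.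
Qed.

Lemma flow_lel A A' B : le top A' A -> flow A B -> flow A' B.
Proof. by move=> h [t [H [uH h1 h2 h3]]]; exists t, H; split=> //; apply: le_trans h h1. Qed.

Lemma flow_ler B A B' : flow A B -> le top B B' -> flow A B'.
Proof.
move=> [t [H [uH h1 h2 h3]]] h; exists t, H; split=> //.
by apply: le_trans h3 _; apply: le_psubst h _.
Qed.

Lemma flow_refl A : Uhat A -> flow A A.
Proof. by move=> h; apply: flow_le h (le_refl _ _). Qed.

(** [H1] occupies the steps up to [t1], and [H2] begins at [t1 + 1]. The step between them passes
    through [B]: the end condition of [H1] at [t1], followed by the beginning of [H2]. *)
Lemma flow_trans B A C : flow A B -> flow B C -> flow A C.
Proof.
move=> [t1 [H1 [u1 a1 b1 c1]]] [t2 [H2 [u2 a2 b2 c2]]].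
pose s2 := scons (TSub (Var 0) (TAdd (tshift 1 t1) TOne)) (shift 1).
pose c := FLe (Var 0) (tshift 1 t1).
have es2 M (r : nat -> M) : sb s2 r =
    econs (ssub (r 0) (sadd (ev (tl 1 r) t1) s1)) (tl 1 r).
  by rewrite sb_scons_shift /= ev_tshift.
exists (TAdd (TAdd t1 TOne) t2), (pif c H1 (psubst s2 H2)); split.
- by apply: Uhat_pif => //; apply: Uhat_psubst.
- apply: le_trans a1 _; apply: (proj2 (psubst_pif_true _ _ _)) => M hM r _ /=.
  by rewrite ev_tshift; apply: sle0.
- apply: (le_case (c := FLe (TAdd (Var 0) TOne) (tshift 1 t1))) => //.
    apply: (le_trans (proj1 (pif_true _ _ _))) => [M hM r [_]|] /=.
      by apply: sle_trans => //; apply: sle_addr.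
    apply: le_trans (le_top _ b1) _.
    apply: (proj2 (psubst_pif_true _ _ _)) => M hM r [_] /=.
    by rewrite !ev_tshift.
  have hf : forall M, model M R -> forall r : nat -> M,
      True /\ ~ sat r (FLe (TAdd (Var 0) TOne) (tshift 1 t1)) ->
      ~ sat (sb stepv r) c by move=> M hM r [_] /=; rewrite !ev_tshift.
  apply: (le_case (c := c)) => //.
    apply: (le_trans (proj1 (pif_true _ _ _))) => [M hM r [] //|].
    have hc1 := le_weak c1; apply: le_trans (hc1 _ _) _ => {hc1}.
      move=> M hM r [[_ /=]]; rewrite !ev_tshift => h1 h2.
      by apply/(sltS_le hM); apply/(sltNge hM).
    apply: le_trans (le_psubst a2 _) _ => //.
    apply: (le_trans (B := psubst stepv (psubst s2 H2))); last first.
      apply: (proj2 (psubst_pif_false _ _ _)) => M hM r [h _]; exact: hf h.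
    apply: le_psubst_comp2 => M hM r [_ /=]; rewrite ev_tshift => h.
    rewrite es2 sb_stepv sb_scons0 ssub_le0 //.
    exact/sle_add2r.
  apply: (le_trans (proj1 (pif_false _ _ _))) => [M hM r [] //|].
  apply: le_trans (le_psubst (t := s2) b2 _) _ => //.
  apply: (le_trans (B := psubst stepv (psubst s2 H2))); last first.
    apply: (proj2 (psubst_pif_false _ _ _)) => M hM r [h _]; exact: hf h.
  apply: le_psubst_comp2 => M hM r [_ /=]; rewrite ev_tshift.
  move/(sltNge hM)/(slt_succP hM) => h.
  rewrite es2 !sb_stepv es2; congr econs => /=.
  apply: (@sadd_inj _ hM (sadd (ev (tl 1 r) t1) s1)).
  rewrite ssubK //; last exact: sle_trans h (sle_addr hM _ _).
  rewrite -{2}(ssubK hM h) !saddA //; congr sadd.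
  by rewrite saddC // saddA.
- have hf : forall M, model M R -> forall r : nat -> M,
      sle (ev (tl 1 r) (TAdd (TAdd t1 TOne) t2)) (r 0) -> ~ sat r c.
    move=> M hM r /= h; rewrite ev_tshift; apply/(sltNge hM)/(slt_succP hM).
    exact: sle_trans (sle_addr hM _ _) h.
  apply: (le_trans (proj1 (pif_false _ _ _))) => [//|].
  apply: le_trans (le_psubst (t := s2) c2 _) _ => [M hM r h|].
    rewrite es2 /=; apply/(sle_add2r hM (sadd (ev (tl 1 r) t1) s1)).
    rewrite ssubK //; last exact: sle_trans (sle_addr hM _ _) h.
    by rewrite saddC.
  by apply: (proj1 (le_psubst_comp _ _)) => M hM r _; rewrite es2.
Qed.

Lemma flow_or C A B : Uhat C -> flow A B -> flow (pmerge FOr A C) (pmerge FOr B C).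
Proof.
move=> uC [t [H [uH h1 h2 h3]]].
exists t, (pmerge FOr H (psubst (shift 1) C)); split.
- by apply: Uhat_or => //; apply: Uhat_psubst.
- apply: le_trans _ (proj2 (le_psubst_or _ _ _ _)); apply: le_or => //.
  apply: le_trans (proj2 (le_psubst_id (s := Var) _ _)) _ => //.
  by apply: (proj2 (le_psubst_comp _ _)) => M hM r _; rewrite sb_scons0.
- apply: le_trans _ (proj2 (le_psubst_or _ _ _ _)); apply: le_or => //.
  by apply: (proj2 (le_psubst_comp _ _)) => M hM r _; rewrite sb_stepv.
- apply: le_trans _ (proj2 (le_psubst_or _ _ _ _)); apply: le_or => //.
  exact: le_refl.
Qed.

Lemma flow_orr C A B : Uhat C -> flow A B -> flow (pmerge FOr C A) (pmerge FOr C B).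
Proof.
move=> uC h; apply: flow_lel (le_orC _ _ _) _.
by apply: flow_ler _ (le_orC _ _ _); apply: flow_or.
Qed.

(** Both flows run in parallel for [t1 + t2] steps, a bound on both lengths. Overshooting is
    harmless, since the steps are unconditional and the end condition holds from the length on. *)
Lemma flow_with X A B : flow X A -> flow X B -> flow X (pwith A B).
Proof.
move=> [t1 [H1 [u1 a1 b1 c1]]] [t2 [H2 [u2 a2 b2 c2]]].
exists (TAdd t1 t2), (pwith H1 H2); split.
- exact: Uhat_with.
- exact: le_with.
- apply: le_with; first exact: le_trans (le_withl0 _ _ _) b1.
  exact: le_trans (le_withr0 _ _ _) b2.
- apply: le_with.
    apply: le_trans (le_withl0 _ _ _) (le_weak c1 _) => M hM r /= h.
    exact: sle_trans (sle_addr hM _ _) h.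
  apply: le_trans (le_withr0 _ _ _) (le_weak c2 _) => M hM r /= h.
  exact: sle_trans (sle_addl hM _ _) h.
Qed.

Lemma flow_psubst s A B : flow A B -> flow (psubst s A) (psubst s B).
Proof.
move=> [t [H [uH h1 h2 h3]]].
have eu M (r : nat -> M) : sb (up s) r = econs (r 0) (sb s (tl 1 r)).
  by rewrite -{1}(econs_tl1 r) sb_up.
exists (tsubst s t), (psubst (up s) H); split.
- exact: Uhat_psubst.
- apply: le_trans (le_psubst h1 _) _ => //.
  by apply: le_psubst_comp2 => M hM r _; rewrite !sb_scons0 eu.
- apply: le_trans (le_psubst (t := up s) h2 _) _ => //.
  by apply: le_psubst_comp2 => M hM r _; rewrite !sb_stepv !eu.
- apply: le_trans (le_psubst (t := up s) h3 _) _ => [M hM r|].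
    by rewrite eu ev_subst.
  by apply: le_psubst_comp2 => M hM r _; rewrite eu.
Qed.

(* Divide the step number [u] by [S + 1], where [S] bounds the lengths of the
   flows from [I(y)] to [I(y+1)] for [y <= t]. *)
Lemma flow_ind A t : Uhat A -> flow A (psubst stepv A) ->
  flow (psubst (scons TZero Var) A) (psubst (scons t Var) A).
Proof.
move=> uA [l [H [uH h1 h2 h3]]].
(* The length [l] may depend on [y]; its majorant at [t] serves every [y <= t]. *)
pose S := tsubst (scons t Var) (maj l).
(* [TDiv] divides by the successor of its second argument, so the argument is [S], and the remainder
   [x] runs from 0 to [S]. *)
pose y := TDiv (Var 0) (tshift 1 S).
pose d := TAdd (tshift 1 S) TOne.
pose x := TSub (Var 0) (TMul d y).
pose t1 := tshift 1 t.
pose sH := scons x (scons y (shift 1)).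
pose sA := scons t1 (shift 1).
pose c := FLt y t1.
exists (TMul t (TAdd S TOne)), (pif c (psubst sH H) (psubst sA A)).
have eH M (r : nat -> M) :
  sb sH r = econs (ev r x) (econs (ev r y) (tl 1 r)).
  by rewrite !sb_scons.
have eA M (r : nat -> M) : sb sA r = econs (ev (tl 1 r) t) (tl 1 r).
  by rewrite sb_scons /t1 ev_tshift.
have hl M (hM : model M R) (a : M) (r : nat -> M) : sle a (ev r t) ->
    sle (ev (econs a r) l) (ev r S).
  move=> h; rewrite /S ev_subst sb_scons0; apply: ev_maj => // -[|i] //=.
  exact: slexx.
have hc M (r : nat -> M) : sat r c <-> slt (ev r y) (ev (tl 1 r) t).
  by rewrite /c /t1 -(ev_tshift 1 t r); exact: iff_refl.
have hx M (hM : model M R) (r : nat -> M) : sle (ev r x) (ev (tl 1 r) S).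
  apply/(sltS_le hM); have := sdiv_lt hM (r 0) (ev (tl 1 r) S).
  by rewrite /= ev_tshift.
have hu M (hM : model M R) (r : nat -> M) :
    r 0 = sadd (smul (sadd (ev (tl 1 r) S) s1) (ev r y)) (ev r x).
  have := sdiv_mod hM (r 0) (ev (tl 1 r) S).
  by rewrite /= ev_tshift.
have huniq M (hM : model M R) (r : nat -> M) q b : sle b (ev (tl 1 r) S) ->
    r 0 = sadd (smul (sadd (ev (tl 1 r) S) s1) q) b ->
    ev r y = q /\ ev r x = b.
  move=> hb e; have ey : ev r y = q.
    by rewrite /= ev_tshift e; apply: sdiv_uniq.
  split=> //; have := hu M hM r; rewrite ey e !(saddC hM (smul _ _)).
  by move/(sadd_inj hM).

(* Adding 1 to the step number either increments the remainder or, when the remainder is [S],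
   carries into the quotient. *)
have hn1 M (hM : model M R) (r : nat -> M) : slt (ev r x) (ev (tl 1 r) S) ->
    ev (sb stepv r) y = ev r y /\ ev (sb stepv r) x = sadd (ev r x) s1.
  move=> /(slt_succP hM) h; apply: huniq => //.
  by rewrite sb_stepv /= -saddA // -(hu M hM r).
have hn2 M (hM : model M R) (r : nat -> M) : ~ slt (ev r x) (ev (tl 1 r) S) ->
    [/\ ev r x = ev (tl 1 r) S, ev (sb stepv r) y = sadd (ev r y) s1
      & ev (sb stepv r) x = s0].
  move=> /(sleNgt hM) h; have e := sle_anti hM (hx M hM r) h.
  have [-> ->] // : ev (sb stepv r) y = sadd (ev r y) s1 /\ ev (sb stepv r) x = s0.
  apply: huniq => //; first exact: sle0.
  rewrite sadd0 // smulDr // smul1 // (_ : tl 1 (sb stepv r) = tl 1 r) //.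
  by rewrite -saddA // -[X in sadd (sadd _ X) _]e -(hu M hM r).
split.
- by apply: Uhat_pif => //; apply: Uhat_psubst.
- have hz M (hM : model M R) (r : nat -> M) : r 0 = s0 -> ev r y = s0 /\ ev r x = s0.
    move=> e; apply: huniq => //; first exact: sle0.
    by rewrite e smul0 // sadd0.
  (* For [t = 0] the flow is in its final phase from the start, and [A(t)] is [A(0)]. *)
  apply: (le_case (c := FLt TZero t)) => //.
    apply: (le_trans (B := psubst (scons TZero Var) (psubst sH H))); last first.
      apply: (proj2 (psubst_pif_true _ _ _)) => M hM r [_ h]; rewrite sb_scons0.
      by apply/hc; case: (hz M hM (econs s0 r)) => // -> _.
    apply: le_trans (le_psubst h1 _) _ => //.
    apply: le_psubst_comp2 => M hM r _; rewrite !sb_scons0 eH.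
    by case: (hz M hM (econs s0 r)) => // -> ->.
  apply: (le_trans (B := psubst (scons TZero Var) (psubst sA A))); last first.
    apply: (proj2 (psubst_pif_false _ _ _)) => M hM r [_ h]; rewrite sb_scons0.
    move/hc; case: (hz M hM (econs s0 r)) => // -> _ h'; exact: h.
  apply: (proj2 (le_psubst_comp _ _)) => M hM r [_ h].
  rewrite !sb_scons0 eA; congr econs.
  apply: (sle0_eq hM); apply/(sleNgt hM) => h'; exact: h.
- apply: (le_case (c := c)) => //; last first.
    apply: (le_trans (proj1 (pif_false _ _ _))) => [M hM r [] //|].
    apply: (le_trans (B := psubst stepv (psubst sA A))).
      by apply: (proj2 (le_psubst_comp _ _)) => M hM r _; rewrite !eA sb_stepv.
    apply: (proj2 (psubst_pif_false _ _ _)) => M hM r [_ h] /hc h'; apply: h.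
    apply/hc; apply: sle_lt_trans h' => //.
    case: (classic (slt (ev r x) (ev (tl 1 r) S))) => [/(hn1 M hM) | /(hn2 M hM)].
      by case=> -> _; apply: slexx.
    by case=> _ -> _; apply: sle_addr.
  apply: (le_trans (proj1 (pif_true _ _ _))) => [M hM r [] //|].
  apply: (le_case (c := FLt x (tshift 1 S))) => //.
    have hs M (r : nat -> M) : sat r (FLt x (tshift 1 S)) ->
        slt (ev r x) (ev (tl 1 r) S) by rewrite /= ev_tshift.
    apply: le_trans (le_psubst (t := sH) h2 _) _ => //.
    apply: (le_trans (B := psubst stepv (psubst sH H))).
      apply: le_psubst_comp2 => M hM r [_ /hs /(hn1 M hM) [e1 e2]].
      by rewrite !eH e1 e2 !sb_stepv.
    apply: (proj2 (psubst_pif_true _ _ _)) => M hM r [[_ /hc h1'] /hs h2'].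
    by apply/hc; case: (hn1 M hM r h2') => -> _; rewrite sb_stepv.
  have hs M (r : nat -> M) : ~ sat r (FLt x (tshift 1 S)) ->
      ~ slt (ev r x) (ev (tl 1 r) S) by rewrite /= ev_tshift.
  pose sy := scons (TAdd y TOne) (shift 1).
  have esy M (r : nat -> M) :
      sb sy r = econs (sadd (ev r y) s1) (tl 1 r) by rewrite sb_scons.
  (* At [x = S] the length [l] has been reached, so [H] reduces to [A(y + 1)]. From there either the
     next inner flow begins or, when [y + 1 = t], the final phase. *)
  apply: le_trans (le_psubst (t := sH) h3 _) _.
    move=> M hM r [[_ /hc [h1' _]] /hs /(hn2 M hM) [ex _ _]].
    rewrite (_ : sb sH r 0 = ev r x) // ex eH tl1_econs; exact: hl.
  apply: (le_trans (B := psubst sy A)).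
    apply: le_eq => [|M hM r _]; rewrite ?shp_psubst // !gm_psubst.
    by rewrite eH sb_shift_tl tl1_econs sb_stepv esy.
  have hc3 M (r : nat -> M) : sat r (FLt (TAdd y TOne) t1) <->
      slt (sadd (ev r y) s1) (ev (tl 1 r) t).
    by rewrite /t1 -(ev_tshift 1 t r); exact: iff_refl.
  apply: (le_case (c := FLt (TAdd y TOne) t1)) => //.
    apply: le_trans (le_psubst (t := sy) h1 _) _ => //.
    apply: (le_trans (B := psubst stepv (psubst sH H))).
      apply: le_psubst_comp2 => M hM r [[_ /hs /(hn2 M hM) [_ e1 e2]] _].
      by rewrite eH e1 e2 sb_scons0 esy sb_stepv.
    apply: (proj2 (psubst_pif_true _ _ _)) => M hM r.
    move=> [[_ /hs /(hn2 M hM) [_ e1 e2]] /hc3 h4].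
    by apply/hc; rewrite e1 sb_stepv.
  apply: (le_trans (B := psubst stepv (psubst sA A))).
    apply: (proj2 (le_psubst_comp _ _)) => M hM r [[[_ /hc h4] _] h5].
    rewrite eA esy sb_stepv tl1_econs; congr econs.
    apply: (sle_anti hM); last exact/(slt_succP hM).
    by apply/(sleNgt hM) => h6; apply: h5; apply/hc3.
  apply: (proj2 (psubst_pif_false _ _ _)) => M hM r.
  move=> [[_ /hs /(hn2 M hM) [_ e1 e2]] h5] /hc; rewrite e1 sb_stepv => h6.
  by apply: h5; apply/hc3.
- have hf M (hM : model M R) (r : nat -> M) :
      sle (ev (tl 1 r) (TMul t (TAdd S TOne))) (r 0) -> ~ sat r c.
    move=> h /hc /(slt_succP hM) h'; move: h; apply: (proj1 (sltNge hM _ _)).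
    apply: (slt_le_trans hM) (sle_mul2r hM _ h').
    rewrite smulC // {1}(hu M hM r) smulDr // smul1 //.
    rewrite !(saddC hM (smul _ _)); apply: slt_add2r => //.
    by apply/(sltS_le hM); apply: hx.
  apply: (le_trans (proj1 (pif_false _ _ _))) => [//|].
  by apply: (proj2 (le_psubst_comp _ _)) => M hM r _; rewrite eA sb_scons0.
Qed.

End Flow.

(** * Flows under bounded quantifiers and negation *)

Lemma sb_insts_vars (M : struct) n s (r : nat -> M) :
  sb (insts (vars n) s) r = ext n (hd n r) (sb s r).
Proof. by rewrite sb_insts evs_vars size_mkseq. Qed.

(* From the variables [u, ys, xs] to [ys, u, xs], where [ys] has length [n]. *)
Definition swap_step (n : nat) : nat -> term :=
  scons (Var n) (insts (vars n) (shift n.+1)).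

Lemma sb_swap_step (M : struct) n (r : nat -> M) :
  sb (swap_step n) r = econs (r n) (ext n (hd n r) (tl n.+1 r)).
Proof. by rewrite sb_scons sb_insts_vars. Qed.

Lemma swap_step_at (M : struct) n (r q : nat -> M) x :
  hd n q = hd n r -> tl n q = econs x (tl n r) ->
  sb (swap_step n) q = econs x r.
Proof.
move=> e1 e2; rewrite sb_swap_step e1 -{2}(ext_hd n r).
have -> : q n = x by have := f_equal (fun f => f 0) e2; rewrite /= addn0.
congr econs; congr ext; rewrite -[n.+1]addn1 -tl_add e2; exact: tl1_econs.
Qed.

Lemma evs_tshift (M : struct) n f (r : nat -> M) :
  evs r (map (tshift n) f) = evs (tl n r) f.
Proof. by rewrite evs_subst. Qed.

Section FlowAll.
Variable k : nat.
Implicit Types (A B : prenex k.+1).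

(** The whole flow is put under the quantifier. Its length may depend on the quantified variables,
    so it is replaced by a majorant in the bounds. The step must stay outside while [pall] binds the
    first variables, whence the permutation [swap_step]. *)
Lemma flow_pall ps A B : flow A B -> flow (pall ps A) (pall ps B).
Proof.
move=> [t [H [uH h1 h2 h3]]]; set n := size ps.
pose ps1 := map (tshift 1) ps.
have sps1 : size ps1 = n by rewrite size_map.
exists (tsubst (insts ps Var) (maj t)), (pall ps1 (psubst (swap_step n) H)).
have elim k' (X : prenex k'.+1) G (qs : seq term) : size qs = n ->
    (forall M, model M R -> forall r : nat -> M, G M r ->
       vle (hd n r) (evs (tl n r) qs)) ->
    le G (psubst (shift n) (pall qs X)) X.
  move=> hqs h; apply: le_trans (le_pall_elim (ts := vars n) _ _ _) _.
  - by rewrite size_mkseq.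
  - by move=> M hM r hG; rewrite evs_vars; apply: h.
  by apply: (proj1 (le_psubst_id _ _)) => M hM r _; rewrite sb_insts_vars ext_hd.
split.
- by apply: Uhat_pall; apply: Uhat_psubst.
- apply: le_pall_intro; rewrite sps1; set G' : ctx := fun M r => _.
  apply: (le_trans (B := A)).
    by apply: elim => // M hM r [_]; rewrite evs_tshift sb_scons0 tl1_econs.
  apply: le_trans (le_top _ h1) _.
  apply: (proj2 (le_psubst_comp _ _)) => M hM r _.
  by rewrite sb_scons0; apply: swap_step_at; rewrite ?hd_upn // tl_upn sb_scons0.
- apply: le_pall_intro; rewrite sps1; set G' : ctx := fun M r => _.
  apply: (le_trans (B := psubst (swap_step n) H)).
    by apply: elim => // M hM r [_]; rewrite !evs_tshift sb_stepv tl1_econs.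
  apply: le_trans (le_psubst h2 _) _ => //.
  apply: le_psubst_comp2 => M hM r _; rewrite sb_stepv.
  rewrite (@swap_step_at _ _ (ext n (hd n r) (tl n.+1 r))
     (sb (upn n stepv) r) (sadd (r n) s1)).
  + by rewrite sb_swap_step.
  + by rewrite hd_upn hd_ext // size_hd.
  + by rewrite tl_upn sb_stepv tl_ext /= addn0 -[n.+1]addn1 -tl_add.
- apply: le_pall_intro; rewrite -/n; set G' : ctx := fun M r => _.
  apply: (le_trans (B := psubst (swap_step n) H)).
    by apply: elim => // M hM r [_]; rewrite !evs_tshift.
  apply: (le_trans (B := psubst (swap_step n) (psubst (shift 1) B))).
    apply: (le_psubst h3) => M hM r [h4 h5].
    rewrite sb_swap_step tl1_econs /=.
    move: h4; rewrite /= addn0; apply: (sle_trans hM).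
    rewrite ev_subst sb_insts -/n; apply: ev_maj => // j.
    rewrite /ext; case: ltnP => hj; last first.
      rewrite /sb /= addnA addn1; exact: slexx.
    have := h5 j; rewrite size_map => /(_ hj); rewrite sb_shift_tl.
    by congr sle.
  apply: (proj1 (le_psubst_comp _ _)) => M hM r _.
  rewrite sb_swap_step sb_shift_tl tl1_econs -[in RHS](ext_hd n r) sb_upn.
  by rewrite sb_shift_tl tl_add addn1.
Qed.

(** The rule introducing a universal block on the right: [X] supplies itself and the bounds for all
    [ys], the flow is carried out under the quantifier, and [le_pall_or] takes [Z] out again. *)
Lemma flow_all (ps : seq term) (C : prenex k) (X Z : prenex k.+1) :
  let n := size ps in
  flow (pwith (psubst (shift n) X)
          (pconst (FLes (vars n) (map (tshift n) ps)) k.+1))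
       (@pmerge FOr k.+1 ([::], C) (psubst (shift n) Z)) ->
  flow X (@pmerge FOr k.+1 (ps, C) Z).
Proof.
move=> n /(flow_pall ps) h; apply: flow_lel _ (flow_ler h _).
  apply: le_pall_intro0; rewrite -/n; apply: le_with0; first exact: le_refl.
  apply: le_win => M hM r [_ h']; right.
  apply: (@leaves_pconst_true _ _ k.+1); apply/sat_FLes.
    by rewrite size_map size_mkseq.
  by rewrite evs_vars evs_tshift.
apply: le_trans (le_pall_or _ _ _ _) _; apply: le_or (le_refl _ _).
have e M (r : nat -> M) :
    gm (pguard FImp (FLes (vars 0) [::]) C) r = gm C r.
  rewrite gm_guard_imp lmap_id // => P; apply: propext; split=> // h'.
  exact: h'.
apply: le_eq => [|M hM r _].
  by rewrite /= shp_pguard.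
by apply: sg_ext => v /=; rewrite ?e.
Qed.

End FlowAll.

(** Negating the matrix suffices: the Pi reading of the result is the negation of the Sigma reading
    of [A], and conversely. *)
Fixpoint pneg (k : nat) : prenex k -> prenex k :=
  match k return prenex k -> prenex k with
  | 0 => FNot
  | k'.+1 => fun A => (A.1, pneg A.2)
  end.

Lemma shp_pneg k (A : prenex k) : shp (pneg A) = shp A.
Proof. by elim: k A => //= k IH A; rewrite IH. Qed.

Lemma gm_pneg k (A : prenex k) M (r : nat -> M) :
  gm (pneg A) r = lmap not (gm A r).
Proof.
elim: k A r => [|k IH] A r //; apply: sg_ext => v //=; exact: IH.
Qed.

Lemma psubst_pneg k (A : prenex k) s : psubst s (pneg A) = pneg (psubst s A).
Proof. by elim: k A s => //= k IH A s; rewrite IH. Qed.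

Lemma matrix_pneg k (A : prenex k) : matrix (pneg A) = FNot (matrix A).
Proof. by elim: k A => //= k IH A. Qed.

Lemma Uhat_pneg k (A : prenex k) : Uhat A -> Uhat (pneg A).
Proof. by rewrite !UhatE matrix_pneg /= => ->. Qed.

Section FlowNeg.
Variable k : nat.
Implicit Types (A B X Y : prenex k).

(** The opponent's outer block is copied; below it, [D_neg] turns the reduction from [Y] to [X] into
    one between the negations. *)
Lemma le_block_neg G (q1 q2 : seq term) X Y : size q1 = size q2 ->
  (forall M, model M R -> forall r : nat -> M, G M r -> evs r q1 = evs r q2) ->
  le (fun M r => G M (tl (size q2) r) /\
        vle (hd (size q2) r) (evs (tl (size q2) r) q2)) Y X ->
  le G ((q1, pneg X) : prenex k.+1) ((q2, pneg Y) : prenex k.+1).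
Proof.
move=> hs he h; rewrite /le /= !eqxx; set n := size q2.
exists (vars n); split; first by rewrite size_mkseq hs.
  by move=> M hM r [hG h1]; rewrite /= evs_vars he.
apply: (D_shp (nX := shp Y) (nY := shp X)).
- by move=> i hi; rewrite ltn_eqF // shp_pneg.
- by move=> i hi; rewrite ltn_eqF // shp_pneg.
apply: D_ext (D_neg h) _ => M hM r [hG h1]; split=> //.
  by rewrite /nopp /= gm_pneg ext_hd.
by rewrite /nown /= gm_pneg evs_vars hs ext_hd.
Qed.

(* Negation turns the flow around: the step [u] of the new flow is the
   negation of the step [t' - u] of the given one. *)
Lemma flow_neg (qs : seq term) A B : flow A B ->
  flow ((qs, pneg B) : prenex k.+1) ((qs, pneg A) : prenex k.+1).
Proof.
move=> [t [H [uH h1 h2 h3]]]; set n := size qs.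
(* The original length may depend on the variables of the block, whereas the new one may not. *)
pose t' := tsubst (insts qs Var) (maj t).
pose qs1 := map (tshift 1) qs.
have sqs1 : size qs1 = n by rewrite size_map.
pose s := scons (TSub (tshift n.+1 t') (Var n)) (insts (vars n) (shift n.+1)).
have es M (r : nat -> M) : sb s r =
    econs (ssub (ev (tl n.+1 r) t') (r n)) (ext n (hd n r) (tl n.+1 r)).
  by rewrite sb_scons sb_insts_vars /= ev_tshift.
have es_at M (r q : nat -> M) x : hd n q = hd n r ->
    tl n q = econs x (tl n r) ->
    sb s q = econs (ssub (ev (tl n r) t') x) r.
  move=> e1 e2; rewrite es e1 -{3}(ext_hd n r).
  have -> : q n = x by have := f_equal (fun f => f 0) e2; rewrite /= addn0.
  have -> : tl n.+1 q = tl n r.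
    by rewrite -[n.+1]addn1 -tl_add e2; apply: tl1_econs.
  by [].
have ht M (hM : model M R) (r : nat -> M) : vle (hd n r) (evs (tl n r) qs) ->
    sle (ev r t) (ev (tl n r) t').
  move=> h; rewrite /t' ev_subst sb_insts -/n; apply: ev_maj => // j.
  rewrite /ext; case: ltnP => hj; last by rewrite /sb /= subnKC //; apply: slexx.
  by have := h j; rewrite size_map nth_mkseq // => /(_ hj).
exists t', ((qs1, pneg (psubst s H)) : prenex k.+1); split.
- by apply: Uhat_pneg; apply: Uhat_psubst.
- rewrite /= psubst_pneg sqs1; apply: le_block_neg; rewrite ?size_map //.
    by move=> M hM r _; rewrite evs_subst evs_tshift sb_scons0 tl1_econs.
  set G' : ctx := fun M r => _.
  have eq M (r : nat -> M) : sb s (sb (upn n (scons TZero Var)) r) =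
      econs (ssub (ev (tl n r) t') s0) r.
    by apply: es_at; rewrite ?hd_upn // tl_upn sb_scons0.
  pose s1' := scons (TSub (tshift n t') TZero) Var.
  have es1 M (r : nat -> M) : sb s1' r =
      econs (ssub (ev (tl n r) t') s0) r by rewrite sb_scons0 /= ev_tshift.
  apply: (le_trans (B := psubst s1' H)).
    by apply: (proj1 (le_psubst_comp _ _)) => M hM r _; rewrite es1 eq.
  apply: le_trans (le_psubst h3 _) _ => [M hM r [_ h]|].
    rewrite es1 tl1_econs /= ssub0 //; apply: ht => //.
    by move: h; rewrite evs_subst evs_tshift sb_scons0 tl1_econs.
  apply: le_trans (proj1 (le_psubst_comp (u := Var) _ _)) _.
    by move=> M hM r _; rewrite es1 sb_shift_tl tl1_econs sb_id.
  exact: (proj1 (le_psubst_id _ _)).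
- rewrite /= psubst_pneg sqs1; apply: le_block_neg; rewrite ?size_map //.
    by move=> M hM r _; rewrite evs_subst !evs_tshift sb_stepv tl1_econs.
  set G' : ctx := fun M r => _.
  have eq M (r : nat -> M) : sb s (sb (upn n stepv) r) =
      econs (ssub (ev (tl n.+1 r) t') (sadd (r n) s1))
            (ext n (hd n r) (tl n.+1 r)).
    rewrite (@es_at _ (ext n (hd n r) (tl n.+1 r)) _ (sadd (r n) s1)).
    + by rewrite tl_ext.
    + by rewrite hd_upn hd_ext // size_hd.
    + by rewrite tl_upn sb_stepv tl_ext /= addn0 -[n.+1]addn1 -tl_add.
  pose c := FLt (Var n) (tshift n.+1 t').
  have hc M (r : nat -> M) : sat r c <-> slt (r n) (ev (tl n.+1 r) t').
    by rewrite -(ev_tshift n.+1 t' r); exact: iff_refl.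
  (* Beyond [t'] truncated subtraction stays at 0, so nothing changes in a step. *)
  apply: (le_case (c := c)) => //; last first.
    apply: (proj1 (le_psubst_comp _ _)) => M hM r [_ h].
    have h' : sle (ev (tl n.+1 r) t') (r n).
      by apply/(sleNgt hM) => h'; apply: h; apply/hc.
    rewrite eq es !ssub_le0 //.
    exact: sle_trans h' (sle_addr hM _ _).
  pose s2 := scons (TSub (tshift n.+1 t') (TAdd (Var n) TOne))
                   (insts (vars n) (shift n.+1)).
  have es2 M (r : nat -> M) : sb s2 r =
      econs (ssub (ev (tl n.+1 r) t') (sadd (r n) s1))
            (ext n (hd n r) (tl n.+1 r)).
    by rewrite sb_scons sb_insts_vars /= ev_tshift.
  apply: (le_trans (B := psubst s2 H)).
    by apply: (proj1 (le_psubst_comp _ _)) => M hM r _; rewrite eq es2.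
  apply: le_trans (le_psubst (t := s2) h2 _) _ => //.
  apply: (proj1 (le_psubst_comp _ _)) => M hM r [_ /hc h].
  rewrite es2 sb_stepv es; congr econs; rewrite [econs _ _ 0]/=.
  have h' := h; move/(slt_succP hM): h' => h'.
  apply: (@sadd_inj _ hM (r n)); rewrite saddA // (saddC hM s1).
  by rewrite !ssubK //; case: h.
- rewrite /= psubst_pneg; apply: le_block_neg; rewrite ?size_map //.
  set G' : ctx := fun M r => _.
  apply: le_trans (le_psubst (t := upn n (shift 1)) h1 _) _ => //.
  apply: (proj1 (le_psubst_comp _ _)) => M hM r [h _].
  rewrite sb_scons0 es ssub_le0 //; last first.
    by move: h; rewrite -/n tl_add addn1 /= addn0.
  congr econs; rewrite -{1}(ext_hd n r) sb_upn sb_shift_tl tl_add addn1.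
  by [].
Qed.

End FlowNeg.

(** * Truth of prenex formulas *)

Section Truth.
Variable M : struct.
Implicit Types r : nat -> M.

Fixpoint tv (s : bool) k : sg M k -> Prop :=
  match k return sg M k -> Prop with
  | 0 => fun P => P
  | k'.+1 => fun X =>
      if s then forall v, X.1 v -> tv (~~ s) (X.2 v)
      else exists v, X.1 v /\ tv (~~ s) (X.2 v)
  end.

Lemma econs_ext x n v r : econs x (ext n v r) = ext n.+1 (x :: v) r.
Proof. by funext i; case: i. Qed.

Lemma ext_behead n (v : seq M) r :
  ext n.+1 (nth s0 v 0 :: behead v) r = ext n.+1 v r.
Proof.
by funext i; rewrite /ext; case: ltnP => // _; case: i => [|i] //=;
  rewrite ?nth_behead.
Qed.

Lemma vle_cons x (v : seq M) y w :
  vle (x :: v) (y :: w) <-> sle x y /\ vle v w.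
Proof.
split=> [h | [h1 h2] [|i] //= hi]; last exact: h2.
by split; [apply: (h 0) | move=> i hi; apply: (h i.+1)].
Qed.

Lemma vle_behead (v w : seq M) :
  vle (nth s0 v 0 :: behead v) w <-> vle v w.
Proof.
by split=> h [|i] hi; have := h _ hi; rewrite //= ?nth_behead.
Qed.

Lemma sat_bquants_all ps A r :
  sat r (bquants Univ ps A) <->
  (forall v, vle v (evs r ps) -> sat (ext (size ps) v r) A).
Proof.
elim: ps A => [|p ps IH] A /=.
  by split=> [h v _ | h]; [|have := h [::]]; rewrite ext0 //; apply.
rewrite IH; split=> h v.
  move=> /vle_behead /vle_cons [h1 h2]; rewrite -ext_behead -econs_ext; apply: h => //=.
  by rewrite !ev_tshift tl1_econs tl_ext.
move=> hv x /=; rewrite !ev_tshift tl1_econs tl_ext econs_ext => hx.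
by apply: h; apply/vle_cons.
Qed.

Lemma sat_bquants_ex ps A r :
  sat r (bquants Exis ps A) <->
  (exists v, vle v (evs r ps) /\ sat (ext (size ps) v r) A).
Proof.
elim: ps A => [|p ps IH] A /=.
  split=> [h | [v [_]]]; last by rewrite ext0.
  by exists [::]; rewrite ext0; split.
rewrite IH; split=> [[v [hv [x /=]]] | [v]].
  rewrite !ev_tshift tl1_econs tl_ext econs_ext => -[hx h].
  by exists (x :: v); split=> //; apply/vle_cons.
rewrite -ext_behead -econs_ext => -[/vle_behead /vle_cons [h1 h2] h3]; exists (behead v); split=> //; exists (nth s0 v 0) => /=.
by rewrite !ev_tshift tl1_econs tl_ext.
Qed.

Definition pol (Q : quant) : bool := if Q is Univ then true else false.

Lemma sat_pform Q k (A : prenex k) r : sat r (pform Q A) <-> tv (pol Q) (gm A r).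
Proof.
elim: k Q A r => [|k IH] Q A r //=; case: Q => /=.
  by rewrite sat_bquants_all; split=> h v hv; apply/(IH Exis); apply: h.
by rewrite sat_bquants_ex; split=> -[v [hv /(IH Univ) h]]; exists v.
Qed.

Lemma tv_neg s k (X : sg M k) : tv s (lmap not X) <-> ~ tv (~~ s) X.
Proof.
elim: k s X => [|k IH] s X //=; case: s => /=.
  split=> [h [v [hv]] | h v hv]; first exact: (proj1 (IH _ _) (h v hv)).
  by apply/IH => h'; apply: h; exists v.
split=> [[v [hv /IH h]] h' | h]; first by apply: h; apply: h'.
apply: NNPP => h'; apply: h => v hv; apply: NNPP => h; apply: h'; exists v.
by split=> //; apply/IH.
Qed.

(** For an existential block and a false guard some legal move must still exist; the zero move
    provides it. *)
Lemma tv_imp (b : Prop) s k (X : sg M k) : szok X ->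
  tv s (lmap (fun P => b -> P) X) <-> (b -> tv s X).
Proof.
elim: k s X => [|k IH] s X //= [h1 h2]; case: s.
  split=> [h hb v hv | h v hv]; first by apply: (proj1 (IH _ _ (h2 _)) (h v hv)).
  by apply/IH => // hb; apply: h.
split=> [[v [hv /(IH _ _ (h2 _)) h]] hb | h]; first by exists v; auto.
case: (classic b) => hb; last by exists (nseq 0 s0); split=> //; apply/IH.
by case: (h hb) => v [hv h']; exists v; split=> //; apply/IH.
Qed.

(** A concatenated move is split by length, so its first part has to be brought to the exact length
    first. *)
Definition trim n (v : seq M) := mkseq (nth s0 v) n.

Lemma vle_trim n (v w : seq M) : size w = n -> vle (trim n v) w <-> vle v w.
Proof.
by move=> hn; split=> h i hi; have := h i hi; rewrite nth_mkseq // -hn.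
Qed.

Lemma ext_trim n v r : ext n (trim n v) r = ext n v r.
Proof. by funext i; rewrite /ext; case: ltnP => h //; rewrite nth_mkseq. Qed.

(** In a universal block, counterexamples to both disjuncts are combined into one move. In an
    existential block, the witness for one disjunct is completed by zeros. *)
Lemma tv_mg_or s k (A B : prenex k) n r r' : model M R ->
  (forall i, i < k -> n i = shp A i) ->
  tv s (mg or n (gm A r) (gm B r')) <-> tv s (gm A r) \/ tv s (gm B r').
Proof.
move=> hM; elim: k s A B n r r' => [|k IH] s A B n r r' hn //=.
have hk : n k = size A.1 by rewrite hn //= eqxx.
have hn' i : i < k -> n i = shp A.2 i.
  by move=> hi; rewrite hn 1?ltnW //= ltn_eqF.
have zok (ps : seq term) r0 : vle (nseq 0 s0) (evs r0 ps).
  by move=> i _; rewrite /= nth_nil; apply: sle0.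
have cat_ok v1 v2 : vle v1 (evs r A.1) -> vle v2 (evs r' B.1) ->
    let v := trim (n k) v1 ++ v2 in
    [/\ vle (take (n k) v) (evs r A.1), vle (drop (n k) v) (evs r' B.1),
        ext (size A.1) (take (n k) v) r = ext (size A.1) v1 r
      & drop (n k) v = v2].
  move=> h1 h2 v; rewrite /v take_size_cat ?drop_size_cat ?size_mkseq //.
  split=> //; first by apply/vle_trim; rewrite ?size_map.
  by rewrite hk ext_trim.
case: s.
  split=> [h | h v [h1 h2]]; last first.
    by apply/IH => //; case: h => h; [left | right]; apply: h.
  apply: NNPP => /not_or_and [h1 h2].
  have [v1 g1] := not_all_ex_not _ _ h1; have [o1 c1] := imply_to_and _ _ g1.
  have [v2 g2] := not_all_ex_not _ _ h2; have [o2 c2] := imply_to_and _ _ g2.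
  have [e1 e2 e3 e4] := cat_ok _ _ o1 o2.
  have := h (trim (n k) v1 ++ v2) (conj e1 e2).
  by case/IH => //; rewrite ?e3 ?e4.
split=> [[v [[h1 h2]]] | ].
  by case/IH => // h; [left | right]; eexists; split; eauto.
case=> -[v [o h]].
  have [e1 e2 e3 e4] := cat_ok _ _ o (zok B.1 r').
  exists (trim (n k) v ++ nseq 0 s0); split=> //; apply/IH => //; left.
  by rewrite e3.
have [e1 e2 e3 e4] := cat_ok _ _ (zok A.1 r) o.
exists (trim (n k) (nseq 0 s0) ++ v); split=> //; apply/IH => //; right.
by rewrite e4.
Qed.

Lemma tv_or s k (A B : prenex k) r : model M R ->
  tv s (gm (pmerge FOr A B) r) <-> tv s (gm A r) \/ tv s (gm B r).
Proof. by move=> hM; rewrite gm_pmerge_or; apply: tv_mg_or. Qed.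

Lemma tv_and s k (A B : prenex k) r : model M R ->
  tv s (gm (pmerge FAnd A B) r) <-> tv s (gm A r) /\ tv s (gm B r).
Proof.
(* De Morgan reduces the claim to disjunctions of the dual reading. *)
move=> hM; have -> : gm (pmerge FAnd A B) r =
    lmap not (gm (pmerge FOr (pneg A) (pneg B)) r).
  rewrite gm_pmerge_and gm_pmerge_or !gm_pneg shp_pneg.
  rewrite (mg_lmapl (op' := fun P Q => ~ P \/ Q)) //.
  rewrite (mg_lmapr (op' := fun P Q => ~ P \/ ~ Q)) //.
  rewrite (lmap_mg (op' := and)) // => P Q; apply: propext.
  by split=> [/not_or_and [/NNPP ? /NNPP ?] | ]; tauto.
rewrite tv_neg tv_or // !gm_pneg !tv_neg negbK.
by split=> [/not_or_and [/NNPP ? /NNPP ?] | ]; tauto.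
Qed.

Lemma tv_leaves s k (X : sg M k) b : szok X -> leaves b X -> tv s X <-> b.
Proof.
elim: k s X => [|k IH] s X //= [h1 h2] h; case: s.
  split=> [h' | hb v hv]; last exact/IH.
  by have := h' _ (h1 0); apply: proj1; apply: IH.
split=> [[v [hv]] | hb]; first exact: (proj1 (IH _ _ (h2 v) (h v))).
by exists (nseq 0 s0); split=> //; apply/IH.
Qed.

Lemma tv_pconst s k N r : model M R -> tv s (gm (pconst N k) r) <-> sat r N.
Proof. by move=> hM; apply: tv_leaves; [apply: gm_szok | apply: leaves_pconst]. Qed.

End Truth.

(** * Padding with empty blocks *)

(** An innermost empty block leaves the kinds of all the other blocks unchanged, whereas an
    outermost one exchanges the Pi and the Sigma reading. *)
Fixpoint pend (k : nat) : prenex k -> prenex k.+1 :=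
  match k return prenex k -> prenex k.+1 with
  | 0 => fun N => ([::], N)
  | k'.+1 => fun A => (A.1, pend A.2)
  end.

Lemma tv_pend (M : struct) s k (A : prenex k) (r : nat -> M) :
  tv s (gm (pend A) r) <-> tv s (gm A r).
Proof.
elim: k s A r => [|k IH] s A r.
  case: s => /=; first by split=> [h | h v _]; [have := h [::]|]; rewrite ext0 //; apply.
  by split=> [[v [_]] | h]; [|exists [::]]; rewrite ext0.
have e v := IH (~~ s) A.2 (ext (size A.1) v r); case: s e => e.
  by split=> h v hv; apply/e; apply: (h v).
by split=> -[v [hv h]]; exists v; split=> //; apply/e.
Qed.

Lemma matrix_pend k (A : prenex k) : matrix (pend A) = matrix A.
Proof. by elim: k A => //= k IH A; rewrite IH. Qed.

Lemma Uhat_pend k (A : prenex k) : Uhat A -> Uhat (pend A).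
Proof. by rewrite !UhatE matrix_pend. Qed.

(** * Reductions between blocks and outer padding *)

Lemma D_block s k G (p q f : seq term) (X Y : prenex k) :
  size f = size p ->
  (forall M, model M R -> forall r : nat -> M, G M (tl (size q) r) ->
     vle (hd (size q) r) (evs (tl (size q) r) q) ->
     vle (evs r f) (evs (tl (size q) r) p)) ->
  D (~~ s) (shp Y) (shp X)
    (fun M r => G M (tl (size q) r) /\ vle (hd (size q) r) (evs (tl (size q) r) q))
    (fun M r => gm Y r) (fun M r => gm (psubst (reblock f (size q)) X) r) ->
  D s (@shp k.+1 (p, X)) (@shp k.+1 (q, Y)) G
    (fun M r => @gm M k.+1 (p, X) r) (fun M r => @gm M k.+1 (q, Y) r).
Proof.
move=> hf hok hD; rewrite /= !eqxx; exists f; split=> //.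
  by move=> M hM r [hG h1]; apply: hok.
apply: (D_shp (nX := shp Y) (nY := shp X)).
- by move=> i hi; rewrite ltn_eqF.
- by move=> i hi; rewrite ltn_eqF.
apply: D_ext hD _ => M hM r [hG h1]; split=> //.
  by rewrite /nopp /= ext_hd.
by rewrite /nown /= gm_psubst sb_reblock hf.
Qed.

(* [leS s] is reducibility of [Pi]-formulas for [s = true], and of
   [Sigma]-formulas for [s = false]. *)
Definition leS (s : bool) (G : ctx) k (A B : prenex k) : Prop :=
  if s then le G A B
  else D false (shp B) (shp A) G (fun M r => gm B r) (fun M r => gm A r).

Lemma leS_eq s G k (A B : prenex k) : shp A = shp B ->
  (forall M, model M R -> forall r : nat -> M, G M r -> gm A r = gm B r) ->
  leS s G A B.
Proof.
move=> e h; case: s; first exact: le_eq.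
by rewrite /leS -e; apply: D_eq => M hM r hG; rewrite h.
Qed.

Lemma leS_pad s G k (A B : prenex k) :
  leS (~~ s) G A B -> leS s G (([::], A) : prenex k.+1) (([::], B) : prenex k.+1).
Proof.
case: s => h.
  apply: (D_block (f := [::])) => //.
  apply: (D_ext h) => M hM r [hG _]; split=> //.
  by rewrite gm_psubst sb_reblock ext0.
apply: (D_block (f := [::])) => //.
apply: (D_ext h) => M hM r [hG _]; split=> //.
by rewrite gm_psubst sb_reblock ext0.
Qed.

(** Embeddings by empty outer blocks. They let a subformula at any depth be treated as an element of
    [prenex k]; the flag tells whether it is read as Pi or as Sigma there. *)
Inductive adm (k : nat) : forall j, bool -> (prenex j -> prenex k) -> Prop :=
| adm_id : @adm k k true (fun A => A)
| adm_pad j s (e : prenex j.+1 -> prenex k) :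
    adm s e -> @adm k j (~~ s) (fun A => e ([::], A)).

Section Adm.
Variable k : nat.

Lemma adm_le j s (e : prenex j -> prenex k) G A B : adm s e ->
  leS s G A B -> le G (e A) (e B).
Proof.
move=> he; elim: he A B => {j s e} [//|j s e _ IH] A B h.
by apply: IH; apply: leS_pad.
Qed.

Lemma adm_psubst j s (e : prenex j -> prenex k) t A : adm s e ->
  e (psubst t A) = psubst t (e A).
Proof. by move=> he; elim: he A => {j s e} [//|j s e _ IH] A; rewrite -IH. Qed.

Lemma adm_or j s (e : prenex j -> prenex k) G A B : adm s e ->
  le G (e (pmerge FOr A B)) (pmerge FOr (e A) (e B)).
Proof.
move=> he; elim: he A B => {j s e} [|j s e he IH] A B; first exact: le_refl.
apply: le_trans _ (IH _ _); apply: (adm_le he); apply: leS_eq.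
  by rewrite /= !shp_pmergeE !shp_psubst.
move=> M hM r _; apply: sg_ext => v //=; rewrite !gm_pmerge_or shp_psubst.
by rewrite !gm_psubst !ext0.
Qed.

Lemma adm_const j s (e : prenex j -> prenex k) N : adm s e ->
  e (pconst N j) = pconst N k.
Proof. by move=> he; elim: he => {j s e} [//|j s e _ IH]; rewrite -IH. Qed.

Lemma adm_Uhat j s (e : prenex j -> prenex k) A : adm s e ->
  Uhat A -> Uhat (e A).
Proof.
by move=> he; elim: he A => {j s e} [//|j s e _ IH] A h; apply: IH.
Qed.

End Adm.

(** A semantic bound on the free variables: all that matters about them is that the game depends on
    nothing else. *)
Definition sup k (b : nat) (A : prenex k) : Prop :=
  forall M (r r' : nat -> M), (forall i, i < b -> r i = r' i) ->
    gm A r = gm A r'.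

Lemma sup_weak k b b' (A : prenex k) : b <= b' -> sup b A -> sup b' A.
Proof. by move=> hb h M r r' e; apply: h => i hi; apply: e; apply: leq_trans hb. Qed.

Definition tbs (ts : seq term) : nat := foldr maxn 0 (map tb ts).

Lemma evs_ext M (r r' : nat -> M) ts :
  (forall i, i < tbs ts -> r i = r' i) -> evs r ts = evs r' ts.
Proof.
elim: ts => //= t ts IH h; congr cons.
  by apply: ev_ext => i hi; apply: h; rewrite /tbs /= leq_max hi.
by apply: IH => i hi; apply: h; rewrite /tbs /= leq_max orbC hi.
Qed.

Lemma sup_ex k (A : prenex k) : exists b, sup b A.
Proof.
elim: k A => [|k IH] A; first by exists (fb A) => M r r'; apply: sat_ext.
case: (IH A.2) => b hb; exists (maxn (tbs A.1) b) => M r r' e.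
apply: sg_ext => v /=.
  rewrite (evs_ext (r' := r')) // => i hi; apply: e.
  by rewrite leq_max hi.
apply: hb => i hi; rewrite /ext; case: ltnP => // hi'; apply: e.
apply: leq_ltn_trans (leq_subr _ _) _.
by rewrite leq_max hi orbT.
Qed.

(* From the environment [r], in which the variables [b], ..., [b + n - 1] are
   fresh, to an environment beginning with these variables. *)
Definition unfreshn (b n : nat) : nat -> term :=
  fun i => if b <= i < b + n then Var (i - b) else Var (n + i).

Lemma sb_unfreshn (M : struct) b n (r : nat -> M) i :
  i < b -> sb (unfreshn b n) r i = tl n r i.
Proof. by move=> h; rewrite /sb /unfreshn leqNgt h. Qed.

Definition freshn (b n : nat) : seq term := [seq Var (b + i) | i <- iota 0 n].

Lemma evs_unfreshn (M : struct) b n (r : nat -> M) :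
  evs (sb (unfreshn b n) r) (freshn b n) = hd n r.
Proof.
rewrite /evs /freshn -map_comp; apply/eq_in_map => i; rewrite mem_iota => /= hi.
by rewrite /sb /unfreshn leq_addr ltn_add2l hi /= addKn.
Qed.

Lemma prenex_enum k : exists e : nat -> prenex k, forall A, exists n, e n = A.
Proof.
elim: k => [|k [e he]].
  by exists (fun n => odflt FFalse (unpickle n)) => A; exists (pickle A);
    rewrite pickleK.
exists (fun n => let p : seq term * nat := odflt ([::], 0) (unpickle n) in
  (p.1, e p.2)) => -[ps A]; case: (he A) => n hn.
by exists (pickle (ps, n)); rewrite pickleK /= hn.
Qed.

(** * Saturated pairs of formulas *)

Section Cuts.
Variable k : nat.
Implicit Types (A B C X Z : prenex k).

Definition contraction := forall C, Uhat C -> flow (pmerge FOr C C) C.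
Hypothesis contr : contraction.

Lemma flow_or_elim A B C : Uhat B -> Uhat C -> flow A C -> flow B C ->
  flow (pmerge FOr A B) C.
Proof.
move=> uB uC hA hB; apply: flow_trans (flow_or uB hA) _.
exact: flow_trans (flow_orr uC hB) (contr uC).
Qed.

(** [X] flows to [X & (C \/ Z)], which reduces to [(X & C) \/ Z], which flows to [Z \/ Z];
    contraction finishes. *)
Lemma flow_cut X C Z : Uhat X -> Uhat Z ->
  flow (pwith X C) Z -> flow X (pmerge FOr C Z) -> flow X Z.
Proof.
move=> uX uZ h1 h2.
apply: flow_trans (flow_with (flow_refl uX) h2) _.
apply: flow_lel (le_with_or _ _ _ _) _.
exact: flow_trans (flow_or uZ h1) (contr uZ).
Qed.

(** The side formulas are absorbed into the induction formula [J], which is [(X & A) \/ Z]. [X] is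
    kept by the additive conjunction for use in the following steps, and an outcome [Z] simply
    persists. *)
Lemma flow_induction X Z A t :
  Uhat X -> Uhat Z -> Uhat A ->
  flow (pwith (psubst (shift 1) X) A)
       (pmerge FOr (psubst stepv A) (psubst (shift 1) Z)) ->
  flow (pwith X (psubst (scons TZero Var) A))
       (pmerge FOr (psubst (scons t Var) A) Z).
Proof.
move=> uX uZ uA h; set X1 := psubst (shift 1) X; set Z1 := psubst (shift 1) Z.
have uX1 : Uhat X1 by apply: Uhat_psubst.
have uZ1 : Uhat Z1 by apply: Uhat_psubst.
have uA1 : Uhat (psubst stepv A) by apply: Uhat_psubst.
pose J := pmerge FOr (pwith X1 A) Z1.
have uJ : Uhat J by apply: Uhat_or => //; apply: Uhat_with.
have step : flow J (psubst stepv J).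
  apply: (flow_trans (B := pmerge FOr (pwith X1 (psubst stepv A)) Z1)).
    apply: flow_or_elim => //.
    - by apply: Uhat_or => //; apply: Uhat_with.
    - apply: (flow_trans (B := pwith X1 (pmerge FOr (psubst stepv A) Z1))).
        apply: flow_with => //.
        exact: flow_lel (le_withl0 _ _ _) (flow_refl uX1).
      apply: flow_le (le_with_or _ _ _ _).
      by apply: Uhat_with => //; apply: Uhat_or.
    - exact: flow_ler (flow_refl uZ1) (le_orr _ _ _).
  apply: flow_le; first by apply: Uhat_or => //; apply: Uhat_with.
  apply: le_trans _ (proj2 (le_psubst_or _ _ _ _)); apply: le_or.
    apply: le_with; last exact: le_withr0.
    apply: le_trans (le_withl0 _ _ _) _.
    by apply: (proj2 (le_psubst_comp _ _)) => M hM r _; rewrite sb_stepv.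
  by apply: (proj2 (le_psubst_comp _ _)) => M hM r _; rewrite sb_stepv.
apply: flow_lel _ (flow_ler (flow_ind t uJ step) _).
  apply: le_trans _ (proj2 (le_psubst_or _ _ _ _)).
  apply: le_trans _ (le_orl _ _ _); apply: le_with; last exact: le_withr0.
  apply: le_trans (le_withl0 _ _ _) (proj2 (le_unshift _ _ _)) => M r.
  by rewrite sb_scons0.
apply: le_trans (proj1 (le_psubst_or _ _ _ _)) _; apply: le_or.
  exact: le_withr.
by apply: (proj1 (le_unshift _ _ _)) => M r; rewrite sb_scons0.
Qed.

End Cuts.

Lemma le_sup k G (A : prenex k) b s t : sup b A ->
  (forall M, model M R -> forall r : nat -> M, G M r ->
     forall i, i < b -> sb s r i = sb t r i) ->
  le G (psubst s A) (psubst t A).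
Proof.
move=> hA h; apply: le_eq => [|M hM r hG]; first by rewrite !shp_psubst.
by rewrite !gm_psubst; apply: hA; apply: h.
Qed.

Section Tasks.
Variable k : nat.
Hypothesis contr : contraction k.
Implicit Types (A B C X Z : prenex k).

Definition con (s : prenex k * prenex k) :=
  [/\ Uhat s.1, Uhat s.2 & ~ flow s.1 s.2].

Lemma conI X Z : Uhat X -> Uhat Z -> ~ flow X Z -> con (X, Z).
Proof. by []. Qed.

(** Growth is measured by plain reductions, so flows into and out of earlier stages survive by mere
    composition. *)
Definition grows (s s' : prenex k * prenex k) := le top s'.1 s.1 /\ le top s.2 s'.2.

Lemma grows_refl s : grows s s. Proof. by split; apply: le_refl. Qed.

Lemma grows_trans s1 s2 s3 : grows s1 s2 -> grows s2 s3 -> grows s1 s3.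
Proof.
by move=> [h1 h2] [h3 h4]; split; [apply: le_trans h3 h1 | apply: le_trans h2 h4].
Qed.

Lemma con_decide X Z C : Uhat C -> con (X, Z) ->
  con (pwith X C, Z) \/ con (X, pmerge FOr C Z).
Proof.
move=> uC [/= uX uZ h]; apply: NNPP => /not_or_and [h1 h2]; apply: h.
apply: (flow_cut contr (C := C)) => //; apply: NNPP => h.
  by apply: h1; split=> //; apply: Uhat_with.
by apply: h2; split=> //; apply: Uhat_or.
Qed.

(** If all three extensions had flows, the third one at a fresh variable would be the induction
    step; [flow_induction] and two cuts would then yield a flow from [X] to [Z]. *)
Lemma con_induction X Z A t : Uhat A -> con (X, Z) ->
  [\/ con (X, pmerge FOr (psubst (scons TZero Var) A) Z),
      con (pwith X (psubst (scons t Var) A), Z)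
    | exists r, con (pwith X (psubst (scons r Var) A),
                  pmerge FOr (psubst (scons (TAdd r TOne) Var) A) Z)].
Proof.
move=> uA [/= uX uZ h].
have [bX hX] := sup_ex X; have [bZ hZ] := sup_ex Z; have [bA hA] := sup_ex A.
pose b := maxn bX (maxn bZ bA).
have {}hX : sup b X by apply: sup_weak hX; rewrite leq_max leqnn.
have {}hZ : sup b Z by apply: sup_weak hZ; rewrite !leq_max leqnn orbT.
have {}hA : sup b.+1 A.
  by apply: sup_weak hA; apply: leqW; rewrite !leq_max leqnn !orbT.
apply: NNPP => hn; apply: h.
have f1 : flow X (pmerge FOr (psubst (scons TZero Var) A) Z).
  apply: NNPP => h; apply: hn; constructor 1; split=> //=.
  by apply: Uhat_or => //; apply: Uhat_psubst.
have f2 : flow (pwith X (psubst (scons t Var) A)) Z.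
  apply: NNPP => h; apply: hn; constructor 2; split=> //=.
  by apply: Uhat_with => //; apply: Uhat_psubst.
have f3 : flow (pwith X (psubst (scons (Var b) Var) A))
    (pmerge FOr (psubst (scons (TAdd (Var b) TOne) Var) A) Z).
  apply: NNPP => h; apply: hn; constructor 3; exists (Var b); split=> //=.
    by apply: Uhat_with => //; apply: Uhat_psubst.
  by apply: Uhat_or => //; apply: Uhat_psubst.
apply: (flow_cut contr uX uZ f2).
apply: (flow_cut (C := psubst (scons TZero Var) A) contr uX).
- by apply: Uhat_or => //; apply: Uhat_psubst.
- apply: flow_induction => //.
  have {}f3 := flow_psubst (unfreshn b 1) f3.
  have hb M (r : nat -> M) : sb (unfreshn b 1) r b = r 0.
    by rewrite /sb /unfreshn leqnn addn1 ltnSn /= subnn.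
  apply: flow_lel _ (flow_ler f3 _).
    apply: le_with.
      apply: le_trans (le_withl0 _ _ _) _.
      by apply: (le_sup hX) => M hM r _ i hi; rewrite sb_unfreshn.
    apply: le_trans (le_withr0 _ _ _) _.
    apply: (@le_trans _ _ (psubst Var A)); first exact: (proj2 (le_psubst_id _ _)).
    apply: (@le_trans _ _ (psubst (fun i => tsubst (unfreshn b 1) (scons (Var b) Var i)) A)).
      apply: (le_sup hA) => M hM r _ [|i] hi.
        by rewrite -[RHS]/(sb (unfreshn b 1) r b) hb.
      by rewrite -[RHS]/(sb (unfreshn b 1) r i) sb_unfreshn.
    by apply: (proj2 (le_psubst_comp _ _)) => M hM r _; rewrite sb_comp.
  apply: le_trans (proj1 (le_psubst_or _ _ _ _)) _; apply: le_or.
    apply: (@le_trans _ _ (psubst (fun i => tsubst (unfreshn b 1)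
        (scons (TAdd (Var b) TOne) Var i)) A)).
      by apply: (proj1 (le_psubst_comp _ _)) => M hM r _; rewrite sb_comp.
    apply: (le_sup hA) => M hM r _ [|i] hi.
      by rewrite -[LHS]/(sadd (sb (unfreshn b 1) r b) s1) hb.
    by rewrite -[LHS]/(sb (unfreshn b 1) r i) sb_unfreshn.
  by apply: (le_sup hZ) => M hM r _ i hi; rewrite sb_unfreshn.
by apply: flow_ler f1 (le_or (le_refl _ _) (le_orr _ _ _)).
Qed.

End Tasks.

(** Fresh variables serve as the failing instance: a flow for it would generalize by [flow_all] to a
    flow from [X] to [(ps, C) \/ Z]. *)
Lemma con_witness k (contr : contraction k.+1) (X Z : prenex k.+1) ps C :
  Uhat ((ps, C) : prenex k.+1) -> con (X, Z) ->
  con (pwith X (ps, C), Z) \/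
  exists ts, size ts = size ps /\
    con (pwith X (pconst (FLes ts ps) k.+1),
         @pmerge FOr k.+1 ([::], psubst (insts ts Var) C) Z).
Proof.
move=> uC hcon; have [uX uZ h] : [/\ Uhat X, Uhat Z & ~ flow X Z] := hcon.
case: (con_decide contr uC hcon) => hd; [by left | right].
have [bX hX] := sup_ex X; have [bZ hZ] := sup_ex Z; have [bC hC] := sup_ex C.
pose b := maxn (maxn bX bZ) (maxn bC (tbs ps)); pose n := size ps.
have {}hX : sup b X by apply: sup_weak hX; rewrite !leq_max leqnn.
have {}hZ : sup b Z by apply: sup_weak hZ; rewrite !leq_max leqnn orbT.
have {}hC : sup (n + b) C.
  by apply: sup_weak hC; apply: leq_trans (leq_addl _ _);
    rewrite !leq_max leqnn !orbT.
have hps : tbs ps <= b by rewrite !leq_max leqnn !orbT.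
exists (freshn b n); have sf : size (freshn b n) = n by rewrite size_map size_iota.
apply: conj => //; apply: conI.
- by apply: Uhat_with => //; apply: Uhat_const; apply: qfree_FLes.
- apply: Uhat_or => //; rewrite UhatE /= matrix_psubst; exact: uC.
move=> f; case: hd => _ _; apply; apply: flow_all; rewrite -/n.
have {}f := flow_psubst (unfreshn b n) f.
have he M (r : nat -> M) : evs (sb (unfreshn b n) r) ps = evs (tl n r) ps.
  by apply: evs_ext => i hi; apply: sb_unfreshn; apply: leq_trans hi hps.
apply: flow_lel _ (flow_ler f _).
  apply: le_with.
    apply: le_trans (le_withl0 _ _ _) _.
    by apply: (le_sup hX) => M hM r _ i hi; rewrite sb_unfreshn.
  apply: le_trans (le_withr0 _ _ _) _; apply: le_eq.
    by rewrite shp_psubst !shp_pconst.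
  move=> M hM r _; rewrite gm_psubst.
  have e : sat r (FLes (vars n) [seq tshift n i | i <- ps]) =
      sat (sb (unfreshn b n) r) (FLes (freshn b n) ps).
    apply: propext; rewrite !sat_FLes ?size_map ?size_iota //.
    by rewrite evs_vars evs_tshift evs_unfreshn he.
  elim: (k.+1) => [//|j IH]; apply: sg_ext => v //=.
  by rewrite !ext0.
apply: le_trans (proj1 (le_psubst_or _ _ _ _)) _; apply: le_or.
  apply: le_eq => [|M hM r _]; first by rewrite /= !shp_psubst.
  apply: sg_ext => v //=; rewrite !ext0 !gm_psubst.
  rewrite sb_insts sb_id sf.
  rewrite evs_unfreshn; apply: hC => i hi; rewrite -[in RHS](ext_hd n r) /ext.
  case: ltnP => // hi'; rewrite sb_unfreshn //.
  by rewrite -(ltn_add2l n) subnKC.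
by apply: (le_sup hZ) => M hM r _ i hi; rewrite sb_unfreshn.
Qed.

Definition witnessed k : prenex k -> prenex k -> prenex k -> Prop :=
  match k return prenex k -> prenex k -> prenex k -> Prop with
  | 0 => fun _ _ _ => True
  | k'.+1 => fun X Z A => exists ts,
      [/\ size ts = size A.1, le top X (pconst (FLes ts A.1) k'.+1)
        & le top (([::], psubst (insts ts Var) A.2) : prenex k'.+1) Z]
  end.

Definition decided k (s : prenex k * prenex k) (C : prenex k) : Prop :=
  Uhat C -> le top s.1 C \/ (le top C s.2 /\ witnessed s.1 s.2 C).

(** One of three reasons why induction for [A] up to [t] is not violated: [A(0)] fails, [A(t)]
    holds, or some step fails at a term. *)
Definition inductive k (s : prenex k * prenex k) (A : prenex k) (t : term) : Prop :=
  Uhat A ->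
  [\/ le top (psubst (scons TZero Var) A) s.2,
      le top s.1 (psubst (scons t Var) A)
    | exists r, le top s.1 (psubst (scons r Var) A) /\
        le top (psubst (scons (TAdd r TOne) Var) A) s.2].

Lemma decided_ex k (contr : contraction k) (s : prenex k * prenex k) C :
  con s ->
  exists s', [/\ con s', grows s s' & decided s' C].
Proof.
move: s => [X Z] hs; case: (boolP (Uhat C)) => uC; last first.
  by exists (X, Z); split=> //; [apply: grows_refl | move=> h; rewrite h in uC].
case: k contr X Z C uC hs => [|k] contr X Z C uC hs.
  case: (con_decide contr uC hs) => h.
    exists (pwith X C, Z); split=> //.
      by split; [apply: le_withl0 | apply: le_refl].
    by left; apply: le_withr0.
  exists (X, pmerge FOr C Z); split=> //.
    by split; [apply: le_refl | apply: le_orr].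
  by right; split=> //; apply: le_orl.
case: C uC => ps C uC; case: (con_witness contr uC hs) => [h|[ts [hts h]]].
  exists (pwith X (ps, C), Z); split=> //.
    by split; [apply: le_withl0 | apply: le_refl].
  by left; apply: le_withr0.
have {h}[X2 [Z2 [h g w]]] : exists X2 Z2, [/\ con (X2, Z2), grows (X, Z) (X2, Z2)
    & @witnessed k.+1 X2 Z2 (ps, C)].
  do 2 eexists; split; first exact: h.
    by split; [apply: le_withl0 | apply: le_orr].
  by exists ts; split=> //; [apply: le_withr0 | apply: le_orl].
(* Adding the failing instance does not yet settle the side of [(ps, C)] itself. If it can still be
   put on the left, that choice is made. *)
case: (con_decide contr uC h) => h2.
  exists (pwith X2 (ps, C), Z2); split=> //.
    apply: grows_trans g _; split; [exact: le_withl0 | exact: le_refl].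
  by left; apply: le_withr0.
exists (X2, @pmerge FOr k.+1 (ps, C) Z2); split=> //.
  apply: grows_trans g _; split; [exact: le_refl | exact: le_orr].
move=> _; right; split; first exact: le_orl.
case: w => ts' [e1 e2 e3]; exists ts'; split=> //.
exact: le_trans e3 (le_orr _ _ _).
Qed.

Lemma inductive_ex k (contr : contraction k) (s : prenex k * prenex k) A t :
  con s ->
  exists s', [/\ con s', grows s s' & inductive s' A t].
Proof.
move: s => [X Z] hs; case: (boolP (Uhat A)) => uA; last first.
  by exists (X, Z); split=> //; [apply: grows_refl | move=> h; rewrite h in uA].
have gl C D : grows (X, Z) (pwith X C, pmerge FOr D Z).
  by split; [apply: le_withl0 | apply: le_orr].
case: (con_induction contr t uA hs) => [h|h|[r h]]; eexists; split; try exact: h.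
- by split; [apply: le_refl | apply: le_orr].
- by move=> _; constructor 1; apply: le_orl.
- by split; [apply: le_withl0 | apply: le_refl].
- by move=> _; constructor 2; apply: le_withr0.
- exact: gl.
- by move=> _; constructor 3; exists r; split; [apply: le_withr0 | apply: le_orl].
Qed.

(** Excluded middle for [X] read as Sigma. An outer empty block makes [X] a Pi formula, and an inner
    one brings its negation, already a Pi formula, to the same depth. *)
Definition em k : Prop :=
  match k return Prop with
  | 0 => True
  | k'.+1 => forall X : prenex k', Uhat X ->
      flow (pconst FTrue k'.+1) (@pmerge FOr k'.+1 ([::], X) (pend (pneg X)))
  end.

Section Saturation.
Variable k : nat.
Hypothesis contr : contraction k.
Variables X0 Z0 : prenex k.
Hypotheses (uX0 : Uhat X0) (uZ0 : Uhat Z0) (hXZ : ~ flow X0 Z0).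
Implicit Types (A B C : prenex k).

Definition saturated (f : nat -> prenex k * prenex k) : Prop :=
  [/\ f 0 = (X0, Z0), (forall n, con (f n) /\ grows (f n) (f n.+1)),
      (forall C, exists n, decided (f n) C)
    & (forall A t, exists n, inductive (f n) A t)].

Lemma saturated_ex : exists f, saturated f.
Proof.
have [e he] := prenex_enum k.
(* A stage codes a formula number and an optional term: without a term the formula is decided, with
   one its induction up to that term is treated. *)
pose dec n : nat * option term := odflt (0, None) (unpickle n).
pose Rl n s s' := grows s s' /\
  if (dec n).2 is Some t then inductive s' (e (dec n).1) t
  else decided s' (e (dec n).1).
have step n s : con s -> exists s', con s' /\ Rl n s s'.
  rewrite /Rl => hs; case: (dec n).2 => [t|].
    by case: (inductive_ex contr (e (dec n).1) t hs) => s' [h1 h2 h3]; exists s'.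
  by case: (decided_ex contr (e (dec n).1) hs) => s' [h1 h2 h3]; exists s'.
have h0 : con (X0, Z0) by split.
have [f [f0 hf]] := dependent_choice step h0; exists f; split=> //.
- by move=> n; case: (hf n) => h1 [h2 _].
- move=> C; case: (he C) => m hm; exists (pickle (m, None : option term)).+1.
  by case: (hf (pickle (m, None : option term))) => _ [_]; rewrite /dec pickleK /= hm.
- move=> A t; case: (he A) => m hm; exists (pickle (m, Some t)).+1.
  by case: (hf (pickle (m, Some t))) => _ [_]; rewrite /dec pickleK /= hm.
Qed.

Variable f : nat -> prenex k * prenex k.
Hypothesis hf : saturated f.

(** Defined by flows rather than reductions, so that it is closed under everything flows provide,
    contraction and cut included. *)
Definition holds A := exists n, flow (f n).1 A.
Definition fails A := exists n, flow A (f n).2.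

Lemma f_con n : con (f n). Proof. by case: hf => _ h _ _; case: (h n). Qed.

Lemma f_grows m n : m <= n -> grows (f m) (f n).
Proof.
elim: n => [|n IH]; first by rewrite leqn0 => /eqP ->; apply: grows_refl.
rewrite leq_eqVlt => /orP [/eqP -> | hm]; first exact: grows_refl.
apply: grows_trans (IH hm) _; by case: hf => _ h _ _; case: (h n).
Qed.

Lemma holds_flow A B : holds A -> flow A B -> holds B.
Proof. by move=> [n h] h'; exists n; apply: flow_trans h h'. Qed.

Lemma holds_le A B : holds A -> le top A B -> holds B.
Proof. by move=> [n h] h'; exists n; apply: flow_ler h h'. Qed.

Lemma holds_fails A : holds A -> fails A -> False.
Proof.
move=> [m hm] [n hn]; have [g1 _] := f_grows (leq_maxl m n).
have [_ g2] := f_grows (leq_maxr m n).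
case: (f_con (maxn m n)) => _ _; apply.
by apply: flow_ler g2; apply: flow_lel g1 _; apply: flow_trans hm hn.
Qed.

Lemma holds_or_fails A : Uhat A -> holds A \/ fails A.
Proof.
move=> uA; case: hf => _ _ h _; case: (h A) => n /(_ uA) [h'|[h' _]].
  left; exists n; apply: flow_le h'; by case: (f_con n).
by right; exists n; apply: flow_le h'.
Qed.

Lemma holds_with A B : holds A -> holds B -> holds (pwith A B).
Proof.
move=> [m hm] [n hn]; exists (maxn m n).
have [g1 _] := f_grows (leq_maxl m n); have [g2 _] := f_grows (leq_maxr m n).
by apply: flow_with; [apply: flow_lel g1 hm | apply: flow_lel g2 hn].
Qed.

(** Primality. If both disjuncts failed, contraction would make the disjunction flow into the
    right-hand side. *)
Lemma holds_or A B : Uhat A -> Uhat B ->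
  holds (pmerge FOr A B) -> holds A \/ holds B.
Proof.
move=> uA uB h; case: (holds_or_fails uA) => [|[m hm]]; first by left.
case: (holds_or_fails uB) => [|[n hn]]; [by right | exfalso].
apply: holds_fails h _; exists (maxn m n).
have [_ g1] := f_grows (leq_maxl m n); have [_ g2] := f_grows (leq_maxr m n).
apply: (flow_or_elim contr) => //; first by case: (f_con (maxn m n)).
  exact: flow_ler hm g1.
exact: flow_ler hn g2.
Qed.

Lemma holds_X0 : holds X0.
Proof. by exists 0; case: hf => -> _ _ _; apply: flow_refl. Qed.

Lemma fails_Z0 : ~ holds Z0.
Proof.
by move=> /holds_fails; apply; exists 0; case: hf => -> _ _ _; apply: flow_refl.
Qed.

Lemma holds_top A : le top (pconst FTrue k) A -> holds A.
Proof.
move=> h; apply: holds_le h; exists 0; apply: flow_le; first by case: (f_con 0).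
apply: le_win => M hM r _; right.
by apply: leaves_pconst_true => -[].
Qed.

Lemma holds_ind A t : Uhat A -> holds (psubst (scons TZero Var) A) ->
  ~ holds (psubst (scons t Var) A) ->
  exists r, holds (psubst (scons r Var) A) /\
    ~ holds (psubst (scons (TAdd r TOne) Var) A).
Proof.
move=> uA h1 h2; case: hf => _ _ _ h; case: (h A t) => n /(_ uA) [h'|h'|[r [h3 h4]]].
- exfalso; apply: holds_fails h1 _; exists n; apply: flow_le h'.
  exact: Uhat_psubst.
- exfalso; apply: h2; exists n; apply: flow_le h'; by case: (f_con n).
- exists r; split; first by exists n; apply: flow_le h3; case: (f_con n).
  move=> h5; apply: holds_fails h5 _; exists n; apply: flow_le h4.
  exact: Uhat_psubst.
Qed.

(** * The term model *)

Definition holdsq (N : form) := holds (pconst N k).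

(** Quantifier-free facts that hold may serve as hypotheses of reductions, since terms can branch on
    them and the false branch is won at once. *)
Lemma holds_mp N A B : qfree N -> holds A -> holdsq N ->
  le (fun M r => sat r N) A B -> holds B.
Proof.
move=> qN hA hN h; apply: holds_le (holds_with hA hN) _.
apply: (le_case (c := N)) => //.
  apply: le_trans (le_withl0 _ _ _) (le_weak h _).
  by move=> M hM r [].
apply: le_trans (le_withr0 _ _ _) _; apply: le_win => M hM r [_ hr]; left.
exact: leaves_pconst_false.
Qed.

Lemma holdsq_valid N :
  (forall M, model M R -> forall r : nat -> M, sat r N) -> holdsq N.
Proof.
move=> h; apply: holds_top; apply: le_win => M hM r _; right.
by apply: leaves_pconst_true; apply: h.
Qed.

Lemma holdsq_imp1 N N' : qfree N -> holdsq N ->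
  (forall M, model M R -> forall r : nat -> M, sat r N -> sat r N') -> holdsq N'.
Proof.
move=> qN h1 h; apply: (holds_mp qN h1 h1); apply: le_win => M hM r hr.
by right; apply: leaves_pconst_true; apply: h hr.
Qed.

Lemma holdsq_imp2 N1 N2 N : qfree N1 -> qfree N2 -> holdsq N1 -> holdsq N2 ->
  (forall M, model M R -> forall r : nat -> M, sat r N1 -> sat r N2 -> sat r N) ->
  holdsq N.
Proof.
move=> q1 q2 h1 h2 h; apply: (holds_mp q2 h1 h2).
apply: (le_case (c := N1)) => //; apply: le_win => M hM r [h3 h4].
  by right; apply: leaves_pconst_true; apply: h.
by left; apply: leaves_pconst_false.
Qed.

Lemma holdsq_false : ~ holdsq FFalse.
Proof.
move=> h; apply: (holds_fails h); exists 0; apply: flow_le; first exact: Uhat_const.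
by apply: le_win => M hM r _; left; apply: leaves_pconst_false.
Qed.

Lemma holdsq_not N : qfree N -> holdsq (FNot N) <-> ~ holdsq N.
Proof.
move=> qN; split=> [h1 h2 | h].
  have qn : qfree (FNot N) by rewrite /= qN.
  apply: holdsq_false; apply: (holdsq_imp2 qn qN h1 h2) => M hM r hn; exact: hn.
have u1 : Uhat (pconst N k) by apply: Uhat_const.
have u2 : Uhat (pconst (FNot N) k) by apply: Uhat_const; rewrite /= qN.
have h1 : holds (pmerge FOr (pconst N k) (pconst (FNot N) k)).
  apply: holds_top; apply: (le_case (c := N)) => //.
    apply: le_trans (le_orl _ _ _); apply: le_win => M hM r [_ hr]; right.
    exact: leaves_pconst_true.
  apply: le_trans (le_orr _ _ _); apply: le_win => M hM r [_ hr]; right.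
  exact: leaves_pconst_true.
by case: (holds_or u1 u2 h1) => [/h|].
Qed.

Lemma holds_congruence :
  term_congruence (fun a b => holdsq (FEq a b)) (fun a b => holdsq (FLe a b)).
Proof.
split.
- by move=> a; apply: holdsq_valid.
- by move=> a b h; apply: holdsq_imp1 h _ => // M hM r /= ->.
- by move=> a b c h1 h2; apply: holdsq_imp2 h1 h2 _ => // M hM r /= -> ->.
- by move=> a b c d h1 h2; apply: holdsq_imp2 h1 h2 _ => // M hM r /= -> ->.
- by move=> a b c d h1 h2; apply: holdsq_imp2 h1 h2 _ => // M hM r /= -> ->.
- by move=> a b c d h1 h2; apply: holdsq_imp2 h1 h2 _ => // M hM r /= -> ->.
- by move=> a b c d h1 h2; apply: holdsq_imp2 h1 h2 _ => // M hM r /= -> ->.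
- move=> a b c d h1 h2 h3.
  have h : holdsq (FAnd (FEq a b) (FEq c d)) by apply: holdsq_imp2 h1 h2 _.
  by apply: holdsq_imp2 h h3 _ => // M hM r /= [-> ->].
Qed.

Definition tm : struct := term_model holds_congruence.
Definition te (s : nat -> term) : nat -> tm := tenv holds_congruence s.

Lemma sb_te t s : sb t (te s) = te (fun i => tsubst s (t i)).
Proof. by funext i; rewrite /sb ev_tenv. Qed.

Lemma holdsq_sat N s : qfree N -> sat (te s) N <-> holdsq (fsubst s N).
Proof.
elim: N => //=.
- by move=> _; split=> // /holdsq_false.
- by move=> a b _; rewrite !ev_tenv; apply: tclass_eq.
- by move=> a b _; rewrite !ev_tenv; apply: (sle_tclass holds_congruence).
- move=> B IB C IC /andP [qB qC]; rewrite IB // IC //.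
  have qB' : qfree (fsubst s B) by rewrite qfree_subst.
  have qC' : qfree (fsubst s C) by rewrite qfree_subst.
  have qN : qfree (FNot (fsubst s B)) by rewrite /= qB'.
  split=> [h | h1 h2].
    case: (classic (holdsq (fsubst s B))) => [/h h' | /(holdsq_not qB') h'].
      by apply: (holdsq_imp1 qC' h') => M hM r h1 h2.
    by apply: (holdsq_imp1 qN h') => M hM r h1 h2; case: (h1 h2).
  apply: (holdsq_imp2 _ qB' h1 h2) => [|M hM r h3]; last exact: h3.
  by rewrite /= qB' qC'.
- move=> B IB C IC /andP [qB qC]; rewrite IB // IC //.
  split=> [[h1 h2] | h].
    by apply: holdsq_imp2 h1 h2 _ => //; rewrite qfree_subst.
  by split; apply: holdsq_imp1 h _ => [|M hM r []//]; rewrite /= !qfree_subst qB.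
- move=> B IB C IC /andP [qB qC]; rewrite IB // IC //.
  have qB' : qfree (fsubst s B) by rewrite qfree_subst.
  have qC' : qfree (fsubst s C) by rewrite qfree_subst.
  split=> [[h | h] | h].
  + by apply: (holdsq_imp1 qB' h) => M hM r h1; left.
  + by apply: (holdsq_imp1 qC' h) => M hM r h1; right.
  + apply: NNPP => /not_or_and [/(holdsq_not qB') h1 /(holdsq_not qC') h2].
    apply: holdsq_false.
    have h3 : holdsq (FAnd (FNot (fsubst s B)) (FNot (fsubst s C))).
      by apply: holdsq_imp2 h1 h2 _; rewrite /= ?qB' ?qC'.
    apply: (holdsq_imp2 _ _ h h3); rewrite /= ?qB' ?qC' //.
    by move=> M hM r [h4|h4] [h5 h6]; [apply: h5 | apply: h6].
Qed.

Lemma R_qfree N : R N -> qfree N.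
Proof.
have /allP h : all qfree R_axioms by [].
by rewrite /R; elim: R_axioms h => //= A As IH h [<-|hN];
  [apply: h; rewrite inE eqxx | apply: IH hN => B hB; apply: h; rewrite inE hB orbT].
Qed.

Lemma tm_R : model tm R.
Proof.
move=> N hN r; rewrite (tenv_val r).
apply/holdsq_sat; first exact: R_qfree.
by apply: holdsq_valid => M hM r'; rewrite sat_subst; apply: hM.
Qed.

Lemma leS_ex j G (q p ts : seq term) (X Y : prenex j) : size ts = size p ->
  (forall M, model M R -> forall r : nat -> M, G M (tl (size q) r) ->
     vle (hd (size q) r) (evs (tl (size q) r) q) ->
     vle (evs r ts) (evs (tl (size q) r) p)) ->
  le (fun M r => G M (tl (size q) r) /\ vle (hd (size q) r) (evs (tl (size q) r) q))
    Y (psubst (reblock ts (size q)) X) ->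
  leS false G ((q, Y) : prenex j.+1) ((p, X) : prenex j.+1).
Proof.
by move=> hs hok h; apply: (D_block (f := ts)) => //; rewrite /le shp_psubst in h.
Qed.

(** * Witnesses for existential blocks *)

Section Block.
Variables (j : nat) (e : prenex j.+1 -> prenex k).
Hypothesis he : adm false e.

(* The least witness of the first variable is found by induction on [y] for
   [exists v >= y, C(v)]. *)
Definition from (y q : term) (qs : seq term) (C : prenex j) : prenex j.+1 :=
  (q :: qs, pguard FAnd (FLe (tshift (size qs).+1 y) (Var 0)) C).

Lemma from_at M (r : nat -> M) y q qs (C : prenex j) v :
  (gm (from y q qs C) r).2 v =
  lmap (fun P => sle (ev r y) (nth s0 v 0) /\ P) (gm C (ext (size qs).+1 v r)).
Proof.
rewrite /= gm_guard_and; apply: lmap_ext => P /=.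
by rewrite ev_tshift tl_ext.
Qed.

Lemma from_false M (r : nat -> M) n y (C : prenex j) :
  ~ sle (ev (tl n r) y) (r 0) ->
  leaves False (gm (pguard FAnd (FLe (tshift n y) (Var 0)) C) r).
Proof.
move=> h; rewrite gm_guard_and; apply: leaves_lmap => P.
by rewrite /= ev_tshift; tauto.
Qed.

(** Induction for Pi formulas suffices, although [N] is read as Sigma: [adm false] forces at least
    one empty block in front, so [e N] is a Pi formula of the right level. *)
Lemma holds_ex1 q qs (C : prenex j) : Uhat C -> holds (e (q :: qs, C)) ->
  exists y, holdsq (FLe y q) /\
    holds (e (qs, psubst (scons (tshift (size qs) y) Var) C)).
Proof.
move=> uC h; set n' := size qs; set n := n'.+1.
pose N : prenex j.+1 := (map (tshift 1) (q :: qs),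
  pguard FAnd (FLe (Var n) (Var 0)) (psubst (upn n (shift 1)) C)).
have uN : Uhat N.
  by rewrite UhatE /= matrix_guard //= matrix_psubst.
have uF y : Uhat (from y q qs C) by rewrite UhatE /= matrix_guard.
have eN y : leS false top (psubst (scons y Var) N) (from y q qs C) /\
    leS false top (from y q qs C) (psubst (scons y Var) N).
  have eshp : shp (psubst (scons y Var) N) = shp (from y q qs C).
    rewrite shp_psubst; funext i; rewrite /= size_map !shp_pguard shp_psubst.
    by [].
  have egm M (r : nat -> M) :
      gm (psubst (scons y Var) N) r = gm (from y q qs C) r.
    rewrite gm_psubst sb_scons0; apply: sg_ext => v.
      by rewrite /= !ev_tshift evs_tshift tl1_econs.
    rewrite from_at /N /= size_map gm_guard_and gm_psubst.
    rewrite -[up (upn n' _)]/(upn n _) sb_upn sb_shift_tl tl1_econs; apply: lmap_ext => P /=.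
    by rewrite /ext ltnn subnn.
  by split; apply: leS_eq.
have hI y : holds (psubst (scons y Var) (e N)) <-> holds (e (from y q qs C)).
  rewrite -(adm_psubst _ _ he); case: (eN y) => e1 e2.
  by split=> h'; apply: holds_le h' _; apply: (adm_le he).
(* At 0 the lower bound is vacuous; at [q + 1] no witness below [q] remains. *)
have [] := @holds_ind (e N) (TAdd q TOne) (adm_Uhat he uN).
- apply/hI; apply: holds_le h _; apply: (adm_le he); apply: leS_eq.
    by funext i; rewrite /= shp_pguard.
  move=> M hM r _; apply: sg_ext => v //; rewrite from_at lmap_id // => P.
  by apply: propext; split=> [[]//|]; split=> //; apply: sle0.
- move/hI => h'; apply: holdsq_false; apply: holds_le h' _.
  rewrite -(adm_const _ he); apply: (adm_le he); apply: (leS_ex (ts := [::])) => //.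
  apply: le_win => M hM r [_ h']; left; apply: from_false => /= h1.
  have h2 := h' 0 isT; rewrite /= in h2.
  have := sle_trans hM h1 h2; apply/(sltNge hM).
  exact: slt_succ.
move=> y [/hI h1 h2]; exists y.
have qy : holdsq (FLe y q).
  apply: holds_le h1 _; rewrite -(adm_const _ he); apply: (adm_le he).
  apply: (leS_ex (ts := [::])) => //; rewrite psubst_pconst.
  apply: (le_case (c := FLe (tshift n y) (tshift n q))) => //.
    apply: le_win => M hM r [_ hr]; right.
    by apply: leaves_pconst_true; rewrite sat_subst sb_reblock ext0; move: hr; rewrite /= !ev_tshift.
  apply: le_win => M hM r [[_ h3] h4]; left; apply: from_false => h5; apply: h4.
  rewrite /= !ev_tshift; apply: (sle_trans hM h5).
  exact: (h3 0 isT).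
split=> //; set C2 := psubst _ C.
have uC2 : Uhat ((qs, C2) : prenex j.+1) by rewrite UhatE /= matrix_psubst.
(* A witness [v >= y] is either at least [y + 1] or equal to [y]. The same block answers both
   disjuncts, the second one without its first entry; primality and the failure at [y + 1] leave the
   second. *)
have : holds (e (@pmerge FOr j.+1 (from (TAdd y TOne) q qs C) (qs, C2))).
  apply: holds_le h1 _; apply: (adm_le he).
  apply: (leS_ex (ts := vars n ++ map (tshift 1) (vars n'))).
  - by rewrite !size_cat size_map !size_mkseq.
  - move=> M hM r _ h3.
    have -> : evs r (vars n ++ map (tshift 1) (vars n')) = hd n r ++ hd n' (tl 1 r).
      by rewrite /evs map_cat -!/(evs _ _) evs_vars evs_tshift evs_vars.
    rewrite [X in vle _ X]/evs map_cat vle_cat !size_map.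
    rewrite take_size_cat ?drop_size_cat ?size_hd //; split=> // i hi.
    have := h3 i.+1 hi; rewrite !nth_mkseq //; last by rewrite size_map in hi.
    by move: hi; rewrite size_map.
  set G' : ctx := fun M r => _.
  pose G2 := pguard FAnd (FLe (tshift n (TAdd y TOne)) (Var 0)) C.
  apply: (@le_trans _ _ (pmerge FOr G2 (psubst (shift 1) C2))); last first.
    change (le G' (pmerge FOr G2 (psubst (shift 1) C2))
      (psubst (reblock (vars n ++ map (tshift 1) (vars n')) n)
        (pmerge FOr (psubst (upn n (shift n')) G2) (psubst (shift n) C2)))).
    apply: le_eq => [|M hM r _].
      by rewrite shp_psubst !shp_pmergeE !shp_psubst.
    rewrite gm_psubst !gm_pmerge_or !shp_psubst !gm_psubst sb_reblock.
    rewrite size_cat size_map !size_mkseq sb_upn_shift !sb_shift_tl tl_ext_add.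
    rewrite -!gm_psubst /evs map_cat -!/(evs _ _) evs_vars evs_tshift evs_vars.
    rewrite take_size_cat ?drop_size_cat ?size_hd // ext_hd.
    by rewrite (_ : tl n r = tl n' (tl 1 r)) ?ext_hd.
  have hg M (hM : model M R) (r : nat -> M) : sle (ev (tl n r) y) (r 0) ->
      gm (pguard FAnd (FLe (tshift n y) (Var 0)) C) r = gm C r.
    move=> hr; rewrite gm_guard_and lmap_id // => P; apply: propext.
    by rewrite /= ev_tshift; tauto.
  apply: (le_case (c := FLe (TAdd (tshift n y) TOne) (Var 0))) => //.
    apply: le_trans (le_orl _ _ _); apply: le_eq => [|M hM r [_ h3]].
      by rewrite !shp_pguard.
    rewrite /= ev_tshift in h3; rewrite hg //; last first.
      exact: sle_trans (sle_addr hM _ _) h3.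
    rewrite /G2 gm_guard_and lmap_id // => P; apply: propext.
    by rewrite /= ev_tshift; tauto.
  apply: (le_case (c := FEq (Var 0) (tshift n y))) => //.
    apply: le_trans (le_orr _ _ _); apply: le_eq => [|M hM r [_ h3]].
      by rewrite shp_pguard !shp_psubst.
    rewrite /= ev_tshift in h3; rewrite hg //; last by rewrite h3; apply: slexx.
    rewrite !gm_psubst sb_scons0 ev_tshift sb_shift_tl tl_add add1n -h3.
    by rewrite econs_tl1.
  apply: le_win => M hM r [[_ h3] h4]; left; apply: from_false => h5.
  rewrite /= !ev_tshift in h3 h4; apply: h3; apply/(slt_succP hM).
  by split=> // e5; apply: h4.
move=> h3; have := holds_le h3 (adm_or _ _ _ he).
case/holds_or => //; try exact: adm_Uhat he _.
by move=> h4; case: h2; apply/hI.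
Qed.

Lemma holds_ex qs (C : prenex j) : Uhat C -> holds (e (qs, C)) ->
  exists ts, [/\ size ts = size qs, holdsq (FLes ts qs)
    & holds (e ([::], psubst (insts ts Var) C))].
Proof.
elim: qs C => [|q qs IH] C uC h.
  exists [::]; split=> //; first by apply: holdsq_valid => M hM r [].
  apply: holds_le h _; apply: (adm_le he); apply: leS_eq.
    by funext i; rewrite /= shp_psubst.
  by move=> M hM r _; apply: sg_ext => v //=; rewrite gm_psubst sb_insts !ext0 sb_id.
have [y [h1 h2]] := holds_ex1 uC h.
have [ts [hs h3 h4]] := IH _ (Uhat_psubst _ uC) h2.
exists (y :: ts); split; first by rewrite /= hs.
    have qf := qfree_FLes ts qs; exact: holdsq_imp2 h1 h3 _.
apply: holds_le h4 _; apply: (adm_le he); apply: leS_eq.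
  by funext i; rewrite /= !shp_psubst.
move=> M hM r _; apply: sg_ext => v //=; rewrite !ext0 !gm_psubst !sb_insts sb_id.
by rewrite sb_scons sb_id ev_tshift -hs tl_ext econs_ext.
Qed.

End Block.

Lemma holdsq_te N : qfree N -> sat (te Var) N <-> holdsq N.
Proof. by move=> qN; rewrite holdsq_sat // fsubst_id. Qed.

Definition tms (v : seq tm) (n : nat) : seq term := mkseq (fun i => sval (nth s0 v i)) n.

Lemma evs_tms v n : evs (te Var) (tms v n) = trim n v.
Proof.
rewrite /evs /tms /mkseq -map_comp; apply: eq_map => i /=.
by rewrite ev_tenv tsubst_id tclass_val.
Qed.

Lemma holds_inst j (e : prenex j.+1 -> prenex k) ps (C : prenex j) ts :
  adm true e -> size ts = size ps -> holdsq (FLes ts ps) -> holds (e (ps, C)) ->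
  holds (e ([::], psubst (insts ts Var) C)).
Proof.
move=> he hs h1 h2; apply: (holds_mp (qfree_FLes _ _) h2 h1).
apply: (adm_le he); apply: (D_block (f := ts)) => //.
  by move=> M hM r h3 _; move/sat_FLes: h3; apply.
by rewrite shp_psubst; apply: D_eq => M hM r _.
Qed.

(** Only this direction descends through the subformulas: universal blocks are instantiated by
    representatives of the moves, existential ones have witnesses by [holds_ex]. *)
Lemma holds_tv j s (e : prenex j -> prenex k) (A : prenex j) : adm s e -> Uhat A ->
  holds (e A) -> tv s (gm A (te Var)).
Proof.
elim: j s e A => [|j IH] s e A he uA h.
  apply/holdsq_te => //; move: h.
  by rewrite -[A]/(pconst A 0) (adm_const _ he).
case: A uA h => ps C uA h.
have uC s' : Uhat (psubst s' C) by apply: Uhat_psubst.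
case: s he h => he h.
  move=> v hv; pose ts := tms v (size ps).
  have hs : size ts = size ps by rewrite size_mkseq.
  have h1 : holdsq (FLes ts ps).
    apply/holdsq_te; first exact: qfree_FLes.
    apply/sat_FLes => //; rewrite evs_tms; apply/vle_trim => //.
    by rewrite size_map.
  have := IH _ _ _ (adm_pad he) (uC _) (holds_inst he hs h1 h).
  by rewrite gm_psubst sb_insts sb_id evs_tms hs ext_trim.
have [ts [hs h1 h2]] := holds_ex he uA h.
exists (evs (te Var) ts); split.
  by apply/sat_FLes => //; apply/holdsq_te => //; exact: qfree_FLes.
have := IH _ _ _ (adm_pad he) (uC _) h2.
by rewrite gm_psubst sb_insts sb_id hs.
Qed.

End Saturation.

(** * Truth in the term model *)

Lemma tv_holds k (contr : contraction k) (hem : em k) (X0 Z0 : prenex k) f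
    (hf : saturated X0 Z0 f) A :
  Uhat A -> tv true (gm A (te hf Var)) <-> holds f A.
Proof.
move=> uA; split=> [h | ]; last first.
  exact: (@holds_tv k contr X0 Z0 f hf k true (fun A => A) A (adm_id k)).
apply: NNPP => hA; case: k contr hem X0 Z0 f hf A uA h hA
  => [|k] contr hem X0 Z0 f hf A uA h hA.
  by apply: hA; apply/(holdsq_te contr hf).
case: A uA h hA => ps C uA h hA.
case: (hf) => _ _ hd _; case: (hd (ps, C)) => n /(_ uA) [h'|[_ [ts [hs h1 h2]]]].
  by apply: hA; exists n; apply: flow_le h'; case: (f_con hf n).
set X := psubst _ _ in h2.
have uX : Uhat X by apply: Uhat_psubst.
have uX1 : Uhat (([::], X) : prenex k.+1) by [].
have uX2 : Uhat (pend (pneg X)) by apply: Uhat_pend; apply: Uhat_pneg.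
have hT : holds f (pconst FTrue k.+1) by apply: (holdsq_valid hf) => M hM r [].
(* Either the failing instance [X] would hold, a contradiction, or its negation holds and is
   therefore true, against the assumed truth of the universal formula. *)
case: (holds_or contr hf uX1 uX2 (holds_flow hT (hem X uX))) => hX.
  by apply: (holds_fails hf hX); exists n; apply: flow_le h2.
have := @holds_tv k.+1 contr X0 Z0 f hf k.+1 true (fun A => A) _ (adm_id _) uX2 hX.
rewrite tv_pend gm_pneg tv_neg; apply.
have h3 : holdsq f (FLes ts ps).
  by exists n; apply: flow_le h1; case: (f_con hf n).
have := h (evs (te hf Var) ts); rewrite /X gm_psubst sb_insts sb_id hs; apply.
by apply/sat_FLes => //; apply/(holdsq_te contr hf) => //; apply: qfree_FLes.
Qed.

Lemma sat_induction M (r : nat -> M) A :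
  sat r (induction A) =
  (sat (econs s0 r) A /\
   (forall x, sat (econs x r) A -> sat (econs (sadd x s1) r) A) ->
   forall x, sat (econs x r) A).
Proof.
have -> : sat r (induction A) =
  (sat r (finst TZero A) /\
   (forall x, sat (econs x r) A -> sat (econs x r)
      (fsubst (scons (TAdd (Var 0) TOne) (shift 1)) A)) ->
   forall x, sat (econs x r) A) by [].
rewrite sat_finst; congr (_ /\ _ -> _); apply: forall_ext => x.
by rewrite sat_subst sb_scons.
Qed.

Lemma tm_model k (contr : contraction k) (hem : em k) (X0 Z0 : prenex k) f
    (hf : saturated X0 Z0 f) : model (tm hf) (IU k).
Proof.
move=> N [hN | [A [uA ->]]] r; first exact: (tm_R contr hN r).
pose s i := sval (r i); have -> : r = te hf s by exact: tenv_val.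
rewrite sat_induction => -[h0 h1] x.
(* The parameters of the induction formula are named by terms, which turns it into an instance met
   by the saturation. *)
pose A' := psubst (up s) A; have uA' : Uhat A' by apply: Uhat_psubst.
have key t : sat (econs (tclass (holds_congruence hf) t : tm hf) (te hf s)) (pform Univ A)
    <-> holds f (psubst (scons t Var) A').
  rewrite -(tv_holds contr hem hf); last exact: Uhat_psubst.
  rewrite sat_pform !gm_psubst econs_tenv.
  have -> : sb (up s) (sb (scons t Var) (te hf Var)) = te hf (scons t s) => //.
  rewrite !sb_te; congr te; funext i; case: i => [|i] /=.
    by rewrite tsubst_id.
  by rewrite /tshift !tsubst_comp -[RHS]tsubst_id -[s i]tsubst_id tsubst_comp; congr tsubst.
rewrite -(tclass_val (holds_congruence hf) x); apply/key; apply: NNPP => hx.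
have [|r' [hr1 hr2]] := holds_ind hf uA' _ hx; first exact/key.
apply: hr2; apply/key.
have := h1 _ (proj2 (key r') hr1).
have -> // : sadd (tclass (holds_congruence hf) r' : tm hf) s1 =
  tclass (holds_congruence hf) (TAdd r' TOne).
exact: (ev_tenv (holds_congruence hf) (scons r' s) (TAdd (Var 0) TOne)).
Qed.

Theorem flow_complete k (contr : contraction k) (hem : em k) (A B : prenex k) :
  Uhat A -> Uhat B ->
  (forall M, model M (IU k) -> forall r : nat -> M,
     tv true (gm A r) -> tv true (gm B r)) ->
  flow A B.
Proof.
move=> uA uB h; apply: NNPP => hn.
have [f hf] := saturated_ex contr uA uB hn.
have := h (tm hf) (@tm_model _ contr hem _ _ _ hf) (te hf Var).
rewrite !(tv_holds contr hem hf) //; move=> h'.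
by apply: (fails_Z0 uB hf); apply: h'; apply: (holds_X0 uA hf).
Qed.

Lemma IU_R (M : struct) k : model M (IU k) -> model M R.
Proof. by move=> h A hA; apply: h; left. Qed.

Lemma lmap_notK (M : struct) k (X : sg M k) : lmap not (lmap not X) = X.
Proof.
rewrite lmap_comp lmap_id // => P /=.
by apply: propext; split=> [/NNPP | h h'].
Qed.

Lemma leaves_not (M : struct) k (X : sg M k) :
  leaves False X -> leaves True (lmap not X).
Proof.
by elim: k X => [|k IH] X /= h; [split=> // _ /h | move=> v; apply: IH].
Qed.

Lemma leS_block k G (q p ts : seq term) (X Y : prenex k) : size ts = size p ->
  (forall M, model M R -> forall r : nat -> M, G M (tl (size q) r) ->
     vle (hd (size q) r) (evs (tl (size q) r) q) ->
     vle (evs r ts) (evs (tl (size q) r) p)) ->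
  leS false (fun M r => G M (tl (size q) r) /\ vle (hd (size q) r) (evs (tl (size q) r) q))
    (psubst (reblock ts (size q)) X) Y ->
  le G ((p, X) : prenex k.+1) ((q, Y) : prenex k.+1).
Proof.
by move=> hs hok h; apply: (D_block (f := ts)) => //; rewrite /leS shp_psubst in h.
Qed.

(** * Induction on the number of blocks *)

Section Step.
Variable k : nat.
Hypotheses (contr : contraction k) (hem : em k).

(** One block answers for both copies, which leaves contraction for the Sigma formula [C]. Since the
    negation of [C] implies that of [C \/ C] in all models, there is a flow one level lower, and
    [flow_neg] reverses it under the block. *)
Lemma contraction_step : contraction k.+1.
Proof.
move=> [p C] uA; have uC : Uhat C by exact: uA.
set n := size p.
have h : flow (pneg C) (pneg (pmerge FOr C C)).
  apply: (flow_complete contr hem); try by apply: Uhat_pneg; try apply: Uhat_or.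
  move=> M hM r; rewrite !gm_pneg !tv_neg tv_or; last exact: IU_R hM.
  by move=> h [].
apply: flow_lel _ (flow_ler (flow_neg p h) _).
  apply: (leS_block (ts := vars n ++ vars n)).
  - by rewrite !size_cat !size_mkseq.
  - move=> M hM r _ hv; rewrite /= /evs !map_cat -!/(evs _ _) !evs_vars.
    by rewrite vle_cat size_map take_size_cat ?drop_size_cat ?size_hd.
  - apply: leS_eq => [|M hM r _].
      by rewrite !shp_pneg shp_psubst !shp_pmergeE !shp_psubst.
    rewrite !gm_pneg lmap_notK gm_psubst !gm_pmerge_or shp_psubst !gm_psubst.
    rewrite sb_reblock size_cat !size_mkseq sb_upn_shift sb_shift_tl tl_ext_add.
    rewrite /evs map_cat -!/(evs _ _) !evs_vars.
    by rewrite take_size_cat ?drop_size_cat ?size_hd // ext_hd.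
apply: le_eq => [|M hM r _].
  by funext i; rewrite /= !shp_pneg.
by apply: sg_ext => v //=; rewrite !gm_pneg lmap_notK.
Qed.

End Step.

Lemma em_step k : contraction k -> em k -> em k.+1.
Proof.
case: k => [|k] contr hem X uX.
  apply: flow_le => //; apply: le_win => M hM r _; right=> v /=.
  split=> // _; rewrite !sat_subst.
  by case: (classic (sat (ext 0 v r) X)) => hX; [left | right].
case: X uX => q C uX; have uC : Uhat C by exact: uX.
set n := size q; set X : prenex k.+1 := (q, C).
pose g := FLes (vars n) (map (tshift n) q).
have qg : qfree g by apply: qfree_FLes.
(* For [X] of the form [exists v <= q, C], the negation of [X] contributes an outer block [v <= q].
   Below it [Y] says that [X] or the negation of [C(v)] is true, which is valid; so the negation
   [A0] of the guarded [Y] flows to falsity, and this flow is reversed. *)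
pose Y := pmerge FOr (psubst (shift n) X) (pend (pneg C)).
have uY : Uhat Y.
  by apply: Uhat_or; [apply: Uhat_psubst | apply: Uhat_pend; apply: Uhat_pneg].
pose A0 := pneg (pguard FImp g Y); pose B0 := pconst FFalse k.+1.
have hg M (r : nat -> M) : sat r g <-> vle (hd n r) (evs (tl n r) q).
  rewrite /g sat_FLes; last by rewrite size_map size_mkseq.
  by rewrite evs_vars evs_tshift.
have h : flow A0 B0.
  apply: (flow_complete contr hem).
  - by apply: Uhat_pneg; apply: Uhat_imp.
  - exact: Uhat_const.
  move=> M hM r; have hR := IU_R hM.
  rewrite gm_pneg tv_neg gm_guard_imp tv_imp; last exact: gm_szok.
  move=> h; exfalso; apply: h => /hg h; apply/tv_or => //.
  rewrite tv_pend gm_pneg tv_neg gm_psubst sb_shift_tl.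
  case: (classic (tv true (gm C r))) => hC; [left | by right].
  exists (hd n r); split=> //.
  by have := hC; rewrite -{1}(ext_hd n r).
apply: flow_lel _ (flow_ler (flow_neg q h) _).
  apply: le_win => M hM r _; right.
  have e v : leaves True (gm (pneg B0) (ext (size q) v r)).
    by rewrite gm_pneg; apply: leaves_not; apply: leaves_pconst_false.
  by move=> v; exact: e v.
change (le top ((q, pneg A0) : prenex k.+2)
  (([::] ++ q, pmerge FOr (psubst (upn 0 (shift n)) X) (psubst (shift 0) (pend (pneg C))))
    : prenex k.+2)).
apply: (leS_block (ts := vars n)).
- by rewrite size_mkseq.
- by move=> M hM r _ hv; rewrite evs_vars.
apply: leS_eq => [|M hM r [_ hr]].
  by rewrite shp_psubst !shp_pneg shp_pguard !shp_pmergeE !shp_psubst.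
rewrite gm_psubst sb_reblock size_mkseq evs_vars ext_hd !gm_pneg lmap_notK.
rewrite gm_guard_imp lmap_id => [|P]; last first.
  by apply: propext; split=> [|hP _ //]; apply; apply/hg.
by rewrite /Y !gm_pmerge_or !shp_psubst !gm_psubst.
Qed.

Lemma contraction_em k : contraction k /\ em k.
Proof.
elim: k => [|k [contr hem]]; last first.
  by split; [exact: contraction_step | exact: em_step].
split=> // C uC; apply: flow_le; first exact: Uhat_or.
by move=> M hM r _ [].
Qed.

(** * Deterministic reductions *)

Lemma tv_conj (M : struct) (b : Prop) s k (X : sg M k) : szok X ->
  tv s (lmap (fun P => b /\ P) X) <-> b /\ tv s X.
Proof.
move=> hX; have -> : lmap (fun P => b /\ P) X =
    lmap not (lmap (fun P => b -> P) (lmap not X)).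
  rewrite !lmap_comp; apply: lmap_ext => P; apply: propext.
  by rewrite /comp; split=> [[hb hP] h | h];
    [apply: h | split; apply: NNPP => h'; apply: h].
rewrite tv_neg tv_imp; last exact: szok_lmap.
rewrite tv_neg negbK; split=> [h | [hb h] h']; last exact: h'.
by split; apply: NNPP => h'; apply: h.
Qed.

Lemma dred_sound Q F G k (A B : prenex k) M (r : nat -> M) :
  model M R -> dred R Q F G A B -> sats r G ->
  tv (pol Q) (gm A r) -> tv (pol Q) (gm B r).
Proof.
move=> hM; elim: k Q G A B r => [|k IH] Q G A B r.
  by move=> /= h hG; apply: (soundness hM h hG).
have hG' n (v : seq M) : sats r G -> sats (ext n v r) (map (fshift n) G).
  move=> hG N /List.in_map_iff [N' [<- hN]].
  by rewrite sat_subst sb_shift_tl tl_ext; apply: hG.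
have hv n v (ps : seq term) : size ps = n ->
    sat (ext n v r) (FLes (vars n) (map (tshift n) ps)) <-> vle v (evs r ps).
  move=> hn; rewrite sat_FLes; last by rewrite size_map size_mkseq.
  rewrite evs_vars evs_tshift tl_ext.
  rewrite -(vle_trim (n := n) v) ?size_map // (_ : hd n _ = trim n v) //.
  apply/eq_in_map => i; rewrite mem_iota => /= hi.
  by rewrite /ext hi.
have hf n v (f ps : seq term) : size f = size ps ->
    sat (ext n v r) (FLes f (map (tshift n) ps)) <->
    vle (evs (ext n v r) f) (evs r ps).
  by move=> hn; rewrite sat_FLes ?size_map // evs_tshift tl_ext.
case: A B => p C [q D]; case: Q => /= -[hs h1 h2] hG.
  move=> hA v /(hv _ _ _ erefl) h3; set r' := ext _ v r in h3 *.
  have h4 := soundness hM h1 (hG' _ v hG) h3.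
  have := IH _ _ _ _ r' h2 (hG' _ v hG).
  rewrite !gm_guard_imp !tv_imp; try exact: gm_szok.
  rewrite gm_psubst sb_reblock tl_ext hs; apply=> // _.
  by apply: hA; apply/hf.
move=> [v [h3 hA]]; have h3' : sat (ext (size p) v r) (FLes (vars (size p))
    (map (tshift (size p)) p)) by apply/hv.
set r' := ext _ v r in h3' hA.
have h4 := soundness hM h1 (hG' _ v hG) h3'.
exists (evs r' (F k.+1)); split; first by apply/hf.
have := IH _ _ _ _ r' h2 (hG' _ v hG).
rewrite !gm_guard_and !tv_conj; try exact: gm_szok.
rewrite gm_psubst sb_reblock tl_ext hs => h5; exact: (proj2 (h5 (conj h3' hA))).
Qed.

Lemma dred_ext T Q F F' G k (A B : prenex k) :
  (forall i, i <= k -> F i = F' i) -> dred T Q F G A B -> dred T Q F' G A B.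
Proof.
elim: k Q G A B => [//|k IH] Q G [p C] [q E] h.
by case: Q => /=; rewrite h // => -[h1 h2 h3]; split=> //;
  apply: IH h3 => i hi; apply: h; apply: leqW.
Qed.

(** Legality of moves is a hypothesis in [D] but a guard inside the formulas in [dred]. For a legal
    opponent's move both guards are true and can be removed; for an illegal one the opponent's guard
    settles the game favourably. *)
Lemma dred_complete Q G k (A B : prenex k) :
  leS (pol Q) (fun M r => sats r G) A B -> exists F, dred R Q F G A B.
Proof.
elim: k Q G A B => [|k IH] Q G A B.
  move=> h; exists (fun _ => [::]); apply: completeness => M hM r hG.
  by case: Q h => h; apply: (h M hM r hG).
have hG n M (r : nat -> M) :
    sats r (map (fshift n) G) -> sats (tl n r) G.
  move=> h N hN; have := h (fshift n N) (List.in_map _ _ _ hN).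
  by rewrite sat_subst.
have hv n M (r : nat -> M) (ps : seq term) : size ps = n ->
    sat r (FLes (vars n) (map (tshift n) ps)) <-> vle (hd n r) (evs (tl n r) ps).
  move=> hn; rewrite sat_FLes; last by rewrite size_map size_mkseq.
  by rewrite evs_vars evs_tshift.
have hfl n M (r : nat -> M) (f ps : seq term) : size f = size ps ->
    sat r (FLes f (map (tshift n) ps)) <-> vle (evs r f) (evs (tl n r) ps).
  by move=> hn; rewrite sat_FLes ?size_map // evs_tshift.
case: A B => p C [q E]; case: Q; rewrite /leS /le /= !eqxx => -[f [hf hok hD]].
  set vq := FLes (vars (size q)) (map (tshift (size q)) q).
  set fp := FLes f (map (tshift (size q)) p).
  have [|F hF] := IH Exis (map (fshift (size q)) G)
    (pguard FImp fp (psubst (reblock f (size q)) C)) (pguard FImp vq E).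
    apply: (D_case (c := vq)); first exact: qfree_FLes.
      apply: D_shp (D_ext hD _).
      - by move=> i hi; rewrite ltn_eqF // shp_pguard.
      - by move=> i hi; rewrite ltn_eqF // shp_pguard shp_psubst.
      move=> M hM r [h1 h2]; have h3 := proj1 (hv _ _ _ _ erefl) h2.
      have hn : nctx (fun M r => sats r G) (size q)
          (fun M r => @gm M k.+1 (q, E) r) r by split; [apply: hG | exact: h3].
      have h4 := hok M hM r hn.
      have gE b (P : Prop) : b -> (b -> P) = P.
        by move=> hb; apply: propext; split=> [|hP _ //]; apply.
      split=> //.
        rewrite gm_guard_imp lmap_id => [|P]; last exact: gE.
        by rewrite /nopp /= ext_hd.
      rewrite gm_guard_imp lmap_id => [|P]; last by apply: gE; apply/hfl.
      by rewrite /nown gm_psubst sb_reblock hf.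
    apply: D_win => M hM r [h1 h2]; split; try exact: gm_szok.
    by left; apply: pguard_false.
  exists (fun i => if i == k.+1 then f else F i); rewrite eqxx; split=> //.
    apply: completeness => M hM r h1 h2; apply/hfl => //.
    apply: (hok M hM r); split; first exact: hG.
    exact: (proj1 (hv _ _ _ _ erefl) h2).
  apply: dred_ext hF => i hi; rewrite ifF //.
  by apply/eqP => e; rewrite e ltnn in hi.
set up_ := FLes (vars (size p)) (map (tshift (size p)) p).
set fq := FLes f (map (tshift (size p)) q).
have [|F hF] := IH Univ (map (fshift (size p)) G)
  (pguard FAnd up_ C) (pguard FAnd fq (psubst (reblock f (size p)) E)).
  apply: (D_case (c := up_)); first exact: qfree_FLes.
    apply: D_shp (D_ext hD _).
    - by move=> i hi; rewrite ltn_eqF // shp_pguard.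
    - by move=> i hi; rewrite ltn_eqF // shp_pguard shp_psubst.
    move=> M hM r [h1 h2]; have h3 := proj1 (hv _ _ _ _ erefl) h2.
    have hn : nctx (fun M r => sats r G) (size p)
        (fun M r => @gm M k.+1 (p, C) r) r by split; [apply: hG | exact: h3].
    have h4 := hok M hM r hn.
    have gE (b P : Prop) : b -> (b /\ P) = P.
      by move=> hb; apply: propext; split=> [[]|].
    split=> //.
      rewrite gm_guard_and lmap_id => [|P]; last exact: gE.
      by rewrite /nopp /= ext_hd.
    rewrite gm_guard_and lmap_id => [|P]; last by apply: gE; apply/hfl.
    by rewrite /nown gm_psubst sb_reblock hf.
  apply: D_win => M hM r [h1 h2]; split; try exact: gm_szok.
  left; rewrite gm_guard_and; apply: leaves_lmap => P; tauto.
exists (fun i => if i == k.+1 then f else F i); rewrite eqxx; split=> //.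
  apply: completeness => M hM r h1 h2; apply/hfl => //.
  apply: (hok M hM r); split; first exact: hG.
  exact: (proj1 (hv _ _ _ _ erefl) h2).
apply: dred_ext hF => i hi; rewrite ifF //.
by apply/eqP => e; rewrite e ltnn in hi.
Qed.

Lemma le_dred G k (A B : prenex k) :
  le (fun M r => sats r G) A B -> exists F, dred R Univ F G A B.
Proof. exact: (@dred_complete Univ). Qed.

(** * From flows to [dflow] *)

(** The ends of a [dflow] must be equivalent to [A] and [B], while those of a [flow] are related one
    way only. So [A] itself is put at step 0, [H(u - 1)] at the steps from 1 to [t + 1], and [B] at
    step [t + 2]. *)
Lemma flow_dflow k (A B : prenex k) : Uhat A -> Uhat B -> flow A B ->
  dflow qfree R A B.
Proof.
move=> uA uB [t [H [uH h1 h2 h3]]].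
pose t1 := TAdd t TOne; pose s := scons (TSub (Var 0) TOne) (shift 1).
pose c0 := FEq (Var 0) TZero; pose c1 := FLe (Var 0) (tshift 1 t1).
pose A1 := psubst (shift 1) A; pose B1 := psubst (shift 1) B.
pose H2 := pif c1 (psubst s H) B1; pose H1 := pif c0 A1 H2.
have es M (r : nat -> M) : sb s r = econs (ssub (r 0) s1) (tl 1 r).
  by rewrite sb_scons_shift.
have hs0 M (r : nat -> M) : tl 1 (sb (scons TZero Var) r) = r.
  by rewrite sb_scons0.
pose T := TAdd t1 TOne.
have hsT M (r : nat -> M) : tl 1 (sb (scons T Var) r) = r.
  by rewrite sb_scons0.
have le_nil (C E : prenex k) : le top C E -> exists F, dred R Univ F [::] C E.
  by move=> h; apply: le_dred; apply: le_top.
have a0 : le top (psubst (scons TZero Var) H1) A /\ le top A (psubst (scons TZero Var) H1).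
  have [e1 e2] := @psubst_pif_true k top (scons TZero Var) c0 A1 H2
    (fun M hM r _ => erefl).
  have [e3 e4] := le_unshift A top hs0.
  by split; [apply: le_trans e1 e3 | apply: le_trans e4 e2].
have b0 : le top (psubst (scons T Var) H1) B /\ le top B (psubst (scons T Var) H1).
  have hT M : model M R -> forall r : nat -> M, slt (ev r t1) (ev r T).
    by move=> hM r; apply: slt_succ.
  have [|e1 e2] := @psubst_pif_false k top (scons T Var) c0 A1 H2.
    move=> M hM r _; rewrite sb_scons0 /= => e.
    have := hT M hM r; rewrite /= e => /(sltNge hM); apply; exact: sle0.
  have [|e3 e4] := @psubst_pif_false k top (scons T Var) c1 (psubst s H) B1.
    move=> M hM r _; rewrite sb_scons0; apply/(sltNge hM).
    by rewrite ev_tshift tl1_econs; apply: hT.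
  have [e5 e6] := le_unshift B top hsT.
  split; first exact: le_trans e1 (le_trans e3 e5).
  exact: le_trans e6 (le_trans e4 e2).
have hn0 M (hM : model M R) (r : nat -> M) : ~ sat (sb stepv r) c0.
  by move=> /= e; apply: (s1_neq0 hM); apply: (sle0_eq hM); rewrite -e; apply: sle_addl.
have hc1 M (r : nat -> M) :
    sat (sb stepv r) c1 <-> sle (sadd (r 0) s1) (ev (tl 1 r) t1).
  by rewrite /c1 sb_stepv [sat _ _]/= ev_tshift; exact: iff_refl.
have toH G : (forall M, model M R -> forall r : nat -> M, G M r ->
      sle (sadd (r 0) s1) (ev (tl 1 r) t1)) ->
    le G (psubst stepv (psubst s H)) (psubst stepv H1).
  move=> hG; apply: le_trans _ (proj2 (psubst_pif_false _ _ _)).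
    by apply: (proj2 (psubst_pif_true _ _ _)) => M hM r /(hG M hM) /hc1.
  by move=> M hM r _; apply: hn0.
have toB G : (forall M, model M R -> forall r : nat -> M, G M r ->
      ~ sle (sadd (r 0) s1) (ev (tl 1 r) t1)) ->
    le G (psubst stepv B1) (psubst stepv H1).
  move=> hG; apply: le_trans _ (proj2 (psubst_pif_false _ _ _)).
    by apply: (proj2 (psubst_pif_false _ _ _)) => M hM r /(hG M hM) h /hc1.
  by move=> M hM r _; apply: hn0.
have st : le (fun M r => sats r [:: FLt (Var 0) (tshift 1 T)]) H1 (psubst stepv H1).
  set G : ctx := fun M r => _.
  have hG M (r : nat -> M) : G M r -> slt (r 0) (sadd (ev (tl 1 r) t1) s1).
    move=> h; have : slt (r 0) (ev r (tshift 1 T)) := h _ (or_introl erefl).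
    by rewrite ev_tshift.
  apply: (le_case (c := c0)) => //.
    apply: le_trans (proj1 (pif_true _ _ _)) _; first by move=> M hM r [].
    apply: le_trans (le_psubst (t := shift 1) h1 _) _ => //.
    apply: (le_trans (B := psubst stepv (psubst s H))).
      apply: le_psubst_comp2 => M hM r [_ /= e].
      by rewrite es sb_stepv sb_scons0 /= saddK // e.
    by apply: toH => M hM r [_ /= ->]; apply: sle_add => //; [apply: sle0 | apply: slexx].
  have h1u M (hM : model M R) (r : nat -> M) : ~ sat r c0 -> sle s1 (r 0).
    move=> hr; apply: (slt0_le1 hM); split; first exact: sle0.
    by move=> e; apply: hr.
  apply: (le_case (c := FLe (TAdd (Var 0) TOne) (tshift 1 t1))) => //.
    have hc M (r : nat -> M) : sat r (FLe (TAdd (Var 0) TOne) (tshift 1 t1)) ->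
        sle (sadd (r 0) s1) (ev (tl 1 r) t1) by rewrite [sat _ _]/= ev_tshift.
    apply: le_trans (proj1 (pif_false _ _ _)) _; first by move=> M hM r [[]].
    apply: le_trans (proj1 (pif_true _ _ _)) _.
      move=> M hM r [_ /hc h]; rewrite [sat _ _]/= ev_tshift.
      exact: sle_trans (sle_addr hM _ _) h.
    apply: le_trans (le_psubst (t := s) h2 _) _ => //.
    apply: (le_trans (B := psubst stepv (psubst s H))).
      apply: le_psubst_comp2 => M hM r [[_ h] _].
      rewrite sb_stepv !es sb_stepv; congr econs => /=.
      by rewrite saddK // ssubK //; apply: h1u.
    by apply: toH => M hM r [_ /hc].
  have hc M (r : nat -> M) : ~ sat r (FLe (TAdd (Var 0) TOne) (tshift 1 t1)) ->
      ~ sle (sadd (r 0) s1) (ev (tl 1 r) t1) by rewrite [sat _ _]/= ev_tshift.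
  apply: le_trans (proj1 (pif_false _ _ _)) _; first by move=> M hM r [[]].
  apply: le_trans (proj1 (pif_true _ _ _)) _.
    move=> M hM r [[/hG h _] _]; rewrite [sat _ _]/= ev_tshift.
    exact/(sltS_le hM).
  apply: le_trans (le_psubst (t := s) h3 _) _.
    move=> M hM r [[_ h] /hc h']; rewrite es tl1_econs [econs _ _ 0]/=.
    apply/(sle_add2r hM s1); rewrite ssubK //; last exact: h1u.
    by apply/(sltS_le hM); apply/(sltNge hM).
  apply: (le_trans (B := psubst stepv B1)).
    by apply: le_psubst_comp2 => M hM r _; rewrite es sb_stepv.
  by apply: toB => M hM r [_ /hc].
have [E0 hE0] := le_nil _ _ (proj1 a0); have [E1 hE1] := le_nil _ _ (proj2 a0).
have [G0 hG0] := le_nil _ _ (proj1 b0); have [G1 hG1] := le_nil _ _ (proj2 b0).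
have [F hF] := le_dred st.
exists T, H1, E0, E1, G0, G1, F; split=> //.
by apply: Uhat_pif; [|apply: Uhat_psubst | apply: Uhat_pif => //; apply: Uhat_psubst].
Qed.

Lemma dflow_sound k (A B : prenex k) M (r : nat -> M) :
  model M (IU k) -> dflow qfree R A B -> tv true (gm A r) -> tv true (gm B r).
Proof.
move=> hM [t [H [E0 [E1 [G0 [G1 [F [uH [_ h0] [h1 _] hs]]]]]]]] hA.
have hR := IU_R hM.
have nil_ok (r' : nat -> M) : sats r' [::] by [].
have {h0} := dred_sound hR h0 (nil_ok r) hA; rewrite gm_psubst sb_scons0 => h0.
apply: (dred_sound hR h1 (nil_ok r)); rewrite gm_psubst sb_scons0.
(* The steps are available only below [t], so the induction formula is guarded by [u <= t]; the
   guard goes into the matrix and leaves the prefix as it is. *)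
pose I := pguard FImp (FLe (Var 0) (tshift 1 t)) H.
have uI : Uhat I by apply: Uhat_imp.
have hI x : sat (econs x r) (pform Univ I) <->
    (sle x (ev r t) -> tv true (gm H (econs x r))).
  rewrite sat_pform gm_guard_imp tv_imp; last exact: gm_szok.
  by rewrite /= ev_tshift tl1_econs.
suff /hI : sat (econs (ev r t) r) (pform Univ I) by apply; apply: slexx.
have hind : sat r (induction (pform Univ I)) by apply: hM; right; exists I.
rewrite sat_induction in hind; apply: hind; split; first by apply/hI.
move=> x /hI hx; apply/hI => hx1.
have hlt : slt x (ev r t) by apply/(slt_succP hR).
have := dred_sound (r := econs x r) hR hs _ (hx (proj1 hlt)).
rewrite gm_psubst sb_stepv; apply=> N [<-|//] /=.
by rewrite ev_tshift.
Qed.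

(** * Sequents and the equivalence *)

Lemma tv_pBigAnd k (As : seq (prenex k)) M (r : nat -> M) : model M R ->
  sat r (FBigAnd (map (@pform Univ k) As)) <-> tv true (gm (pBigAnd As) r).
Proof.
move=> hM; elim: As => [|A As IH]; first by rewrite tv_pconst.
by rewrite /= -/(pBigAnd As) tv_and // -IH -(sat_pform Univ).
Qed.

Lemma tv_pBigOr k (As : seq (prenex k)) M (r : nat -> M) : model M R ->
  sat r (FBigOr (map (@pform Univ k) As)) <-> tv true (gm (pBigOr As) r).
Proof.
move=> hM; elim: As => [|A As IH]; first by rewrite tv_pconst.
by rewrite /= -/(pBigOr As) tv_or // -IH -(sat_pform Univ).
Qed.

Lemma Uhat_pBigAnd k (As : seq (prenex k)) : all (@Uhat k) As -> Uhat (pBigAnd As).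
Proof.
elim: As => [_|A As IH /= /andP [hA /IH hAs]]; first exact: Uhat_const.
exact: Uhat_and.
Qed.

Lemma Uhat_pBigOr k (As : seq (prenex k)) : all (@Uhat k) As -> Uhat (pBigOr As).
Proof.
elim: As => [_|A As IH /= /andP [hA /IH hAs]]; first exact: Uhat_const.
exact: Uhat_or.
Qed.

Theorem corollary3p1 (k : nat) (Gamma Delta : seq (prenex k))
  (hGamma : all (@Uhat k) Gamma) (hDelta : all (@Uhat k) Delta) :
  proves_seq (IU k) (map (@pform Univ k) Gamma) (map (@pform Univ k) Delta)
  <-> dflow_seq qfree R Gamma Delta.
Proof.
have uG := Uhat_pBigAnd hGamma; have uD := Uhat_pBigOr hDelta.
split=> [h | h].
  have [contr hem] := contraction_em k.
  apply: flow_dflow => //; apply: (flow_complete contr hem) => // M hM r.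
  rewrite -tv_pBigAnd; last exact: IU_R hM.
  rewrite -tv_pBigOr; last exact: IU_R hM.
  exact: (soundness hM h (r := r)).
apply: completeness => M hM r _ /= hG; have hR := IU_R hM.
by apply/tv_pBigOr => //; apply: (dflow_sound hM h); apply/tv_pBigAnd.
Qed.
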